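(* Let $f$ and $g$ be transcendental entire functions of bounded type which are permutable, i.e. $f\circ g=g\circ f$. Then $\overline{I(f)}$ and $\overline{I(g)}$ are completely invariant under $f\circ g$ (a set $E$ is completely invariant under $h$ if $z\in E \iff h(z)\in E$).
   Context: For an entire function $f$, $f^n$ denotes the $n$-th iterate and $I(f)=\{z\in\mathbb{C}: f^n(z)\to\infty\}$ is its escaping set; $\overline{E}$ denotes closure in $\mathbb{C}$. A transcendental entire function is of bounded type if the set of its critical values and finite asymptotic values, together with their finite limit points, is bounded. *)

(* Defs.v *)
From Stdlib Require Import Reals List.
Open Scope R_scope.

Definition Cpx : Type := (R * R)%type.

Definition Cadd (z w : Cpx) : Cpx := (fst z + fst w, snd z + snd w).
Definition Csub (z w : Cpx) : Cpx := (fst z - fst w, snd z - snd w).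
Definition Cmul (z w : Cpx) : Cpx :=
  (fst z * fst w - snd z * snd w, fst z * snd w + snd z * fst w).
Definition Cinv (z : Cpx) : Cpx :=
  let d := fst z * fst z + snd z * snd z in (fst z / d, - snd z / d).
Definition Cdiv (z w : Cpx) : Cpx := Cmul z (Cinv w).
Definition C0 : Cpx := (0, 0).
Definition Cnorm (z : Cpx) : R := sqrt (fst z * fst z + snd z * snd z).

Definition has_cderiv (f : Cpx -> Cpx) (z l : Cpx) : Prop :=
  forall eps, 0 < eps -> exists delta, 0 < delta /\
    forall h : Cpx, h <> C0 -> Cnorm h < delta ->
      Cnorm (Csub (Cdiv (Csub (f (Cadd z h)) (f z)) h) l) < eps.

Definition entire (f : Cpx -> Cpx) : Prop := forall z, exists l, has_cderiv f z l.

Fixpoint peval (cs : list Cpx) (z : Cpx) : Cpx :=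
  match cs with
  | nil => C0
  | a :: cs' => Cadd a (Cmul z (peval cs' z))
  end.

Definition is_polynomial (f : Cpx -> Cpx) : Prop :=
  exists cs : list Cpx, forall z, f z = peval cs z.

Definition transcendental_entire (f : Cpx -> Cpx) : Prop :=
  entire f /\ ~ is_polynomial f.

Definition critical_value (f : Cpx -> Cpx) (w : Cpx) : Prop :=
  exists z, has_cderiv f z C0 /\ f z = w.

Definition asymptotic_value (f : Cpx -> Cpx) (a : Cpx) : Prop :=
  exists gamma : R -> Cpx,
    (forall t, 0 <= t -> forall eps, 0 < eps -> exists delta, 0 < delta /\
        forall s, 0 <= s -> Rabs (s - t) < delta ->
          Cnorm (Csub (gamma s) (gamma t)) < eps) /\
    (forall M, exists T, forall t, T <= t -> M < Cnorm (gamma t)) /\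
    (forall eps, 0 < eps -> exists T, forall t, T <= t ->
        Cnorm (Csub (f (gamma t)) a) < eps).

Definition sing_values (f : Cpx -> Cpx) (w : Cpx) : Prop :=
  critical_value f w \/ asymptotic_value f w.

Definition limit_point (E : Cpx -> Prop) (w : Cpx) : Prop :=
  forall eps, 0 < eps -> exists s, E s /\ s <> w /\ Cnorm (Csub s w) < eps.

Definition sing_set (f : Cpx -> Cpx) (w : Cpx) : Prop :=
  sing_values f w \/ limit_point (sing_values f) w.

Definition bounded_set (E : Cpx -> Prop) : Prop :=
  exists M, forall w, E w -> Cnorm w <= M.

Definition bounded_type (f : Cpx -> Cpx) : Prop :=
  transcendental_entire f /\ bounded_set (sing_set f).

Definition iterate (f : Cpx -> Cpx) (n : nat) (z : Cpx) : Cpx := Nat.iter n f z.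

Definition escaping_set (f : Cpx -> Cpx) (z : Cpx) : Prop :=
  forall M, exists N, forall n, (N <= n)%nat -> M < Cnorm (iterate f n z).

Definition closure (E : Cpx -> Prop) (z : Cpx) : Prop :=
  forall eps, 0 < eps -> exists w, E w /\ Cnorm (Csub w z) < eps.

Definition completely_invariant (E : Cpx -> Prop) (h : Cpx -> Cpx) : Prop :=
  forall z, E z <-> E (h z).

(* Main.v *)
(** Write [z = exp s].  Let [f] be of bounded type and [R = exp L] a bound for its singular values
    and for [|f|] on the unit disc.  Over [{|w| > R}] paths lift through [f], so
    [s |-> f (exp s)] has inverse branches [psi] on the half-plane [{Re > L}].  If [{|f| > R}]
    contained circles of arbitrarily large radius, some [psi] would satisfy
    [psi (z + 2 pi i m) = psi z + 2 pi i] with [m <> 0], and the Schwarz lemma would bound the growth of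
    [f] on these circles by a power, making [f] a polynomial.  Hence the image of [psi] contains no
    large disc, and Bloch's theorem yields the Eremenko-Lyubich estimate
    [|psi' z| <= K / (Re z - L)]: in the coordinate [s] the map is strongly expanding where it is large.

    Let [z] escape under [f] and let [U] be a neighbourhood of [z].  By expansion [f^n (U)] contains,
    for large [n], the exponential of a disc of radius 10, so a whole circle and on it a maximum of
    [|g|]; by expansion of [g] there, [g (f^n (U)) = f^n (g (U))] contains the exponential of another
    disc of radius 10 far to the right.  Such a set contains a point escaping under [f], by iterating the
    same covering argument for [f].  Thus [g] maps the escaping set of [f] into its closure; the
    remaining inclusions follow from continuity and the open mapping theorem.

    The function theory is derived from complex differentiability alone: Goursat's lemma in the
    coordinate [a + exp s] gives the mean value inequality, and everything else (Cauchy's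
    estimate, regularity, the maximum principle, open mapping) is deduced from that inequality. *)

Require Import Defs.
From Stdlib Require Import Reals ZArith Lra Lia Psatz Classical ClassicalEpsilon List.
From Coquelicot Require Import Coquelicot.
Open Scope R_scope.

(** That [f^n z] is large does not prevent [g (f^n z)] from being small, so the argument never shows
    that [g] sends an escaping point to an escaping point. Only the converse holds pointwise. This
    is why closures appear, and why the forward inclusion for [g] has to perturb the point. Covering
    spaces and branches of the logarithm are avoided. A path lift breaks down in finite time only by
    running to infinity, and then the endpoint of the path below is an asymptotic value. Inverse
    branches are obtained by lifting along segments of a convex domain, and the dynamical statements
    hold for arbitrary logarithms of the points involved. The bound on the unit disc has two uses.
    It confines every [psi] to the right half-plane, on which the Schwarz lemma and the exclusion of
    large discs both rest. It also bounds [f 0], the only asymptotic value that composing with [exp]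
    can add. *)

Lemma choice (A B : Type) (P : A -> B -> Prop) :
  (forall x, exists y, P x y) -> exists f, forall x, P x (f x).
Proof.
  intro H. exists (fun x => proj1_sig (constructive_indefinite_description _ (H x))).
  intro x. exact (proj2_sig (constructive_indefinite_description _ (H x))).
Qed.

Arguments choice {A B} P _.

(** * Complex differentiability *)

Definition ccont (f : C -> C) (z : C) : Prop :=
  forall eps, 0 < eps -> exists delta, 0 < delta /\
    forall w, Cmod (w - z) < delta -> Cmod (f w - f z) < eps.

(** The quotient-free form also covers [w = z], so sums and compositions need no case distinction;
    [has_cderiv_iff] identifies it with the notion of the theorem. *)
Definition cdiff (f : C -> C) (z l : C) : Prop :=
  forall eps, 0 < eps -> exists delta, 0 < delta /\
    forall w, Cmod (w - z) < delta ->
      Cmod (f w - f z - l * (w - z)) <= eps * Cmod (w - z).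

Lemma Cmod_sub_triangle (a b c : C) : Cmod (a - c) <= Cmod (a - b) + Cmod (b - c).
Proof.
  replace (a - c)%C with ((a - b) + (b - c))%C by ring. apply Cmod_triangle.
Qed.

Lemma Cmod_sub_sym (a b : C) : Cmod (a - b) = Cmod (b - a).
Proof. rewrite <- Cmod_opp. f_equal. ring. Qed.

Lemma Cmod_sub_ge (a b : C) : Cmod a - Cmod b <= Cmod (a - b).
Proof.
  pose proof (Cmod_triangle (a - b) b) as H.
  replace (a - b + b)%C with a in H by ring. lra.
Qed.

Lemma Cmod_sub_le (a b : C) : Cmod (a - b) <= Cmod a + Cmod b.
Proof.
  pose proof (Cmod_triangle a (- b)) as H. rewrite Cmod_opp in H. exact H.
Qed.

Lemma Cmod_sub_self (a : C) : Cmod (a - a) = 0.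
Proof. replace (a - a)%C with (RtoC 0) by ring. apply Cmod_0. Qed.

Lemma Cmod_sub_eq0 (a b : C) : Cmod (a - b) = 0 -> a = b.
Proof.
  intro H. apply Cmod_eq_0 in H.
  replace a with (a - b + b)%C by ring. rewrite H. ring.
Qed.

Lemma Cmod_sub_gt0 (a b : C) : a <> b -> 0 < Cmod (a - b).
Proof.
  intro H. destruct (Cmod_ge_0 (a - b)) as [h|h]; auto.
  exfalso. apply H. apply Cmod_sub_eq0. auto.
Qed.

Lemma Cmod_le_abs (z : C) : Cmod z <= Rabs (fst z) + Rabs (snd z).
Proof.
  unfold Cmod. apply Rsqr_incr_0_var.
  - rewrite Rsqr_sqrt; [|nra]. unfold Rsqr.
    pose proof (Rabs_pos (fst z)). pose proof (Rabs_pos (snd z)).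
    rewrite <- (pow2_abs (fst z)), <- (pow2_abs (snd z)). nra.
  - pose proof (Rabs_pos (fst z)). pose proof (Rabs_pos (snd z)). lra.
Qed.

Lemma fst_le_Cmod (z : C) : Rabs (fst z) <= Cmod z.
Proof. eapply Rle_trans; [apply Rmax_l | apply Rmax_Cmod]. Qed.

Lemma snd_le_Cmod (z : C) : Rabs (snd z) <= Cmod z.
Proof. eapply Rle_trans; [apply Rmax_r | apply Rmax_Cmod]. Qed.

Lemma fst_bounds (z : C) : - Cmod z <= fst z <= Cmod z.
Proof. apply Rabs_le_between, fst_le_Cmod. Qed.

Lemma Cmod_sq (z : C) : Cmod z * Cmod z = fst z * fst z + snd z * snd z.
Proof. unfold Cmod. rewrite sqrt_sqrt; nra. Qed.

Lemma fst_conj_mul (z : C) : fst (Cconj z * z)%C = Cmod z * Cmod z.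
Proof. rewrite Cmod_sq. simpl. ring. Qed.

Lemma le_eps_mul (a b : R) : 0 <= b -> (forall eps, 0 < eps -> a <= eps * b) -> a <= 0.
Proof.
  intros Hb H. destruct (Rle_or_lt a 0) as [h|h]; auto. exfalso.
  assert (h2 := H (a / (2 * (b + 1)))).
  assert (0 < a / (2 * (b + 1))) by (apply Rdiv_lt_0_compat; lra).
  specialize (h2 H0).
  assert (a / (2 * (b + 1)) * (2 * (b + 1)) = a) by (field; lra).
  nra.
Qed.

Lemma cdiff_bound (f : C -> C) (z l : C) :
  cdiff f z l -> exists delta, 0 < delta /\ forall w, Cmod (w - z) < delta ->
    Cmod (f w - f z) <= (Cmod l + 1) * Cmod (w - z).
Proof.
  intros H. destruct (H 1 Rlt_0_1) as [d [Hd H1]]. exists d; split; auto.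
  intros w Hw. specialize (H1 w Hw).
  replace (f w - f z)%C with ((f w - f z - l * (w - z)) + l * (w - z))%C by ring.
  eapply Rle_trans; [apply Cmod_triangle|]. rewrite Cmod_mult. lra.
Qed.

Lemma cdiff_cont (f : C -> C) (z l : C) : cdiff f z l -> ccont f z.
Proof.
  intros H eps He. destruct (cdiff_bound f z l H) as [d [Hd H1]].
  pose proof (Cmod_ge_0 l) as Hl.
  exists (Rmin d (eps / (Cmod l + 2))). split.
  - apply Rmin_glb_lt; auto. apply Rdiv_lt_0_compat; lra.
  - intros w Hw. assert (Hw1 : Cmod (w - z) < d) by (eapply Rlt_le_trans; [apply Hw | apply Rmin_l]).
    assert (Hw2 : Cmod (w - z) < eps / (Cmod l + 2)) by (eapply Rlt_le_trans; [apply Hw | apply Rmin_r]).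
    apply H1 in Hw1. assert (eps / (Cmod l + 2) * (Cmod l + 2) = eps) by (field; lra).
    pose proof (Cmod_ge_0 (w - z)). nra.
Qed.

Lemma cdiff_const (c z : C) : cdiff (fun _ => c) z 0.
Proof.
  intros eps He. exists 1. split; [lra|]. intros w _.
  replace (c - c - 0 * (w - z))%C with (RtoC 0) by ring. rewrite Cmod_0.
  pose proof (Cmod_ge_0 (w - z)). nra.
Qed.

Lemma cdiff_id (z : C) : cdiff (fun x => x) z 1.
Proof.
  intros eps He. exists 1. split; [lra|]. intros w _.
  replace (w - z - 1 * (w - z))%C with (RtoC 0) by ring. rewrite Cmod_0.
  pose proof (Cmod_ge_0 (w - z)). nra.
Qed.

Lemma cdiff_plus (f g : C -> C) (z l m : C) :
  cdiff f z l -> cdiff g z m -> cdiff (fun x => f x + g x)%C z (l + m).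
Proof.
  intros Hf Hg eps He.
  destruct (Hf (eps / 2) ltac:(lra)) as [d1 [Hd1 H1]].
  destruct (Hg (eps / 2) ltac:(lra)) as [d2 [Hd2 H2]].
  exists (Rmin d1 d2). split; [apply Rmin_glb_lt; auto|]. intros w Hw.
  assert (Hw1 := Rlt_le_trans _ _ _ Hw (Rmin_l _ _)).
  assert (Hw2 := Rlt_le_trans _ _ _ Hw (Rmin_r _ _)).
  specialize (H1 w Hw1). specialize (H2 w Hw2).
  replace (f w + g w - (f z + g z) - (l + m) * (w - z))%C
    with ((f w - f z - l * (w - z)) + (g w - g z - m * (w - z)))%C by ring.
  eapply Rle_trans; [apply Cmod_triangle|]. lra.
Qed.

Lemma cdiff_ext_loc (f g : C -> C) (z l : C) (d : R) :
  0 < d -> (forall w, Cmod (w - z) < d -> f w = g w) -> cdiff f z l -> cdiff g z l.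
Proof.
  intros Hd Hfg Hf eps He. destruct (Hf eps He) as [d1 [Hd1 H1]].
  exists (Rmin d d1). split; [apply Rmin_glb_lt; auto|]. intros w Hw.
  assert (Hw1 := Rlt_le_trans _ _ _ Hw (Rmin_l _ _)).
  assert (Hw2 := Rlt_le_trans _ _ _ Hw (Rmin_r _ _)).
  rewrite <- (Hfg w Hw1), <- (Hfg z); [auto|]. rewrite Cmod_sub_self. auto.
Qed.

Lemma cdiff_ext (f g : C -> C) (z l m : C) :
  (forall w, f w = g w) -> l = m -> cdiff f z l -> cdiff g z m.
Proof. intros H <-. apply (cdiff_ext_loc f g z l 1); auto. lra. Qed.

Lemma cdiff_comp (f g : C -> C) (z l m : C) :
  cdiff f z l -> cdiff g (f z) m -> cdiff (fun x => g (f x)) z (m * l).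
Proof.
  intros Hf Hg eps He.
  destruct (cdiff_bound f z l Hf) as [d0 [Hd0 H0]].
  pose proof (Cmod_ge_0 l) as Hl. pose proof (Cmod_ge_0 m) as Hm.
  set (A := Cmod l + 1) in *. set (B := Cmod m + 1).
  assert (HA : 0 < A) by (unfold A; lra). assert (HB : 0 < B) by (unfold B; lra).
  assert (He1 : 0 < eps / (2 * A)) by (apply Rdiv_lt_0_compat; lra).
  assert (He2 : 0 < eps / (2 * B)) by (apply Rdiv_lt_0_compat; lra).
  destruct (Hg _ He1) as [d1 [Hd1 H1]]. destruct (Hf _ He2) as [d2 [Hd2 H2]].
  destruct (cdiff_cont f z l Hf d1 Hd1) as [d3 [Hd3 H3]].
  exists (Rmin d0 (Rmin d2 d3)). split; [repeat apply Rmin_glb_lt; auto|]. intros w Hw.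
  assert (Hw0 := Rlt_le_trans _ _ _ Hw (Rmin_l _ _)).
  assert (Hw1 := Rlt_le_trans _ _ _ Hw (Rmin_r _ _)).
  assert (Hw2 := Rlt_le_trans _ _ _ Hw1 (Rmin_l _ _)).
  assert (Hw3 := Rlt_le_trans _ _ _ Hw1 (Rmin_r _ _)).
  specialize (H0 w Hw0). specialize (H2 w Hw2). specialize (H1 (f w) (H3 w Hw3)).
  replace (g (f w) - g (f z) - m * l * (w - z))%C
    with ((g (f w) - g (f z) - m * (f w - f z)) + m * (f w - f z - l * (w - z)))%C by ring.
  eapply Rle_trans; [apply Cmod_triangle|]. rewrite Cmod_mult.
  pose proof (Cmod_ge_0 (w - z)) as Hn.
  apply Rle_trans with (eps / (2 * A) * (A * Cmod (w - z)) + B * (eps / (2 * B) * Cmod (w - z))).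
  - apply Rplus_le_compat.
    + eapply Rle_trans; [apply H1|]. apply Rmult_le_compat_l; lra.
    + apply Rmult_le_compat; auto using Cmod_ge_0. unfold B; lra.
  - right. field. lra.
Qed.

Lemma cdiff_mult_c (c : C) (f : C -> C) (z l : C) :
  cdiff f z l -> cdiff (fun x => c * f x)%C z (c * l).
Proof.
  intros Hf eps He. pose proof (Cmod_ge_0 c) as Hc.
  assert (He1 : 0 < eps / (Cmod c + 1)) by (apply Rdiv_lt_0_compat; lra).
  destruct (Hf _ He1) as [d [Hd H]]. exists d; split; auto. intros w Hw.
  replace (c * f w - c * f z - c * l * (w - z))%C with (c * (f w - f z - l * (w - z)))%C by ring.
  rewrite Cmod_mult. specialize (H w Hw).
  apply Rle_trans with ((Cmod c + 1) * (eps / (Cmod c + 1) * Cmod (w - z))).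
  - apply Rmult_le_compat; auto using Cmod_ge_0. lra.
  - right. field. lra.
Qed.

Lemma cdiff_minus (f g : C -> C) (z l m : C) :
  cdiff f z l -> cdiff g z m -> cdiff (fun x => f x - g x)%C z (l - m).
Proof.
  intros Hf Hg. apply (cdiff_ext (fun x => f x + (- (1)) * g x)%C _ z (l + (- (1)) * m)%C).
  - intros; ring.
  - ring.
  - apply cdiff_plus; auto. apply cdiff_mult_c; auto.
Qed.

Lemma cdiff_sqr (z : C) : cdiff (fun x => x * x)%C z (2 * z).
Proof.
  intros eps He. exists eps; split; auto. intros w Hw.
  replace (w * w - z * z - 2 * z * (w - z))%C with ((w - z) * (w - z))%C by ring.
  rewrite Cmod_mult. apply Rmult_le_compat_r; [apply Cmod_ge_0 | lra].
Qed.

(* Polarisation reduces products to squares. *)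
Lemma cdiff_mult (f g : C -> C) (z l m : C) :
  cdiff f z l -> cdiff g z m -> cdiff (fun x => f x * g x)%C z (l * g z + f z * m).
Proof.
  intros Hf Hg.
  assert (Hp := cdiff_comp _ _ _ _ _ (cdiff_plus _ _ _ _ _ Hf Hg) (cdiff_sqr _)).
  assert (Hm := cdiff_comp _ _ _ _ _ (cdiff_minus _ _ _ _ _ Hf Hg) (cdiff_sqr _)).
  assert (H := cdiff_mult_c (/ 4)%C _ _ _ (cdiff_minus _ _ _ _ _ Hp Hm)).
  assert (H4 : RtoC 4 <> 0%C) by (intro E; injection E; lra).
  revert H. apply cdiff_ext.
  - intros w. cbv beta; field; auto.
  - cbv beta; field; auto.
Qed.

Lemma cdiff_Cinv (z : C) : z <> 0%C -> cdiff Cinv z (- / (z * z)).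
Proof.
  intros Hz eps He. assert (Hz0 : 0 < Cmod z) by (apply Cmod_gt_0; auto).
  set (a := Cmod z) in *.
  (* The remainder is [(w - z)^2 / (w z^2)]. The first radius keeps [Cmod w] above [a / 2]; the
     second then gives the factor [eps]. *)
  exists (Rmin (a / 2) (eps * (a * a * a) / 2)). split.
  { apply Rmin_glb_lt; [lra|]. assert (0 < a * a * a) by (repeat apply Rmult_lt_0_compat; auto).
    nra. }
  intros w Hw.
  assert (Hw1 := Rlt_le_trans _ _ _ Hw (Rmin_l _ _)).
  assert (Hw2 := Rlt_le_trans _ _ _ Hw (Rmin_r _ _)).
  assert (Hwa : a / 2 <= Cmod w).
  { pose proof (Cmod_sub_ge z w). rewrite Cmod_sub_sym in H. unfold a in *. lra. }
  assert (Hw0 : w <> 0%C) by (apply Cmod_gt_0; lra).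
  replace (/ w - / z - - / (z * z) * (w - z))%C
    with ((w - z) * ((w - z) / (w * (z * z))))%C by (field; auto).
  rewrite Cmod_mult, Cmod_div, !Cmod_mult.
  2:{ repeat apply Cmult_neq_0; auto. }
  fold a. rewrite Rmult_comm. apply Rmult_le_compat_r; [apply Cmod_ge_0|].
  assert (0 < a * a) by nra.
  apply Rle_div_l; [nra|].
  assert (0 <= eps * (a * a)) by nra.
  assert (eps * (a * a) * (a / 2) <= eps * (a * a) * Cmod w) by (apply Rmult_le_compat_l; auto).
  lra.
Qed.

Lemma cdiff_inv (f : C -> C) (z l : C) :
  f z <> 0%C -> cdiff f z l -> cdiff (fun x => / f x)%C z (- / (f z * f z) * l).
Proof. intros Hz Hf. apply (cdiff_comp f Cinv); auto. apply cdiff_Cinv; auto. Qed.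

Lemma cdiff_sub_c (f : C -> C) (c z l : C) : cdiff f z l -> cdiff (fun x => f x - c)%C z l.
Proof.
  intro H. apply (cdiff_ext (fun x => f x - c)%C _ z (l - 0)%C); auto; [ring|].
  apply cdiff_minus; auto. apply cdiff_const.
Qed.

Lemma cdiff_shift (f : C -> C) (c z l : C) : cdiff f (z + c)%C l -> cdiff (fun x => f (x + c)%C) z l.
Proof.
  intros H eps He. destruct (H eps He) as [d [Hd H1]]. exists d; split; auto.
  intros w Hw. replace (w - z)%C with (w + c - (z + c))%C in * by ring. auto.
Qed.

Lemma ccont_comp (f g : C -> C) (z : C) : ccont f z -> ccont g (f z) -> ccont (fun x => g (f x)) z.
Proof.
  intros Hf Hg eps He. destruct (Hg eps He) as [d [Hd H]].
  destruct (Hf d Hd) as [d1 [Hd1 H1]]. exists d1; auto.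
Qed.

(** * The exponential *)

Definition cexp (z : C) : C := (exp (fst z) * cos (snd z), exp (fst z) * sin (snd z)).

Lemma cexp_plus (z w : C) : cexp (z + w)%C = (cexp z * cexp w)%C.
Proof.
  unfold cexp. simpl. rewrite exp_plus, cos_plus, sin_plus. unfold Cmult. simpl.
  f_equal; ring.
Qed.

Lemma Cmod_cexp (z : C) : Cmod (cexp z) = exp (fst z).
Proof.
  pose proof (exp_pos (fst z)).
  apply Rsqr_inj; [apply Cmod_ge_0 | lra|]. unfold Rsqr. rewrite Cmod_sq. simpl.
  pose proof (sin2_cos2 (snd z)) as H1. unfold Rsqr in H1. nra.
Qed.

Lemma cexp_neq0 (z : C) : cexp z <> 0%C.
Proof. apply Cmod_gt_0. rewrite Cmod_cexp. apply exp_pos. Qed.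

Lemma cexp_0 : cexp 0 = 1%C.
Proof. unfold cexp. simpl. rewrite exp_0, cos_0, sin_0. unfold RtoC. f_equal; ring. Qed.

Lemma derivable_pt_lim_le (f : R -> R) (x l eps : R) :
  derivable_pt_lim f x l -> 0 < eps -> exists d, 0 < d /\ forall h, Rabs h < d ->
    Rabs (f (x + h) - f x - l * h) <= eps * Rabs h.
Proof.
  intros H He. destruct (H eps He) as [d Hd]. exists d. split; [apply cond_pos|].
  intros h Hh. destruct (Req_dec h 0) as [->|Hn].
  - rewrite Rplus_0_r. replace (f x - f x - l * 0) with 0 by ring. rewrite Rabs_R0. lra.
  - specialize (Hd h Hn Hh).
    replace (f (x + h) - f x - l * h) with (((f (x + h) - f x) / h - l) * h) by (field; auto).
    rewrite Rabs_mult. apply Rmult_le_compat_r; [apply Rabs_pos | lra].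
Qed.

Lemma cdiff_cexp_0 : cdiff cexp 0 1.
Proof.
  (* In real and imaginary parts the remainder consists of four products, bounded by 1, 2, 2 and 1
     times [e * Cmod w]; the divisor 8 leaves room for their sum 6. *)
  intros eps He. set (e := Rmin (eps / 8) 1).
  assert (He0 : 0 < e) by (apply Rmin_glb_lt; lra).
  assert (He1 : e <= eps / 8) by apply Rmin_l. assert (He2 : e <= 1) by apply Rmin_r.
  destruct (derivable_pt_lim_le _ _ _ e (derivable_pt_lim_exp 0) He0) as [d1 [Hd1 H1]].
  destruct (derivable_pt_lim_le _ _ _ e (derivable_pt_lim_cos 0) He0) as [d2 [Hd2 H2]].
  destruct (derivable_pt_lim_le _ _ _ e (derivable_pt_lim_sin 0) He0) as [d3 [Hd3 H3]].
  exists (Rmin (e / 2) (Rmin d1 (Rmin d2 d3))).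
  split; [repeat apply Rmin_glb_lt; lra|]. intros w Hw.
  assert (Hw0 := Rlt_le_trans _ _ _ Hw (Rmin_l _ _)).
  assert (Hw' := Rlt_le_trans _ _ _ Hw (Rmin_r _ _)).
  assert (Hw1 := Rlt_le_trans _ _ _ Hw' (Rmin_l _ _)).
  assert (Hw'' := Rlt_le_trans _ _ _ Hw' (Rmin_r _ _)).
  assert (Hw2 := Rlt_le_trans _ _ _ Hw'' (Rmin_l _ _)).
  assert (Hw3 := Rlt_le_trans _ _ _ Hw'' (Rmin_r _ _)).
  replace (w - 0)%C with w in * by ring. rewrite cexp_0.
  pose proof (fst_le_Cmod w) as Fx. pose proof (snd_le_Cmod w) as Fy.
  set (x := fst w) in *. set (y := snd w) in *.
  specialize (H1 x ltac:(lra)). specialize (H2 y ltac:(lra)). specialize (H3 y ltac:(lra)).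
  rewrite Rplus_0_l, exp_0 in H1. rewrite Rplus_0_l, cos_0, sin_0 in H2.
  rewrite Rplus_0_l, cos_0, sin_0 in H3.
  eapply Rle_trans; [apply Cmod_le_abs|].
  replace (fst (cexp w - 1 - 1 * w)%C) with ((exp x - 1 - 1 * x) * cos y + (cos y - 1 - - 0 * y) * (1 + x))
    by (unfold cexp; simpl; fold x y; ring).
  replace (snd (cexp w - 1 - 1 * w)%C) with (exp x * (sin y - 0 - 1 * y) + (exp x - 1) * y)
    by (unfold cexp; simpl; fold x y; ring).
  assert (Hc : Rabs (cos y) <= 1) by (apply Rabs_le; apply COS_bound).
  assert (Hx1 : Rabs (1 + x) <= 2).
  { eapply Rle_trans; [apply Rabs_triang|]. rewrite Rabs_R1. lra. }
  assert (Hex : Rabs (exp x - 1) <= e).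
  { replace (exp x - 1) with ((exp x - 1 - 1 * x) + x) by ring.
    eapply Rle_trans; [apply Rabs_triang|]. pose proof (Rabs_pos x). nra. }
  assert (Hex2 : Rabs (exp x) <= 2).
  { replace (exp x) with ((exp x - 1) + 1) by ring.
    eapply Rle_trans; [apply Rabs_triang|]. rewrite Rabs_R1. lra. }
  pose proof (Cmod_ge_0 w) as Hn.
  assert (A1 : Rabs ((exp x - 1 - 1 * x) * cos y) <= e * Cmod w * 1).
  { rewrite Rabs_mult. apply Rmult_le_compat; auto using Rabs_pos. nra. }
  assert (A2 : Rabs ((cos y - 1 - - 0 * y) * (1 + x)) <= e * Cmod w * 2).
  { rewrite Rabs_mult. apply Rmult_le_compat; auto using Rabs_pos. nra. }
  assert (A3 : Rabs (exp x * (sin y - 0 - 1 * y)) <= 2 * (e * Cmod w)).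
  { rewrite Rabs_mult. apply Rmult_le_compat; auto using Rabs_pos. nra. }
  assert (A4 : Rabs ((exp x - 1) * y) <= e * Cmod w).
  { rewrite Rabs_mult. apply Rmult_le_compat; auto using Rabs_pos. }
  pose proof (Rabs_triang ((exp x - 1 - 1 * x) * cos y) ((cos y - 1 - - 0 * y) * (1 + x))).
  pose proof (Rabs_triang (exp x * (sin y - 0 - 1 * y)) ((exp x - 1) * y)).
  nra.
Qed.

Lemma cdiff_cexp (z : C) : cdiff cexp z (cexp z).
Proof.
  apply (cdiff_ext (fun w => cexp z * cexp (w + - z))%C _ z (cexp z * 1)%C).
  - intros w. rewrite <- cexp_plus. f_equal. ring.
  - ring.
  - apply cdiff_mult_c. apply cdiff_shift. replace (z + - z)%C with (RtoC 0) by ring.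
    apply cdiff_cexp_0.
Qed.

Lemma unit_angle (a b : R) : a * a + b * b = 1 -> exists t, - PI <= t <= PI /\ cos t = a /\ sin t = b.
Proof.
  intro H. assert (Ha : -1 <= a <= 1) by nra.
  pose proof (acos_bound a) as Hb. pose proof PI_RGT_0.
  assert (Hs : sqrt (1 - a²) = Rabs b).
  { replace (1 - a²) with (b²) by (unfold Rsqr; lra). apply sqrt_Rsqr_abs. }
  destruct (Rle_or_lt 0 b) as [h|h].
  - exists (acos a). repeat split; try lra. apply cos_acos; auto.
    rewrite sin_acos, Hs by auto. apply Rabs_pos_eq; auto.
  - exists (- acos a). repeat split; try lra. rewrite cos_neg. apply cos_acos; auto.
    rewrite sin_neg, sin_acos, Hs by auto. rewrite Rabs_left; lra.
Qed.

(** Dividing by [cexp s] leaves a point of the unit circle. What matters is the bound [PI] on the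
    shift: a disc about [s] of radius above [PI] is mapped onto a set containing the whole circle
    through [cexp s]. *)
Lemma cexp_surj_near (w s : C) : Cmod w = exp (fst s) ->
  exists t, - PI <= t <= PI /\ cexp (s + (0, t))%C = w.
Proof.
  intro H. pose proof (cexp_neq0 s) as Hs.
  set (q := (w / cexp s)%C).
  assert (Hq : Cmod q = 1).
  { unfold q. rewrite Cmod_div, H, Cmod_cexp by auto. field. pose proof (exp_pos (fst s)); lra. }
  pose proof (Cmod_sq q) as Hq2. rewrite Hq in Hq2.
  destruct (unit_angle (fst q) (snd q)) as [t [Ht [Hc Hs2]]]; [lra|].
  exists t. split; auto. rewrite cexp_plus.
  replace (cexp (0, t)) with q.
  - unfold q. field. auto.
  - unfold cexp. simpl. rewrite exp_0, Hc, Hs2, !Rmult_1_l. apply surjective_pairing.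
Qed.

Lemma cexp_surj (w : C) : w <> 0%C -> exists s, cexp s = w /\ fst s = ln (Cmod w).
Proof.
  intro H. apply Cmod_gt_0 in H.
  destruct (cexp_surj_near w (ln (Cmod w), 0)) as [t [_ Ht]].
  - simpl. rewrite exp_ln; auto.
  - eexists; split; [apply Ht|]. simpl. ring.
Qed.

Lemma cexp_period (s : C) (m : Z) : cexp (s + (0, (2 * PI * IZR m)%R))%C = cexp s.
Proof.
  assert (H : forall n : nat, cexp (s + (0, (2 * INR n * PI)%R))%C = cexp s).
  { intro n. unfold cexp. simpl. rewrite Rplus_0_r.
    rewrite cos_period, sin_period. auto. }
  destruct (Z.le_gt_cases 0 m) as [h|h].
  - rewrite <- (H (Z.to_nat m)). rewrite INR_IZR_INZ, Z2Nat.id by auto.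
    do 3 f_equal. ring.
  - assert (E : IZR m = - INR (Z.to_nat (- m))).
    { rewrite INR_IZR_INZ, Z2Nat.id, opp_IZR by lia. ring. }
    rewrite E. set (n := Z.to_nat (- m)). unfold cexp. simpl. rewrite Rplus_0_r.
    rewrite <- (cos_period (snd s + 2 * PI * - INR n) n).
    rewrite <- (sin_period (snd s + 2 * PI * - INR n) n).
    replace (snd s + 2 * PI * - INR n + 2 * INR n * PI) with (snd s) by ring. auto.
Qed.

Lemma cexp_eq (s t : C) : cexp s = cexp t -> exists m : Z, t = (s + (0, (2 * PI * IZR m)%R))%C.
Proof.
  intro H.
  assert (H1 : fst s = fst t).
  { apply exp_inv. rewrite <- !Cmod_cexp, H. auto. }
  unfold cexp in H. rewrite H1 in H. injection H as Ha Hb.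
  pose proof (exp_pos (fst t)).
  apply Rmult_eq_reg_l in Ha; [|lra]. apply Rmult_eq_reg_l in Hb; [|lra].
  (* With half the difference of the arguments, [cos (2 d) = 1] becomes [sin d = 0], whose solutions
     are the multiples of [PI]. *)
  set (d := (snd t - snd s) / 2).
  assert (Hd : sin d = 0).
  { assert (Hc : cos (2 * d) = 1).
    { unfold d. replace (2 * ((snd t - snd s) / 2)) with (snd t - snd s) by field.
      rewrite cos_minus, Ha, Hb. pose proof (sin2_cos2 (snd t)) as E. unfold Rsqr in E. lra. }
    rewrite cos_2a_sin in Hc. nra. }
  apply sin_eq_0_0 in Hd. destruct Hd as [k Hk]. exists k.
  unfold d in Hk. destruct s as [s1 s2], t as [t1 t2]. simpl in *. subst.
  unfold Cplus. simpl. f_equal; [ring|]. lra.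
Qed.

(** * Mean value inequality and compactness *)

Definition seg (a b : C) (t : R) : C := (a + RtoC t * (b - a))%C.

Lemma seg_0 (a b : C) : seg a b 0 = a.
Proof. unfold seg. ring. Qed.

Lemma seg_1 (a b : C) : seg a b 1 = b.
Proof. unfold seg. ring. Qed.

Lemma seg_sub (a b : C) (s t : R) : Cmod (seg a b s - seg a b t) = Rabs (s - t) * Cmod (b - a).
Proof.
  unfold seg. rewrite <- Cmod_R, <- Cmod_mult. f_equal.
  rewrite RtoC_minus. ring.
Qed.

Lemma seg_in_disc (c a b : C) (r t : R) : 0 <= t <= 1 ->
  Cmod (a - c) < r -> Cmod (b - c) < r -> Cmod (seg a b t - c) < r.
Proof.
  intros Ht Ha Hb. unfold seg.
  replace (a + t * (b - a) - c)%C with (RtoC (1 - t) * (a - c) + RtoC t * (b - c))%C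
    by (rewrite RtoC_minus; ring).
  eapply Rle_lt_trans; [apply Cmod_triangle|].
  rewrite !Cmod_mult, !Cmod_R, !Rabs_pos_eq by lra.
  destruct (Req_dec t 1) as [->|]; nra.
Qed.

(** Apply the real mean value theorem to the real part of [Cconj (h b - h a) * h] along the segment:
    its increment is the square of [Cmod (h b - h a)], and one factor cancels. *)
Lemma mean_value_ineq (h dh : C -> C) (a b : C) (N : R) :
  (forall t, 0 <= t <= 1 -> cdiff h (seg a b t) (dh (seg a b t)) /\ Cmod (dh (seg a b t)) <= N) ->
  Cmod (h b - h a) <= N * Cmod (b - a).
Proof.
  intros H. set (c := Cconj (h b - h a)%C).
  destruct (MVT_cor2 (fun t => fst (c * h (seg a b t))%C)
    (fun t => fst (c * (dh (seg a b t) * (b - a)))%C) 0 1 Rlt_0_1) as [xi [E Hxi]].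
  - intros t Ht. destruct (H t Ht) as [Hd _]. clear H.
    intros eps He.
    pose proof (Cmod_ge_0 c) as Hc. pose proof (Cmod_ge_0 (b - a)) as Hba.
    set (K := (Cmod c + 1) * (Cmod (b - a) + 1)).
    assert (HK : 0 < K) by (unfold K; nra).
    destruct (Hd (eps / (2 * K))) as [d [Hd0 H1]]; [apply Rdiv_lt_0_compat; lra|].
    assert (Hd' : 0 < d / (Cmod (b - a) + 1)) by (apply Rdiv_lt_0_compat; lra).
    exists (mkposreal _ Hd'). intros s Hs Hs1. simpl pos in Hs1.
    specialize (H1 (seg a b (t + s))). rewrite seg_sub in H1.
    replace (t + s - t) with s in H1 by ring.
    pose proof (Rabs_pos s) as Hsp.
    assert (Hs2 : Rabs s * Cmod (b - a) < d).
    { apply Rlt_div_r in Hs1; [|lra]. nra. }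
    specialize (H1 Hs2).
    set (A := (h (seg a b (t + s)) - h (seg a b t) - dh (seg a b t) * (seg a b (t + s) - seg a b t))%C) in *.
    assert (EA : (fst (c * h (seg a b (t + s)))%C - fst (c * h (seg a b t))%C) / s
                 - fst (c * (dh (seg a b t) * (b - a)))%C = fst (c * A)%C / s).
    { unfold A. replace (seg a b (t + s) - seg a b t)%C with (RtoC s * (b - a))%C
        by (unfold seg; rewrite RtoC_plus; ring).
      simpl. field. auto. }
    cbv beta. rewrite EA. unfold Rdiv. rewrite Rabs_mult, Rabs_inv.
    assert (Hsa : 0 < Rabs s) by (apply Rabs_pos_lt; auto).
    apply Rlt_div_l; [auto|].
    eapply Rle_lt_trans; [apply fst_le_Cmod|]. rewrite Cmod_mult.
    apply Rle_lt_trans with (Cmod c * (eps / (2 * K) * (Rabs s * Cmod (b - a)))).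
    { apply Rmult_le_compat_l; auto. }
    apply Rle_lt_trans with ((eps / (2 * K) * K) * Rabs s).
    { assert (0 < eps / (2 * K)) by (apply Rdiv_lt_0_compat; lra).
      assert (Cmod c * Cmod (b - a) <= K) by (unfold K; nra).
      replace (Cmod c * (eps / (2 * K) * (Rabs s * Cmod (b - a))))
        with (eps / (2 * K) * (Cmod c * Cmod (b - a)) * Rabs s) by ring.
      apply Rmult_le_compat_r; auto. apply Rmult_le_compat_l; lra. }
    replace (eps / (2 * K) * K) with (eps / 2) by (field; lra). nra.
  - rewrite seg_0, seg_1 in E.
    assert (E2 : fst (c * h b)%C - fst (c * h a)%C = Cmod (h b - h a) * Cmod (h b - h a)).
    { rewrite <- fst_conj_mul. fold c. simpl. ring. }
    rewrite E2 in E.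
    destruct (H xi) as [_ HN]; [lra|].
    pose proof (fst_bounds (c * (dh (seg a b xi) * (b - a)))%C) as [_ Hb].
    rewrite !Cmod_mult in Hb. unfold c in Hb. rewrite Cmod_conj in Hb. fold c in Hb.
    pose proof (Cmod_ge_0 (h b - h a)) as P. pose proof (Cmod_ge_0 (b - a)) as Q.
    destruct (Req_dec (Cmod (h b - h a)) 0) as [->|Hn].
    { pose proof (Cmod_ge_0 (dh (seg a b xi))). nra. }
    apply Rmult_le_reg_l with (Cmod (h b - h a)); [lra|].
    rewrite E, Rminus_0_r, Rmult_1_r. eapply Rle_trans; [apply Hb|].
    apply Rmult_le_compat_l; auto. apply Rmult_le_compat_r; auto.
Qed.

Lemma mean_value_disc (h dh : C -> C) (c a b : C) (r N : R) :
  (forall z, Cmod (z - c) < r -> cdiff h z (dh z)) ->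
  (forall z, Cmod (z - c) < r -> Cmod (dh z) <= N) ->
  Cmod (a - c) < r -> Cmod (b - c) < r ->
  Cmod (h b - h a) <= N * Cmod (b - a).
Proof.
  intros H1 H2 Ha Hb. apply mean_value_ineq with dh.
  intros t Ht. assert (Cmod (seg a b t - c) < r) by (apply seg_in_disc; auto). auto.
Qed.

Lemma real_cluster (u : nat -> R) (M : R) : (forall n, Rabs (u n) <= M) ->
  exists l, forall eps, 0 < eps -> forall N : nat, exists n, (N <= n)%nat /\ Rabs (u n - l) < eps.
Proof.
  intro H. destruct (Bolzano_Weierstrass u (fun x => - M <= x <= M)) as [l Hl].
  - apply compact_P3.
  - intro n. apply Rabs_le_between, H.
  - exists l. intros eps He N. destruct (Hl (disc l (mkposreal eps He)) N) as [p [Hp Hd]].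
    + exists (mkposreal eps He). intros x Hx; exact Hx.
    + exists p; split; auto.
Qed.

(** First fix indices [phi] along which the real parts converge at rate [/ (INR k + 1)]; a cluster
    point of the imaginary parts along [phi] supplies the second coordinate. *)
Lemma C_cluster (u : nat -> C) (M : R) : (forall n, Cmod (u n) <= M) ->
  exists l, forall eps, 0 < eps -> forall N : nat, exists n, (N <= n)%nat /\ Cmod (u n - l) < eps.
Proof.
  intro H. destruct (real_cluster (fun n => fst (u n)) M) as [l1 H1].
  { intro n. eapply Rle_trans; [apply fst_le_Cmod | apply H]. }
  destruct (choice (fun k n => (k <= n)%nat /\ Rabs (fst (u n) - l1) < / (INR k + 1))) as [phi Hphi].
  { intro k. apply H1. apply Rinv_0_lt_compat. pose proof (pos_INR k). lra. }
  destruct (real_cluster (fun k => snd (u (phi k))) M) as [l2 H2].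
  { intro n. eapply Rle_trans; [apply snd_le_Cmod | apply H]. }
  exists (l1, l2). intros eps He N.
  destruct (archimed_cor1 (eps / 2)) as [K [HK HK0]]; [lra|].
  destruct (H2 (eps / 2) ltac:(lra) (max N K)) as [k [Hk Hk2]].
  destruct (Hphi k) as [Hp1 Hp2]. exists (phi k). split; [lia|].
  eapply Rle_lt_trans; [apply Cmod_le_abs|]. simpl.
  assert (/ (INR k + 1) <= / INR K).
  { apply Rinv_le_contravar; [apply lt_0_INR; lia|].
    assert (INR K <= INR k) by (apply le_INR; lia). lra. }
  unfold Rminus in *. lra.
Qed.

Definition rcont (u : C -> R) (z : C) : Prop :=
  forall eps, 0 < eps -> exists delta, 0 < delta /\
    forall w, Cmod (w - z) < delta -> Rabs (u w - u z) < eps.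

Lemma compact_max (K : C -> Prop) (u : C -> R) (M : R) (p0 : C) :
  K p0 -> (forall z, K z -> Cmod z <= M) ->
  (forall z, (forall eps, 0 < eps -> exists w, K w /\ Cmod (w - z) < eps) -> K z) ->
  (forall z, K z -> rcont u z) ->
  exists p, K p /\ forall z, K z -> u z <= u p.
Proof.
  intros H0 HM Hcl Hu.
  assert (Hbd : exists B, forall z, K z -> u z <= B).
  { apply NNPP. intro Hn.
    destruct (choice (fun n z => K z /\ INR n < u z)) as [z Hz].
    { intro n. apply NNPP. intro Hc. apply Hn. exists (INR n). intros w Hw.
      apply Rnot_lt_le. intro. apply Hc. eauto. }
    destruct (C_cluster z M) as [l Hl]; [intro n; apply HM, Hz|].
    assert (Kl : K l). { apply Hcl. intros eps He. destruct (Hl eps He O) as [n [_ Hn2]]. exists (z n). split; auto. apply Hz. }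
    destruct (Hu l Kl 1 Rlt_0_1) as [d [Hd Hd2]].
    destruct (INR_unbounded (u l + 1)) as [N HN].
    destruct (Hl d Hd N) as [n [Hn1 Hn2]]. specialize (Hd2 _ Hn2).
    destruct (Hz n) as [_ Hz2]. apply le_INR in Hn1. apply Rabs_def2 in Hd2. lra. }
  destruct (completeness (fun y => exists z, K z /\ u z = y)) as [S [HS1 HS2]].
  { destruct Hbd as [B HB]. exists B. intros y [z [Hz <-]]. auto. }
  { exists (u p0). eauto. }
  destruct (choice (fun n z => K z /\ S - / (INR n + 1) < u z)) as [z Hz].
  { intro n. apply NNPP. intro Hc.
    assert (S <= S - / (INR n + 1)).
    { apply HS2. intros y [w [Hw <-]]. apply Rnot_lt_le. intro. apply Hc. eauto. }
    assert (0 < / (INR n + 1)) by (apply Rinv_0_lt_compat; pose proof (pos_INR n); lra). lra. }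
  destruct (C_cluster z M) as [l Hl]; [intro n; apply HM, Hz|].
  assert (Kl : K l). { apply Hcl. intros eps He. destruct (Hl eps He O) as [n [_ Hn2]]. exists (z n). split; auto. apply Hz. }
  exists l. split; auto. intros w Hw. apply Rle_trans with S; [apply HS1; eauto|].
  apply Rnot_lt_le. intro Hlt.
  destruct (Hu l Kl ((S - u l) / 2)) as [d [Hd Hd2]]; [lra|].
  destruct (archimed_cor1 ((S - u l) / 2)) as [N [HN HN0]]; [lra|].
  destruct (Hl d Hd N) as [n [Hn1 Hn2]]. specialize (Hd2 _ Hn2).
  destruct (Hz n) as [_ Hz2]. apply Rabs_def2 in Hd2.
  assert (/ (INR n + 1) <= / INR N).
  { apply Rinv_le_contravar; [apply lt_0_INR; lia|]. apply le_INR in Hn1. lra. }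
  lra.
Qed.

Lemma rcont_Cmod (f : C -> C) (z : C) : ccont f z -> rcont (fun w => Cmod (f w)) z.
Proof.
  intros H eps He. destruct (H eps He) as [d [Hd H1]]. exists d; split; auto.
  intros w Hw. specialize (H1 w Hw). pose proof (Cmod_sub_ge (f w) (f z)).
  pose proof (Cmod_sub_ge (f z) (f w)) as H3. rewrite (Cmod_sub_sym (f z)) in H3. apply Rabs_def1; lra.
Qed.

Lemma rcont_opp (u : C -> R) (z : C) : rcont u z -> rcont (fun w => - u w) z.
Proof.
  intros H eps He. destruct (H eps He) as [d [Hd H1]]. exists d; split; auto.
  intros w Hw. replace (- u w - - u z) with (- (u w - u z)) by ring. rewrite Rabs_Ropp. auto.
Qed.

Lemma disc_closed (a : C) (r : R) (z : C) :
  (forall eps, 0 < eps -> exists w, Cmod (w - a) <= r /\ Cmod (w - z) < eps) -> Cmod (z - a) <= r.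
Proof.
  intro H. apply Rnot_lt_le. intro Hn. destruct (H (Cmod (z - a) - r)) as [w [H1 H2]]; [lra|].
  pose proof (Cmod_sub_triangle z w a) as H3. rewrite (Cmod_sub_sym z w) in H3. lra.
Qed.

Lemma disc_max (u : C -> R) (a : C) (r : R) : 0 <= r ->
  (forall z, Cmod (z - a) <= r -> rcont u z) ->
  exists p, Cmod (p - a) <= r /\ forall z, Cmod (z - a) <= r -> u z <= u p.
Proof.
  intros Hr Hu. apply (compact_max (fun z => Cmod (z - a) <= r) u (Cmod a + r) a); auto.
  - rewrite Cmod_sub_self; auto.
  - intros z Hz. pose proof (Cmod_sub_ge z a). lra.
  - apply disc_closed.
Qed.

Lemma circle_max (u : C -> R) (a : C) (r : R) : 0 <= r ->
  (forall z, Cmod (z - a) = r -> rcont u z) ->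
  exists p, Cmod (p - a) = r /\ forall z, Cmod (z - a) = r -> u z <= u p.
Proof.
  intros Hr Hu. apply (compact_max (fun z => Cmod (z - a) = r) u (Cmod a + r) (a + RtoC r)%C); auto.
  - replace (a + RtoC r - a)%C with (RtoC r) by ring. rewrite Cmod_R. apply Rabs_pos_eq; auto.
  - intros z Hz. pose proof (Cmod_sub_ge z a). lra.
  - intros z Hz. apply Rle_antisym.
    + apply disc_closed. intros eps He. destruct (Hz eps He) as [w [H1 H2]]. exists w. split; lra.
    + apply Rnot_lt_le. intro Hn. destruct (Hz (r - Cmod (z - a))) as [w [H1 H2]]; [lra|].
      pose proof (Cmod_sub_triangle w z a). lra.
Qed.

(** * Goursat's lemma and the maximum principle *)

(** The imaginary part of the counterclockwise contour integral of [G] around the rectangle. On the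
    vertical sides it integrates the real part of [G], which is what the mean value inequality asks
    for. *)
Definition rectJ (G : C -> C) (x1 x2 y1 y2 : R) : R :=
  RInt (fun x => snd (G (x, y1)) - snd (G (x, y2))) x1 x2 +
  RInt (fun y => fst (G (x2, y)) - fst (G (x1, y))) y1 y2.

Lemma continuous_of_eps (g : R -> R) (x : R) :
  (forall eps, 0 < eps -> exists d, 0 < d /\ forall y, Rabs (y - x) < d -> Rabs (g y - g x) < eps) ->
  continuous g x.
Proof.
  intro H. apply filterlim_locally. intros [e He].
  destruct (H e He) as [d [Hd H1]]. exists (mkposreal d Hd). intros y Hy. apply H1. exact Hy.
Qed.

Lemma ccont_path (G : C -> C) (c : R -> C) (x : R) :
  (forall y, Cmod (c y - c x) <= Rabs (y - x)) -> ccont G (c x) ->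
  continuous (fun y => fst (G (c y))) x /\ continuous (fun y => snd (G (c y))) x.
Proof.
  intros Hc H. split; apply continuous_of_eps; intros eps He;
    destruct (H eps He) as [d [Hd H1]]; exists d; split; auto; intros y Hy;
    specialize (H1 (c y) (Rle_lt_trans _ _ _ (Hc y) Hy)).
  - pose proof (fst_le_Cmod (G (c y) - G (c x))%C) as F. simpl in F. unfold Rminus. lra.
  - pose proof (snd_le_Cmod (G (c y) - G (c x))%C) as F. simpl in F. unfold Rminus. lra.
Qed.

Lemma Cmod_horizontal (x x' y : R) : Cmod ((x, y) - (x', y))%C = Rabs (x - x').
Proof.
  replace ((x, y) - (x', y))%C with (RtoC (x - x')).
  - apply Cmod_R.
  - unfold RtoC, Cminus, Cplus, Copp. simpl. f_equal; ring.
Qed.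

Lemma Cmod_vertical (x y y' : R) : Cmod ((x, y) - (x, y'))%C = Rabs (y - y').
Proof.
  unfold Cmod. simpl. rewrite <- sqrt_Rsqr_abs. f_equal. unfold Rsqr. ring.
Qed.

Definition rect_cont (G : C -> C) (x1 x2 y1 y2 : R) : Prop :=
  forall x y, x1 <= x <= x2 -> y1 <= y <= y2 -> ccont G (x, y).

Lemma ex_RInt_hor (G : C -> C) (x1 x2 a b y : R) : a <= b -> x1 <= a -> b <= x2 ->
  (forall x, x1 <= x <= x2 -> ccont G (x, y)) -> ex_RInt (fun x => snd (G (x, y))) a b.
Proof.
  intros Hab Ha Hb H. apply (ex_RInt_continuous (V := R_CompleteNormedModule)). intros z Hz.
  rewrite Rmin_left, Rmax_right in Hz by auto.
  apply (ccont_path G (fun x => (x, y))).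
  - intro t. rewrite Cmod_horizontal. lra.
  - apply H. lra.
Qed.

Lemma ex_RInt_ver (G : C -> C) (y1 y2 a b x : R) : a <= b -> y1 <= a -> b <= y2 ->
  (forall y, y1 <= y <= y2 -> ccont G (x, y)) -> ex_RInt (fun y => fst (G (x, y))) a b.
Proof.
  intros Hab Ha Hb H. apply (ex_RInt_continuous (V := R_CompleteNormedModule)). intros z Hz.
  rewrite Rmin_left, Rmax_right in Hz by auto.
  apply (ccont_path G (fun y => (x, y))).
  - intro t. rewrite Cmod_vertical. lra.
  - apply H. lra.
Qed.

Lemma RInt_Rplus (f g : R -> R) (a b : R) : ex_RInt f a b -> ex_RInt g a b ->
  RInt (fun x => f x + g x) a b = RInt f a b + RInt g a b.
Proof. apply (RInt_plus (V := R_CompleteNormedModule)). Qed.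

Lemma rectJ_split_x (G : C -> C) (x1 m x2 y1 y2 : R) : x1 <= m <= x2 -> y1 <= y2 ->
  rect_cont G x1 x2 y1 y2 ->
  rectJ G x1 x2 y1 y2 = rectJ G x1 m y1 y2 + rectJ G m x2 y1 y2.
Proof.
  intros Hm Hy H. unfold rectJ.
  rewrite <- (RInt_Chasles (fun x => snd (G (x, y1)) - snd (G (x, y2))) x1 m x2).
  2,3: apply (ex_RInt_minus (V := R_NormedModule)); apply (ex_RInt_hor G x1 x2); try lra;
    intros x Hx; apply H; lra.
  replace (RInt (fun y => fst (G (x2, y)) - fst (G (x1, y))) y1 y2)
    with (RInt (fun y => fst (G (m, y)) - fst (G (x1, y))) y1 y2 +
          RInt (fun y => fst (G (x2, y)) - fst (G (m, y))) y1 y2).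
  - unfold plus. simpl. ring.
  - rewrite <- RInt_Rplus.
    + apply RInt_ext. intros. simpl. ring.
    + apply (ex_RInt_minus (V := R_NormedModule)); apply (ex_RInt_ver G y1 y2); try lra; intros y Hy2; apply H; lra.
    + apply (ex_RInt_minus (V := R_NormedModule)); apply (ex_RInt_ver G y1 y2); try lra; intros y Hy2; apply H; lra.
Qed.

Lemma rectJ_split_y (G : C -> C) (x1 x2 y1 m y2 : R) : y1 <= m <= y2 -> x1 <= x2 ->
  rect_cont G x1 x2 y1 y2 ->
  rectJ G x1 x2 y1 y2 = rectJ G x1 x2 y1 m + rectJ G x1 x2 m y2.
Proof.
  intros Hm Hx H. unfold rectJ.
  rewrite <- (RInt_Chasles (fun y => fst (G (x2, y)) - fst (G (x1, y))) y1 m y2).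
  2,3: apply (ex_RInt_minus (V := R_NormedModule)); apply (ex_RInt_ver G y1 y2); try lra;
    intros y Hy; apply H; lra.
  replace (RInt (fun x => snd (G (x, y1)) - snd (G (x, y2))) x1 x2)
    with (RInt (fun x => snd (G (x, y1)) - snd (G (x, m))) x1 x2 +
          RInt (fun x => snd (G (x, m)) - snd (G (x, y2))) x1 x2).
  - unfold plus. simpl. ring.
  - rewrite <- RInt_Rplus.
    + apply RInt_ext. intros. simpl. ring.
    + apply (ex_RInt_minus (V := R_NormedModule)); apply (ex_RInt_hor G x1 x2); try lra; intros x Hx2; apply H; lra.
    + apply (ex_RInt_minus (V := R_NormedModule)); apply (ex_RInt_hor G x1 x2); try lra; intros x Hx2; apply H; lra.
Qed.

Lemma RInt_near_const (g : R -> R) (a b c e : R) : a <= b -> ex_RInt g a b ->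
  (forall x, a <= x <= b -> Rabs (g x - c) <= e) -> Rabs (RInt g a b - c * (b - a)) <= e * (b - a).
Proof.
  intros Hab Hg H.
  assert (H1 : RInt (fun _ => c - e) a b <= RInt g a b).
  { apply RInt_le; auto. apply ex_RInt_const. intros x Hx. specialize (H x ltac:(lra)).
    apply Rabs_le_between in H. lra. }
  assert (H2 : RInt g a b <= RInt (fun _ => c + e) a b).
  { apply RInt_le; auto. apply ex_RInt_const. intros x Hx. specialize (H x ltac:(lra)).
    apply Rabs_le_between in H. lra. }
  rewrite RInt_const in H1, H2. unfold scal in H1, H2. simpl in H1, H2. unfold mult in H1, H2. simpl in H1, H2.
  apply Rabs_le. lra.
Qed.

(** The affine part of [G] contributes nothing: its horizontal sides give
    [fst l * (y1 - y2) * (x2 - x1)] and its vertical sides the opposite. Each integrand stays within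
    [2 e] times the half-perimeter of its constant. *)
Lemma rectJ_small (G : C -> C) (x1 x2 y1 y2 e : R) (p l : C) : x1 <= x2 -> y1 <= y2 -> 0 <= e ->
  rect_cont G x1 x2 y1 y2 -> x1 <= fst p <= x2 -> y1 <= snd p <= y2 ->
  (forall x y, x1 <= x <= x2 -> y1 <= y <= y2 ->
     Cmod (G (x, y) - G p - l * ((x, y) - p)) <= e * Cmod ((x, y) - p)) ->
  Rabs (rectJ G x1 x2 y1 y2) <= 2 * e * ((x2 - x1) + (y2 - y1)) * ((x2 - x1) + (y2 - y1)).
Proof.
  intros Hx Hy He Hc Hp1 Hp2 H. set (d := (x2 - x1) + (y2 - y1)).
  assert (HH : forall x y, x1 <= x <= x2 -> y1 <= y <= y2 ->
     Cmod (G (x, y) - G p - l * ((x, y) - p)) <= e * d).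
  { intros x y Hx1 Hy1. eapply Rle_trans; [apply H; auto|]. apply Rmult_le_compat_l; auto.
    eapply Rle_trans; [apply Cmod_le_abs|]. simpl.
    assert (Rabs (x + - fst p) <= x2 - x1) by (apply Rabs_le; lra).
    assert (Rabs (y + - snd p) <= y2 - y1) by (apply Rabs_le; lra). unfold d. lra. }
  assert (A : Rabs (RInt (fun x => snd (G (x, y1)) - snd (G (x, y2))) x1 x2 - (fst l * (y1 - y2)) * (x2 - x1))
              <= 2 * e * d * (x2 - x1)).
  { apply RInt_near_const; auto.
    - apply (ex_RInt_minus (V := R_NormedModule)); apply (ex_RInt_hor G x1 x2); try lra;
        intros x Hx1; apply Hc; lra.
    - intros x Hx1. pose proof (HH x y1 Hx1 ltac:(lra)) as B1. pose proof (HH x y2 Hx1 ltac:(lra)) as B2.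
      pose proof (snd_le_Cmod (G (x, y1) - G p - l * ((x, y1) - p))%C) as C1.
      pose proof (snd_le_Cmod (G (x, y2) - G p - l * ((x, y2) - p))%C) as C2.
      set (X1 := snd (G (x, y1) - G p - l * ((x, y1) - p))%C) in *.
      set (X2 := snd (G (x, y2) - G p - l * ((x, y2) - p))%C) in *.
      replace (snd (G (x, y1)) - snd (G (x, y2)) - fst l * (y1 - y2)) with (X1 - X2)
        by (unfold X1, X2; simpl; ring).
      eapply Rle_trans; [apply Rabs_triang|]. rewrite Rabs_Ropp. lra. }
  assert (B : Rabs (RInt (fun y => fst (G (x2, y)) - fst (G (x1, y))) y1 y2 - (fst l * (x2 - x1)) * (y2 - y1))
              <= 2 * e * d * (y2 - y1)).
  { apply RInt_near_const; auto.
    - apply (ex_RInt_minus (V := R_NormedModule)); apply (ex_RInt_ver G y1 y2); try lra;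
        intros y Hy1; apply Hc; lra.
    - intros y Hy1. pose proof (HH x1 y ltac:(lra) Hy1) as B1. pose proof (HH x2 y ltac:(lra) Hy1) as B2.
      pose proof (fst_le_Cmod (G (x1, y) - G p - l * ((x1, y) - p))%C) as C1.
      pose proof (fst_le_Cmod (G (x2, y) - G p - l * ((x2, y) - p))%C) as C2.
      set (X1 := fst (G (x1, y) - G p - l * ((x1, y) - p))%C) in *.
      set (X2 := fst (G (x2, y) - G p - l * ((x2, y) - p))%C) in *.
      replace (fst (G (x2, y)) - fst (G (x1, y)) - fst l * (x2 - x1)) with (X2 - X1)
        by (unfold X1, X2; simpl; ring).
      eapply Rle_trans; [apply Rabs_triang|]. rewrite Rabs_Ropp. lra. }
  unfold rectJ. apply Rabs_le_between in A. apply Rabs_le_between in B.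
  apply Rabs_le. unfold d in *. lra.
Qed.

Lemma nested_intervals (a b : nat -> R) :
  (forall n, a n <= a (S n)) -> (forall n, b (S n) <= b n) -> (forall n, a n <= b n) ->
  exists p, forall n, a n <= p <= b n.
Proof.
  intros Ha Hb Hab.
  assert (Ha' : forall n m, (n <= m)%nat -> a n <= a m).
  { intros n m Hnm. induction Hnm; [lra|]. specialize (Ha m). lra. }
  assert (Hb' : forall n m, (n <= m)%nat -> b m <= b n).
  { intros n m Hnm. induction Hnm; [lra|]. specialize (Hb m). lra. }
  assert (HX : forall n m, a n <= b m).
  { intros n m. pose proof (Ha' n (max n m) ltac:(lia)). pose proof (Hb' m (max n m) ltac:(lia)).
    specialize (Hab (max n m)). lra. }
  destruct (completeness (fun y => exists n, y = a n)) as [p [H1 H2]].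
  - exists (b O). intros y [n ->]. auto.
  - exists (a O), O; auto.
  - exists p. intro n. split; [apply H1; eauto|]. apply H2. intros y [m ->]. auto.
Qed.

Lemma rectJ_quarter (G : C -> C) (x y w h : R) : 0 <= w -> 0 <= h ->
  rect_cont G x (x + w) y (y + h) ->
  exists x' y', (x <= x' /\ x' + w / 2 <= x + w) /\ (y <= y' /\ y' + h / 2 <= y + h) /\
    Rabs (rectJ G x (x + w) y (y + h)) <= 4 * Rabs (rectJ G x' (x' + w / 2) y' (y' + h / 2)).
Proof.
  intros Hw Hh H.
  assert (E : rectJ G x (x + w) y (y + h) =
    rectJ G x (x + w / 2) y (y + h / 2) + rectJ G x (x + w / 2) (y + h / 2) (y + h / 2 + h / 2) +
    rectJ G (x + w / 2) (x + w / 2 + w / 2) y (y + h / 2) +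
    rectJ G (x + w / 2) (x + w / 2 + w / 2) (y + h / 2) (y + h / 2 + h / 2)).
  { replace (x + w / 2 + w / 2) with (x + w) by field.
    replace (y + h / 2 + h / 2) with (y + h) by field.
    rewrite (rectJ_split_x G x (x + w / 2)) by (auto; lra).
    rewrite (rectJ_split_y G x (x + w / 2) y (y + h / 2)); try lra.
    rewrite (rectJ_split_y G (x + w / 2) (x + w) y (y + h / 2)); try lra.
    - intros s t Hs Ht. apply H; lra.
    - intros s t Hs Ht. apply H; lra. }
  rewrite E.
  match goal with |- context [Rabs (?a + ?b + ?c + ?d)] =>
    pose proof (Rabs_triang (a + b + c) d) as T1;
    pose proof (Rabs_triang (a + b) c) as T2; pose proof (Rabs_triang a b) as T3;
    set (A := a) in *; set (B := b) in *; set (CC := c) in *; set (D := d) in * end.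
  destruct (Rle_or_lt (Rabs (A + B + CC + D)) (4 * Rabs A)) as [h1|h1].
  { exists x, y. repeat split; try lra. exact h1. }
  destruct (Rle_or_lt (Rabs (A + B + CC + D)) (4 * Rabs B)) as [h2|h2].
  { exists x, (y + h / 2). repeat split; try lra. exact h2. }
  destruct (Rle_or_lt (Rabs (A + B + CC + D)) (4 * Rabs CC)) as [h3|h3].
  { exists (x + w / 2), y. repeat split; try lra. exact h3. }
  exists (x + w / 2), (y + h / 2). repeat split; try lra.
  fold D. lra.
Qed.

(** Some quarter keeps at least a quarter of the integral, so [4^n] times the integral over the
    [n]-th rectangle dominates the original one. Differentiability at the common point bounds it by
    [2 eps] times the squared half-perimeter, which shrinks like [4^-n]. *)
Theorem goursat (G : C -> C) (x1 x2 y1 y2 : R) : x1 <= x2 -> y1 <= y2 ->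
  (forall x y, x1 <= x <= x2 -> y1 <= y <= y2 -> exists l, cdiff G (x, y) l) ->
  rectJ G x1 x2 y1 y2 = 0.
Proof.
  intros Hx Hy HG.
  assert (Hc : rect_cont G x1 x2 y1 y2).
  { intros x y H1 H2. destruct (HG x y H1 H2) as [l Hl]. apply (cdiff_cont _ _ _ Hl). }
  set (w0 := x2 - x1). set (h0 := y2 - y1).
  set (W := fun n => w0 / 2 ^ n). set (Hh := fun n => h0 / 2 ^ n).
  assert (P2 : forall n, 0 < 2 ^ n) by (intro; apply pow_lt; lra).
  assert (W0 : forall n, 0 <= W n) by (intro n; unfold W; apply Rdiv_le_0_compat; [unfold w0; lra | auto]).
  assert (H0 : forall n, 0 <= Hh n) by (intro n; unfold Hh; apply Rdiv_le_0_compat; [unfold h0; lra | auto]).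
  assert (WS : forall n, W (S n) = W n / 2) by (intro n; unfold W; simpl; field; apply Rgt_not_eq, P2).
  assert (HS : forall n, Hh (S n) = Hh n / 2) by (intro n; unfold Hh; simpl; field; apply Rgt_not_eq, P2).
  set (valid := fun (n : nat) (p : R * R) => x1 <= fst p /\ fst p + W n <= x2 /\ y1 <= snd p /\ snd p + Hh n <= y2).
  set (J := fun (n : nat) (p : R * R) => rectJ G (fst p) (fst p + W n) (snd p) (snd p + Hh n)).
  (* A state pairs the step count with the lower left corner, which determines the rectangle;
     invalid states receive a dummy successor. *)
  destruct (choice (fun (q r : nat * (R * R)) => valid (fst q) (snd q) ->
     fst r = S (fst q) /\ valid (S (fst q)) (snd r) /\
     (fst (snd q) <= fst (snd r) /\ fst (snd r) + W (S (fst q)) <= fst (snd q) + W (fst q)) /\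
     (snd (snd q) <= snd (snd r) /\ snd (snd r) + Hh (S (fst q)) <= snd (snd q) + Hh (fst q)) /\
     Rabs (J (fst q) (snd q)) <= 4 * Rabs (J (S (fst q)) (snd r)))) as [next Hnext].
  { intros [n [x y]]. simpl. destruct (classic (valid n (x, y))) as [V|V].
    2:{ exists (O, (0, 0)). intro; contradiction. }
    unfold valid in V; simpl in V.
    destruct (rectJ_quarter G x y (W n) (Hh n)) as [x' [y' [B1 [B2 B3]]]]; auto.
    { intros s t Hs Ht. apply Hc; lra. }
    exists (S n, (x', y')). intros _. simpl. unfold valid, J. simpl. rewrite WS, HS.
    repeat split; try lra. }
  set (sq := fun n => Nat.iter n next (O, (x1, y1))).
  assert (V : forall n, fst (sq n) = n /\ valid n (snd (sq n))).
  { induction n as [|n [IH1 IH2]].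
    - simpl. split; auto. unfold valid, W, Hh, w0, h0. simpl. lra.
    - destruct (Hnext (sq n)) as [A1 [A2 _]]; rewrite IH1 in *; auto. }
  assert (St : forall n, 
     (fst (snd (sq n)) <= fst (snd (sq (S n))) /\ fst (snd (sq (S n))) + W (S n) <= fst (snd (sq n)) + W n) /\
     (snd (snd (sq n)) <= snd (snd (sq (S n))) /\ snd (snd (sq (S n))) + Hh (S n) <= snd (snd (sq n)) + Hh n) /\
     Rabs (J n (snd (sq n))) <= 4 * Rabs (J (S n) (snd (sq (S n))))).
  { intro n. destruct (V n) as [IH1 IH2].
    destruct (Hnext (sq n)) as [A1 [A2 A3]]; rewrite IH1 in *; auto. }
  clear Hnext.
  destruct (nested_intervals (fun n => fst (snd (sq n))) (fun n => fst (snd (sq n)) + W n)) as [px Hpx].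
  { intro n. apply St. } { intro n. apply St. } { intro n. specialize (W0 n). lra. }
  destruct (nested_intervals (fun n => snd (snd (sq n))) (fun n => snd (snd (sq n)) + Hh n)) as [py Hpy].
  { intro n. apply St. } { intro n. apply St. } { intro n. specialize (H0 n). lra. }
  assert (JJ : forall n, Rabs (rectJ G x1 x2 y1 y2) <= 4 ^ n * Rabs (J n (snd (sq n)))).
  { induction n as [|n IH].
    - simpl. right. unfold J, W, Hh, w0, h0. simpl.
      replace (x1 + (x2 - x1) / 1) with x2 by field. replace (y1 + (y2 - y1) / 1) with y2 by field. ring.
    - destruct (St n) as [_ [_ B]]. simpl.
      assert (0 < 4 ^ n) by (apply pow_lt; lra). eapply Rle_trans; [apply IH|].
      rewrite (Rmult_comm 4 (4 ^ n)), Rmult_assoc. apply Rmult_le_compat_l; [lra | exact B]. }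
  assert (Vp : forall n, valid n (snd (sq n))) by (intro; apply V).
  destruct (HG px py) as [l Hl].
  { specialize (Hpx O). specialize (Vp O). unfold valid in Vp. lra. }
  { specialize (Hpy O). specialize (Vp O). unfold valid in Vp. lra. }
  cut (Rabs (rectJ G x1 x2 y1 y2) <= 0).
  { intro Z. pose proof (Rabs_pos (rectJ G x1 x2 y1 y2)).
    destruct (Req_dec (rectJ G x1 x2 y1 y2) 0) as [|n]; auto. apply Rabs_no_R0 in n. lra. }
  set (D := w0 + h0). assert (HD : 0 <= D) by (unfold D, w0, h0; lra).
  apply (le_eps_mul _ (2 * D * D)); [nra|]. intros eps He.
  destruct (Hl eps He) as [d [Hd HL]].
  destruct (pow_lt_1_zero (1 / 2) ltac:(rewrite Rabs_pos_eq; lra) (d / (D + 1))) as [N HN].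
  { apply Rdiv_lt_0_compat; lra. }
  specialize (HN N ltac:(lia)). rewrite Rabs_pos_eq in HN by (apply pow_le; lra).
  assert (EN : (1 / 2) ^ N = / 2 ^ N) by (rewrite <- pow_inv; f_equal; lra). rewrite EN in HN.
  assert (WH : W N + Hh N = D * / 2 ^ N) by (unfold W, Hh, D, Rdiv; ring).
  assert (WHd : W N + Hh N < d).
  { rewrite WH. apply Rlt_div_r in HN; [|lra].
    assert (0 < / 2 ^ N) by (apply Rinv_0_lt_compat; auto). nra. }
  specialize (JJ N). eapply Rle_trans; [apply JJ|].
  specialize (Vp N). destruct (snd (sq N)) as [x y] eqn:Esq. unfold valid in Vp; simpl in Vp.
  specialize (Hpx N). specialize (Hpy N). cbv beta in Hpx, Hpy. rewrite Esq in Hpx, Hpy. simpl in Hpx, Hpy.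
  specialize (W0 N). specialize (H0 N).
  assert (Q : Rabs (J N (x, y)) <= 2 * eps * (W N + Hh N) * (W N + Hh N)).
  { unfold J. simpl.
    pose proof (rectJ_small G x (x + W N) y (y + Hh N) eps (px, py) l) as Z.
    replace (x + W N - x) with (W N) in Z by ring. replace (y + Hh N - y) with (Hh N) in Z by ring.
    apply Z; simpl; try lra.
    - intros s t Hs Ht. apply Hc; lra.
    - intros s t Hs Ht. apply HL. eapply Rle_lt_trans; [apply Cmod_le_abs|]. simpl.
      assert (Rabs (s + - px) <= W N) by (apply Rabs_le; lra).
      assert (Rabs (t + - py) <= Hh N) by (apply Rabs_le; lra). lra. }
  rewrite WH in Q.
  apply Rle_trans with (4 ^ N * (2 * eps * (D * / 2 ^ N) * (D * / 2 ^ N))).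
  - apply Rmult_le_compat_l; auto. apply pow_le; lra.
  - right. replace 4 with (2 * 2) by ring. rewrite Rpow_mult_distr. field. apply Rgt_not_eq, P2.
Qed.

(* In the coordinate [z = a + exp zeta] the circles about [a] become the vertical
   sides of a rectangle whose horizontal sides cancel by periodicity. *)
Lemma mean_value_le (h : C -> C) (a : C) (rho r M : R) : 0 < r < rho ->
  (forall z, 0 < Cmod (z - a) < rho -> exists l, cdiff h z l) -> ccont h a ->
  (forall z, Cmod (z - a) = r -> fst (h z) <= M) -> fst (h a) <= M.
Proof.
  intros Hr Hd Hc HM. apply Rnot_lt_le. intro Hn.
  set (e := (fst (h a) - M) / 2). assert (He : 0 < e) by (unfold e; lra).
  destruct (Hc e He) as [d [Hd0 Hd1]].
  set (r1 := Rmin r (d / 2)).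
  assert (Hr1 : 0 < r1) by (apply Rmin_glb_lt; lra).
  assert (Hr1r : r1 <= r) by apply Rmin_l. assert (Hr1d : r1 <= d / 2) by apply Rmin_r.
  set (G := fun z => h (a + cexp z)%C).
  assert (Hsub : forall z, Cmod (a + cexp z - a) = exp (fst z)).
  { intro z. rewrite <- Cmod_cexp. f_equal. ring. }
  assert (HG : forall z, fst z <= ln r -> exists l, cdiff G z l).
  { intros z Hz. destruct (Hd (a + cexp z)%C) as [l Hl].
    - rewrite Hsub. split; [apply exp_pos|].
      apply Rle_lt_trans with (exp (ln r)); [|rewrite exp_ln; lra].
      destruct Hz as [Hz| ->]; [left; apply exp_increasing; auto | right; auto].
    - exists (l * (0 + cexp z))%C. unfold G. apply (cdiff_comp (fun z => a + cexp z)%C h); auto.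
      apply cdiff_plus; [apply cdiff_const | apply cdiff_cexp]. }
  assert (Hln : ln r1 <= ln r) by (apply ln_le; lra).
  pose proof PI_RGT_0 as HPI.
  pose proof (goursat G (ln r1) (ln r) 0 (2 * PI) Hln ltac:(lra)) as HJ.
  specialize (HJ ltac:(intros x y Hx Hy; apply HG; simpl; lra)).
  assert (Hper : forall x, G (x, 0) = G (x, 2 * PI)).
  { intro x. unfold G. do 2 f_equal. unfold cexp. simpl.
    rewrite cos_2PI, sin_2PI, cos_0, sin_0. auto. }
  unfold rectJ in HJ.
  rewrite (RInt_ext _ (fun _ => 0)) in HJ.
  2:{ intros x _. rewrite Hper. apply Rminus_diag_eq; auto. }
  rewrite RInt_const in HJ. unfold scal in HJ. simpl in HJ. unfold mult in HJ. simpl in HJ.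
  (* The horizontal sides have cancelled, so this integral vanishes; yet its integrand is at most
     [M - (fst (h a) - e) = - e]. *)
  assert (HI : RInt (fun y => fst (G (ln r, y)) - fst (G (ln r1, y))) 0 (2 * PI)
               <= RInt (fun _ => - e) 0 (2 * PI)).
  { apply RInt_le; [lra | | apply ex_RInt_const |].
    - apply (ex_RInt_minus (V := R_NormedModule)); apply (ex_RInt_ver G 0 (2 * PI)); try lra;
        intros y _; destruct (HG (ln r, y)) as [l Hl]; simpl; try lra; try apply (cdiff_cont _ _ _ Hl);
        destruct (HG (ln r1, y)) as [l1 Hl1]; simpl; try lra; apply (cdiff_cont _ _ _ Hl1).
    - intros y _.
      assert (A1 : fst (G (ln r, y)) <= M).
      { apply HM. rewrite Hsub. simpl. apply exp_ln; lra. }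
      assert (A2 : fst (h a) - e <= fst (G (ln r1, y))).
      { unfold G. assert (K := Hd1 (a + cexp (ln r1, y))%C). rewrite Hsub in K. simpl in K.
        rewrite exp_ln in K by auto. specialize (K ltac:(lra)).
        pose proof (fst_bounds (h (a + cexp (ln r1, y)) - h a)%C) as F. simpl in F. lra. }
      unfold e in *. lra. }
  rewrite RInt_const in HI. unfold scal in HI. simpl in HI. unfold mult in HI. simpl in HI.
  nra.
Qed.

(** Rotate the values: the real part of [Cconj (h a) * h] is the squared modulus at [a] and at most
    [Cmod (h a) * M] on the circle. *)
Lemma mean_value_Cmod (h : C -> C) (a : C) (rho r M : R) : 0 < r < rho ->
  (forall z, 0 < Cmod (z - a) < rho -> exists l, cdiff h z l) -> ccont h a ->
  (forall z, Cmod (z - a) = r -> Cmod (h z) <= M) -> Cmod (h a) <= M.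
Proof.
  intros Hr Hd Hc HM.
  assert (K : fst (Cconj (h a) * h a)%C <= Cmod (h a) * M).
  { apply (mean_value_le (fun z => Cconj (h a) * h z)%C a rho r); auto.
    - intros z Hz. destruct (Hd z Hz) as [l Hl]. eexists. apply cdiff_mult_c, Hl.
    - intros eps He. pose proof (Cmod_ge_0 (h a)).
      destruct (Hc (eps / (Cmod (h a) + 1))) as [d [Hd0 H1]]; [apply Rdiv_lt_0_compat; lra|].
      exists d; split; auto. intros w Hw. specialize (H1 w Hw).
      replace (Cconj (h a) * h w - Cconj (h a) * h a)%C with (Cconj (h a) * (h w - h a))%C by ring.
      rewrite Cmod_mult, Cmod_conj. apply Rlt_div_r in H1; [|lra].
      pose proof (Cmod_ge_0 (h w - h a)). nra.
    - intros z Hz. pose proof (fst_bounds (Cconj (h a) * h z)%C) as [_ F].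
      rewrite Cmod_mult, Cmod_conj in F. eapply Rle_trans; [apply F|].
      apply Rmult_le_compat_l; [apply Cmod_ge_0 | auto]. }
  rewrite fst_conj_mul in K. pose proof (Cmod_ge_0 (h a)).
  destruct (Req_dec (Cmod (h a)) 0) as [E|E].
  - rewrite E. replace 0 with (Cmod (RtoC 0)) by apply Cmod_0.
    specialize (HM (a + RtoC r)%C). replace (a + RtoC r - a)%C with (RtoC r) in HM by ring.
    rewrite Cmod_R, Rabs_pos_eq in HM by lra. specialize (HM eq_refl).
    rewrite Cmod_0. eapply Rle_trans; [apply Cmod_ge_0 | apply HM].
  - apply Rmult_le_reg_l with (Cmod (h a)); lra.
Qed.

(** The difference quotient, completed at [a] by the intended derivative [l]. It takes the place of
    power series: dividing by [z - a] lowers a degree or a multiplicity by one. *)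
Definition dquot (h : C -> C) (a l : C) (z : C) : C :=
  if Ceq_dec z a then l else ((h z - h a) / (z - a))%C.

Lemma dquot_neq (h : C -> C) (a l z : C) : z <> a -> dquot h a l z = ((h z - h a) / (z - a))%C.
Proof. intro H. unfold dquot. destruct (Ceq_dec z a); [contradiction | auto]. Qed.

Lemma dquot_eq (h : C -> C) (a l : C) : dquot h a l a = l.
Proof. unfold dquot. destruct (Ceq_dec a a); [auto | contradiction]. Qed.

Lemma dquot_spec (h : C -> C) (a l z : C) : (h z = h a + (z - a) * dquot h a l z)%C.
Proof.
  unfold dquot. destruct (Ceq_dec z a) as [->|n]; [ring|]. field.
  apply Cminus_eq_contra. auto.
Qed.

Lemma dquot_cont (h : C -> C) (a l : C) : cdiff h a l -> ccont (dquot h a l) a.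
Proof.
  intros H eps He. destruct (H (eps / 2)) as [d [Hd H1]]; [lra|]. exists d; split; auto.
  intros w Hw. rewrite dquot_eq. unfold dquot. destruct (Ceq_dec w a) as [->|n].
  - rewrite Cmod_sub_self. auto.
  - assert (n' : (w - a <> 0)%C) by (apply Cminus_eq_contra; auto).
    replace ((h w - h a) / (w - a) - l)%C with ((h w - h a - l * (w - a)) / (w - a))%C by (field; auto).
    rewrite Cmod_div by auto. apply Cmod_gt_0 in n'.
    apply Rle_lt_trans with (eps / 2); [|lra]. apply Rle_div_l; auto.
Qed.

Lemma dquot_diff (h : C -> C) (a l z m : C) : z <> a -> cdiff h z m ->
  exists k, cdiff (dquot h a l) z k.
Proof.
  intros Hz Hm. eexists.
  apply (cdiff_ext_loc (fun w => (h w - h a) * / (w - a))%C) with (d := Cmod (z - a)).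
  - apply Cmod_sub_gt0; auto.
  - intros w Hw. rewrite dquot_neq; auto. intros ->. rewrite Cmod_sub_sym in Hw. lra.
  - apply cdiff_mult; [apply cdiff_sub_c, Hm|].
    apply cdiff_inv; [apply Cminus_eq_contra; auto | apply cdiff_sub_c, cdiff_id].
Qed.

(** The mean value inequality applies to the completed difference quotient, which is [l] at [a] and
    at most [M / r] on the circle of radius [r]; then [r] tends to [rho]. *)
Lemma cauchy_estimate (h : C -> C) (a l : C) (rho M : R) : 0 < rho -> 
  (forall z, Cmod (z - a) < rho -> exists m, cdiff h z m) -> cdiff h a l ->
  (forall z, Cmod (z - a) < rho -> Cmod (h z - h a) <= M) -> Cmod l <= M / rho.
Proof.
  intros Hrho Hd Hl HM.
  assert (K : forall r, 0 < r < rho -> Cmod l * r <= M).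
  { intros r Hr. apply Rle_div_r; [lra|]. rewrite <- (dquot_eq h a l).
    apply (mean_value_Cmod _ a rho r); auto.
    - intros z Hz. destruct (Hd z ltac:(lra)) as [m Hm]. apply (dquot_diff h a l z m); auto.
      intros ->. rewrite Cmod_sub_self in Hz. lra.
    - apply dquot_cont; auto.
    - intros z Hz. assert (za : z <> a). { intros ->. rewrite Cmod_sub_self in Hz. lra. }
      rewrite dquot_neq, Cmod_div, Hz by (auto; apply Cminus_eq_contra; auto).
      apply Rmult_le_compat_r; [left; apply Rinv_0_lt_compat; lra|]. apply HM. lra. }
  apply Rle_div_r; auto. apply Rnot_lt_le. intro Hn.
  pose proof (Cmod_ge_0 l) as L.
  assert (HM0 : 0 <= M). { specialize (HM a). rewrite !Cmod_sub_self in HM. auto. }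
  assert (L0 : 0 < Cmod l) by nra.
  (* If [Cmod l] exceeded [M / rho], the radius halfway between [M / Cmod l] and [rho] would violate
     [K]. *)
  assert (M < Cmod l * ((M / Cmod l + rho) / 2)).
  { replace (Cmod l * ((M / Cmod l + rho) / 2)) with ((M + Cmod l * rho) / 2) by (field; lra). lra. }
  assert (M / Cmod l < rho) by (apply Rlt_div_l; lra).
  assert (0 <= M / Cmod l) by (apply Rdiv_le_0_compat; lra).
  specialize (K ((M / Cmod l + rho) / 2) ltac:(lra)). lra.
Qed.

(** A quantitative open mapping theorem. If [w] were omitted, [/ (h - w)] would be differentiable
    and at most [2 / m] on the circle of radius [r], but larger than that at the centre. *)
Lemma disc_cover (h : C -> C) (a : C) (rho r m : R) (w : C) : 0 < r < rho ->
  (forall z, Cmod (z - a) < rho -> exists l, cdiff h z l) ->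
  (forall z, Cmod (z - a) = r -> m <= Cmod (h z - h a)) ->
  Cmod (w - h a) < m / 2 -> exists z, Cmod (z - a) < rho /\ h z = w.
Proof.
  intros Hr Hd Hm Hw. apply NNPP. intro Hn.
  assert (Hne : forall z, Cmod (z - a) < rho -> (h z - w <> 0)%C).
  { intros z Hz. apply Cminus_eq_contra. intro E. apply Hn. eauto. }
  assert (Ha : Cmod (a - a) < rho) by (rewrite Cmod_sub_self; lra).
  assert (D : forall z, Cmod (z - a) < rho -> exists l, cdiff (fun x => / (h x - w))%C z l).
  { intros z Hz. destruct (Hd z Hz) as [l Hl]. eexists.
    apply cdiff_inv; [auto | apply cdiff_sub_c, Hl]. }
  assert (Pa : 0 < Cmod (h a - w)) by (apply Cmod_gt_0; auto).
  assert (P : Cmod (/ (h a - w))%C <= / (m / 2)).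
  { apply (mean_value_Cmod (fun x => / (h x - w))%C a rho r); auto.
    - intros z Hz. apply D. lra.
    - destruct (D a Ha) as [l Hl]. apply (cdiff_cont _ _ _ Hl).
    - intros z Hz. rewrite Cmod_inv by (apply Hne; lra).
      pose proof (Cmod_ge_0 (w - h a)).
      apply Rinv_le_contravar; [lra|]. specialize (Hm z Hz).
      pose proof (Cmod_sub_triangle (h z) w (h a)). lra. }
  rewrite Cmod_inv in P by auto. rewrite (Cmod_sub_sym w) in Hw.
  apply Rinv_lt_contravar in Hw; [lra | nra].
Qed.

(** * Regularity of the derivative *)

Definition holo (h dh : C -> C) (a : C) (r : R) : Prop :=
  forall z, Cmod (z - a) < r -> cdiff h z (dh z).

Lemma holo_sub (h dh : C -> C) (a b : C) (r s : R) :
  holo h dh a r -> Cmod (b - a) + s <= r -> holo h dh b s.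
Proof.
  intros H Hs z Hz. apply H. pose proof (Cmod_sub_triangle z b a). lra.
Qed.

(* Cauchy's estimate for [eta |-> h (eta + c) - h eta]. *)
Lemma deriv_lipschitz (h dh : C -> C) (a c : C) (rho N : R) : 0 < rho ->
  holo h dh a rho -> (forall z, Cmod (z - a) < rho -> Cmod (dh z) <= N) ->
  Cmod c < rho / 2 -> Cmod (dh (a + c) - dh a)%C <= 4 * N / rho * Cmod c.
Proof.
  intros Hrho Hh HN Hc.
  set (D := fun z => (h (z + c) - h z)%C).
  assert (Hin : forall z, Cmod (z - a) < rho / 2 -> Cmod (z + c - a) < rho).
  { intros z Hz. replace (z + c - a)%C with ((z - a) + c)%C by ring.
    eapply Rle_lt_trans; [apply Cmod_triangle | lra]. }
  assert (HD : forall z, Cmod (z - a) < rho / 2 -> cdiff D z (dh (z + c) - dh z)%C).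
  { intros z Hz. apply cdiff_minus; [apply cdiff_shift, Hh; auto | apply Hh; lra]. }
  assert (HB : forall z, Cmod (z - a) < rho / 2 -> Cmod (D z) <= N * Cmod c).
  { intros z Hz. unfold D. eapply Rle_trans.
    - apply (mean_value_disc h dh a z (z + c)%C rho N); auto. lra.
    - right. do 2 f_equal. ring. }
  assert (Ha : Cmod (a - a) < rho / 2) by (rewrite Cmod_sub_self; lra).
  replace (4 * N / rho * Cmod c) with ((2 * (N * Cmod c)) / (rho / 2)) by (field; lra).
  apply (cauchy_estimate D a); [lra | | apply HD; auto |].
  - intros z Hz. eexists. apply HD; auto.
  - intros z Hz. eapply Rle_trans; [apply Cmod_sub_le|].
    pose proof (HB z Hz). pose proof (HB a Ha). lra.
Qed.

(** By continuity [h] oscillates by at most 2 near [a], and Cauchy's estimate on discs of radius [d]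
    turns this into [2 / d]. *)
Lemma deriv_loc_bounded (h dh : C -> C) (a : C) (rho : R) : 0 < rho -> holo h dh a rho ->
  exists d N, 0 < d <= rho /\ 0 <= N /\ forall z, Cmod (z - a) < d -> Cmod (dh z) <= N.
Proof.
  intros Hrho Hh. assert (Ha : Cmod (a - a) < rho) by (rewrite Cmod_sub_self; lra).
  destruct (cdiff_cont _ _ _ (Hh a Ha) 1 Rlt_0_1) as [d0 [Hd0 H0]].
  set (d := Rmin d0 rho / 2).
  assert (M1 := Rmin_l d0 rho). assert (M2 := Rmin_r d0 rho).
  assert (M3 : 0 < Rmin d0 rho) by (apply Rmin_glb_lt; auto).
  exists d, (2 / d). assert (Hd : 0 < d) by (unfold d; lra).
  split; [unfold d in *; lra|]. split; [apply Rdiv_le_0_compat; lra|].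
  intros z Hz.
  assert (Hin : forall w, Cmod (w - z) < d -> Cmod (w - a) < Rmin d0 rho).
  { intros w Hw. pose proof (Cmod_sub_triangle w z a). unfold d in *. lra. }
  apply (cauchy_estimate h z); auto.
  - intros w Hw. eexists. apply Hh. specialize (Hin w Hw). lra.
  - apply Hh. unfold d in *; lra.
  - intros w Hw. specialize (Hin w Hw).
    pose proof (H0 w ltac:(lra)). pose proof (H0 z ltac:(unfold d in *; lra)) as H2.
    pose proof (Cmod_sub_triangle (h w) (h a) (h z)) as H3. rewrite (Cmod_sub_sym (h a)) in H3. lra.
Qed.

Lemma deriv_loc_lipschitz (h dh : C -> C) (a : C) (rho : R) : 0 < rho -> holo h dh a rho ->
  exists d K, 0 < d <= rho /\ 0 <= K /\ forall b c, Cmod (b - a) < d -> Cmod (c - a) < d ->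
    Cmod (dh c - dh b) <= K * Cmod (c - b).
Proof.
  intros Hrho Hh. destruct (deriv_loc_bounded h dh a rho Hrho Hh) as [d0 [N [Hd0 [HN H0]]]].
  (* Two points within [d0 / 8] of [a] are within [d0 / 4] of each other, half the radius [d0 / 2]
     on which [deriv_lipschitz] is used. *)
  exists (d0 / 8), (4 * N / (d0 / 2)). split; [lra|]. split; [apply Rdiv_le_0_compat; lra|].
  intros b c Hb Hc. pose proof (Cmod_sub_triangle c a b) as T. rewrite (Cmod_sub_sym a b) in T.
  replace (dh c) with (dh (b + (c - b))%C) by (f_equal; ring).
  apply (deriv_lipschitz h dh b (c - b)%C (d0 / 2) N); [lra | | | lra].
  - apply (holo_sub h dh a b rho); auto. lra.
  - intros z Hz. apply H0. pose proof (Cmod_sub_triangle z b a). lra.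
Qed.

Lemma deriv_cont (h dh : C -> C) (a : C) (rho : R) : 0 < rho -> holo h dh a rho -> ccont dh a.
Proof.
  intros Hrho Hh eps He.
  destruct (deriv_loc_lipschitz h dh a rho Hrho Hh) as [d [K [Hd [HK H]]]].
  exists (Rmin d (eps / (K + 1))). split.
  { apply Rmin_glb_lt; [lra|]. apply Rdiv_lt_0_compat; lra. }
  intros w Hw.
  assert (Hw1 := Rlt_le_trans _ _ _ Hw (Rmin_l _ _)).
  assert (Hw2 := Rlt_le_trans _ _ _ Hw (Rmin_r _ _)).
  specialize (H a w ltac:(rewrite Cmod_sub_self; lra) Hw1).
  apply Rlt_div_r in Hw2; [|lra]. pose proof (Cmod_ge_0 (w - a)). nra.
Qed.

(** Subtracting the linear map [dh b] leaves a function whose derivative on the segment is at most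
    [K * Cmod (c - b)], by the Lipschitz bound on [dh]. *)
Lemma taylor2 (h dh : C -> C) (a : C) (rho : R) : 0 < rho -> holo h dh a rho ->
  exists d K, 0 < d <= rho /\ 0 <= K /\ forall b c, Cmod (b - a) < d -> Cmod (c - a) < d ->
    Cmod (h c - h b - dh b * (c - b)) <= K * Cmod (c - b) * Cmod (c - b).
Proof.
  intros Hrho Hh. destruct (deriv_loc_lipschitz h dh a rho Hrho Hh) as [d [K [Hd [HK H]]]].
  exists d, K. repeat split; try lra. intros b c Hb Hc.
  replace (h c - h b - dh b * (c - b))%C with ((h c - dh b * c) - (h b - dh b * b))%C by ring.
  apply (mean_value_ineq (fun z => h z - dh b * z)%C (fun z => dh z - dh b * 1)%C).
  intros t Ht. assert (Hs : Cmod (seg b c t - a) < d) by (apply seg_in_disc; auto). split.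
  - apply cdiff_minus; [apply Hh; lra | apply cdiff_mult_c, cdiff_id].
  - replace (dh (seg b c t) - dh b * 1)%C with (dh (seg b c t) - dh b)%C by ring.
    eapply Rle_trans; [apply H; auto|]. apply Rmult_le_compat_l; auto.
    rewrite <- (seg_0 b c) at 2. rewrite seg_sub, Rabs_pos_eq by lra.
    pose proof (Cmod_ge_0 (c - b)). nra.
Qed.

(* The difference quotients of [dh] form a Cauchy family by Cauchy's estimate
   applied to differences of two difference quotients of [h]. *)
Lemma deriv_diff (h dh : C -> C) (a : C) (rho : R) : 0 < rho -> holo h dh a rho ->
  exists l, cdiff dh a l.
Proof.
  intros Hrho Hh. destruct (taylor2 h dh a rho Hrho Hh) as [d [K [Hd [HK H]]]].
  set (q := fun c => ((dh (a + c) - dh a) / c)%C).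
  (* Cauchy's estimate on radius [d / 2]: the difference of the two quotients of [h] oscillates by
     at most [2 * (K * (Cmod c + Cmod e))]. *)
  set (B := 2 * K / (d / 2)).
  assert (HB : 0 <= B) by (unfold B; apply Rdiv_le_0_compat; lra).
  assert (Hin : forall z c, Cmod (z - a) < d / 2 -> Cmod c < d / 2 -> Cmod (z + c - a) < d).
  { intros z c Hz Hc. replace (z + c - a)%C with ((z - a) + c)%C by ring.
    eapply Rle_lt_trans; [apply Cmod_triangle | lra]. }
  assert (Ha : Cmod (a - a) < d / 2) by (rewrite Cmod_sub_self; lra).
  assert (Hq : forall c e : C, c <> 0%C -> e <> 0%C -> Cmod c < d / 2 -> Cmod e < d / 2 ->
    Cmod (q c - q e) <= B * (Cmod c + Cmod e)).
  { intros c e Hc0 He0 Hc He.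
    set (Q := fun c z => (/ c * (h (z + c) - h z))%C).
    assert (DQ : forall c z, Cmod c < d / 2 -> Cmod (z - a) < d / 2 ->
       cdiff (Q c) z (/ c * (dh (z + c) - dh z))%C).
    { intros c1 z Hc1 Hz. apply cdiff_mult_c. apply cdiff_minus.
      - apply cdiff_shift, Hh. specialize (Hin z c1 Hz Hc1). lra.
      - apply Hh. lra. }
    assert (EQ : forall c z : C, c <> 0%C -> Cmod c < d / 2 -> Cmod (z - a) < d / 2 ->
       Cmod (Q c z - dh z) <= K * Cmod c).
    { intros c1 z Hc1 Hc2 Hz. pose proof (H z (z + c1)%C ltac:(lra) (Hin z c1 Hz Hc2)) as T.
      replace (z + c1 - z)%C with c1 in T by ring.
      replace (Q c1 z - dh z)%C with (/ c1 * (h (z + c1) - h z - dh z * c1))%C by (unfold Q; field; auto).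
      rewrite Cmod_mult, Cmod_inv by auto. apply Cmod_gt_0 in Hc1.
      apply Rmult_le_reg_l with (Cmod c1); auto. rewrite <- Rmult_assoc, Rinv_r, Rmult_1_l by lra. lra. }
    assert (EE : forall z, Cmod (z - a) < d / 2 -> Cmod (Q c z - Q e z) <= K * (Cmod c + Cmod e)).
    { intros z Hz. pose proof (EQ c z Hc0 Hc Hz). pose proof (EQ e z He0 He Hz) as H2.
      pose proof (Cmod_sub_triangle (Q c z) (dh z) (Q e z)) as H3. rewrite (Cmod_sub_sym (dh z)) in H3. lra. }
    replace (B * (Cmod c + Cmod e)) with (2 * (K * (Cmod c + Cmod e)) / (d / 2)) by (unfold B; field; lra).
    apply (cauchy_estimate (fun z => Q c z - Q e z)%C a); [lra | | |].
    - intros z Hz. eexists. apply cdiff_minus; apply DQ; auto.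
    - apply (cdiff_ext (fun z => Q c z - Q e z)%C _ a
        (/ c * (dh (a + c) - dh a) - / e * (dh (a + e) - dh a))%C); auto.
      + unfold q. field. auto.
      + apply cdiff_minus; apply DQ; auto.
    - intros z Hz. eapply Rle_trans; [apply Cmod_sub_le|].
      pose proof (EE z Hz). pose proof (EE a Ha). lra. }
  (* A cluster point of the quotients along this null sequence is the candidate derivative; [Hq]
     upgrades it to a limit over all [c], with error [B * Cmod c]. *)
  set (cs := fun n : nat => RtoC (d / 4 * / (INR n + 1))).
  assert (Ppos : forall n, 0 < / (INR n + 1) <= 1).
  { intro n. pose proof (pos_INR n). split; [apply Rinv_0_lt_compat; lra|].
    rewrite <- Rinv_1. apply Rinv_le_contravar; lra. }
  assert (Ccs : forall n, Cmod (cs n) = d / 4 * / (INR n + 1)).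
  { intro n. unfold cs. specialize (Ppos n). rewrite Cmod_R. apply Rabs_pos_eq. nra. }
  assert (Cn0 : forall n, cs n <> 0%C /\ Cmod (cs n) < d / 2).
  { intro n. specialize (Ppos n). split; [apply Cmod_gt_0|]; rewrite Ccs; nra. }
  destruct (C_cluster (fun n => q (cs n)) (Cmod (q (cs O)) + B * d)) as [l Hl].
  { intro n. pose proof (Hq (cs n) (cs O) (proj1 (Cn0 n)) (proj1 (Cn0 O)) (proj2 (Cn0 n)) (proj2 (Cn0 O))) as T.
    pose proof (Cmod_sub_ge (q (cs n)) (q (cs O))).
    pose proof (proj2 (Cn0 n)). pose proof (proj2 (Cn0 O)).
    assert (B * (Cmod (cs n) + Cmod (cs O)) <= B * d) by (apply Rmult_le_compat_l; lra). lra. }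
  assert (HL : forall c : C, c <> 0%C -> Cmod c < d / 2 -> Cmod (q c - l) <= B * Cmod c).
  { intros c Hc0 Hc. apply Rnot_lt_le. intro Hn.
    set (g := Cmod (q c - l) - B * Cmod c) in *. assert (Hg : 0 < g) by (unfold g; lra).
    destruct (archimed_cor1 (g / (2 * (B * d + 1)))) as [N [HN1 HN2]].
    { apply Rdiv_lt_0_compat; nra. }
    destruct (Hl (g / 2) ltac:(lra) N) as [n [Hn1 Hn2]].
    destruct (Cn0 n) as [Cn1 Cn2].
    pose proof (Hq c (cs n) Hc0 Cn1 Hc Cn2) as T.
    pose proof (Cmod_sub_triangle (q c) (q (cs n)) l) as T2.
    assert (Cmod (cs n) <= d * / INR N).
    { rewrite Ccs. assert (/ (INR n + 1) <= / INR N).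
      { apply Rinv_le_contravar; [apply lt_0_INR; lia|]. apply le_INR in Hn1. lra. }
      specialize (Ppos n). nra. }
    assert (B * Cmod (cs n) <= B * d * / INR N) by (rewrite Rmult_assoc; apply Rmult_le_compat_l; auto).
    assert (0 <= B * d) by nra.
    assert (B * d * / INR N <= B * d * (g / (2 * (B * d + 1)))) by (apply Rmult_le_compat_l; lra).
    assert (B * d * (g / (2 * (B * d + 1))) < g / 2).
    { replace (B * d * (g / (2 * (B * d + 1)))) with ((g / 2) * (B * d / (B * d + 1))) by (field; lra).
      assert (B * d / (B * d + 1) < 1) by (apply Rlt_div_l; lra). nra. }
    unfold g in *. lra. }
  exists l. intros eps He. exists (Rmin (d / 2) (eps / (B + 1))). split.
  { apply Rmin_glb_lt; [lra | apply Rdiv_lt_0_compat; lra]. }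
  intros w Hw.
  assert (Hw1 := Rlt_le_trans _ _ _ Hw (Rmin_l _ _)).
  assert (Hw2 := Rlt_le_trans _ _ _ Hw (Rmin_r _ _)).
  destruct (Ceq_dec w a) as [->|n].
  { replace (dh a - dh a - l * (a - a))%C with (RtoC 0) by ring. rewrite Cmod_0, Cmod_sub_self. lra. }
  assert (n' : (w - a <> 0)%C) by (apply Cminus_eq_contra; auto).
  specialize (HL (w - a)%C n' Hw1).
  replace (dh w - dh a - l * (w - a))%C with ((q (w - a) - l) * (w - a))%C.
  2:{ unfold q. replace (a + (w - a))%C with w by ring. field. auto. }
  rewrite Cmod_mult. apply Rmult_le_compat_r; [apply Cmod_ge_0|].
  apply Rlt_div_r in Hw2; [|lra]. pose proof (Cmod_ge_0 (w - a)). nra.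
Qed.

(** * Entire functions *)

Definition centire (f : C -> C) : Prop := forall z, exists l, cdiff f z l.

Lemma centire_deriv (f : C -> C) : centire f -> exists df, forall z, cdiff f z (df z).
Proof. intro H. apply (choice (fun z l => cdiff f z l)), H. Qed.

Lemma centire_cont (f : C -> C) (z : C) : centire f -> ccont f z.
Proof. intro H. destruct (H z) as [l Hl]. apply (cdiff_cont _ _ _ Hl). Qed.

(** At [a] the derivative of the quotient is half the second derivative [l] of [f]: the Taylor
    remainder [T] has derivative [df x - df a - l * (x - a)], which is small compared with
    [x - a]. *)
Lemma dquot_entire (f df : C -> C) (a : C) : (forall z, cdiff f z (df z)) ->
  centire (dquot f a (df a)).
Proof.
  intros Hf z. destruct (Ceq_dec z a) as [->|n].
  2:{ apply (dquot_diff f a (df a) z (df z)); auto. }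
  destruct (deriv_diff f df a 1 Rlt_0_1) as [l Hl]; [intros w _; auto|].
  assert (H2 : RtoC 2 <> 0%C) by (intro E; injection E; lra).
  exists (l / 2)%C. intros eps He. destruct (Hl eps He) as [d [Hd H]]. exists d; split; auto.
  intros w Hw. rewrite dquot_eq. destruct (Ceq_dec w a) as [->|n].
  { rewrite dquot_eq. replace (df a - df a - l / 2 * (a - a))%C with (RtoC 0) by (field; auto).
    rewrite Cmod_0, Cmod_sub_self. lra. }
  rewrite dquot_neq by auto. assert (n' : (w - a <> 0)%C) by (apply Cminus_eq_contra; auto).
  set (T := fun x => (f x - df a * x - l / 2 * ((x - a) * (x - a)))%C).
  assert (B : Cmod (T w - T a) <= eps * Cmod (w - a) * Cmod (w - a)).
  { apply (mean_value_ineq T (fun x => df x - df a * 1 - l / 2 * (1 * (x - a) + (x - a) * 1))%C).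
    intros t Ht. split.
    - apply cdiff_minus; [apply cdiff_minus; [auto | apply cdiff_mult_c, cdiff_id]|].
      apply cdiff_mult_c. apply (cdiff_mult (fun x => x - a)%C (fun x => x - a)%C);
        apply cdiff_sub_c, cdiff_id.
    - set (x := seg a w t).
      replace (df x - df a * 1 - l / 2 * (1 * (x - a) + (x - a) * 1))%C
        with (df x - df a - l * (x - a))%C by (field; auto).
      assert (Hx : Cmod (x - a) <= Cmod (w - a)).
      { unfold x. rewrite <- (seg_0 a w) at 2. rewrite seg_sub, Rabs_pos_eq by lra.
        pose proof (Cmod_ge_0 (w - a)). nra. }
      eapply Rle_trans; [apply H; lra|]. apply Rmult_le_compat_l; lra. }
  replace ((f w - f a) / (w - a) - df a - l / 2 * (w - a))%C with ((T w - T a) / (w - a))%C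
    by (unfold T; field; auto).
  rewrite Cmod_div by auto. apply Cmod_gt_0 in n'. apply Rle_div_l; auto.
Qed.

Lemma Cmod_sq_expand (a p z : C) :
  Cmod (z - a) * Cmod (z - a) =
  Cmod (p - a) * Cmod (p - a) + 2 * fst (Cconj (p - a) * (z - p))%C + Cmod (z - p) * Cmod (z - p).
Proof. rewrite !Cmod_sq. simpl. ring. Qed.

Lemma rcont_fst (f : C -> C) (z : C) : ccont f z -> rcont (fun w => fst (f w)) z.
Proof.
  intros H eps He. destruct (H eps He) as [d [Hd H1]]. exists d; split; auto.
  intros w Hw. specialize (H1 w Hw). pose proof (fst_le_Cmod (f w - f z)%C) as F.
  simpl in F. unfold Rminus. lra.
Qed.

(* The term [e |z - a|^2] makes the mean value inequality strict at an interior maximum. *)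
Lemma max_principle (f : C -> C) (a : C) (r M : R) : 0 < r -> centire f ->
  (forall z, Cmod (z - a) = r -> Cmod (f z) <= M) ->
  forall z, Cmod (z - a) <= r -> Cmod (f z) <= M.
Proof.
  intros Hr Hf HM b Hb. apply Rnot_lt_le. intro Hn.
  set (c := Cconj (f b)).
  assert (HM0 : 0 <= M).
  { specialize (HM (a + RtoC r)%C). replace (a + RtoC r - a)%C with (RtoC r) in HM by ring.
    rewrite Cmod_R, Rabs_pos_eq in HM by lra. specialize (HM eq_refl).
    eapply Rle_trans; [apply Cmod_ge_0 | apply HM]. }
  set (g := Cmod (f b) * Cmod (f b) - Cmod (f b) * M).
  assert (Hg : 0 < g) by (unfold g; nra).
  (* The perturbation on the circle is then half the gap [g], too little to move the maximum of [u]
     there. *)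
  set (e := g / (2 * (r * r))). assert (He : 0 < e) by (apply Rdiv_lt_0_compat; nra).
  assert (Her : e * (r * r) = g / 2) by (unfold e; field; lra).
  (* [e |z - a|^2] is not the real part of a holomorphic function, but expanded about [p] it is the
     real part of an affine one plus [e |z - p|^2], which is constant on circles about [p]. *)
  set (Phi := fun p z => (c * f z + RtoC (2 * e) * (Cconj (p - a) * (z - p)))%C).
  assert (DPhi : forall p, centire (Phi p)).
  { intros p z. destruct (Hf z) as [l Hl]. eexists. apply cdiff_plus.
    - apply cdiff_mult_c, Hl.
    - apply cdiff_mult_c, cdiff_mult_c, cdiff_sub_c, cdiff_id. }
  set (u := fun z => fst (c * f z)%C + e * (Cmod (z - a) * Cmod (z - a))).
  assert (EPhi : forall p z, fst (Phi p z) = u z - e * (Cmod (p - a) * Cmod (p - a)) - e * (Cmod (z - p) * Cmod (z - p))).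
  { intros p z. unfold u. rewrite (Cmod_sq_expand a p z). unfold Phi. simpl. ring. }
  destruct (disc_max u a r) as [p [Hp1 Hp2]]; [lra | |].
  { intros z _. intros eps Heps.
    destruct (rcont_fst (Phi z) z (centire_cont _ _ (DPhi z)) (eps / 2)) as [d [Hd H]]; [lra|].
    exists (Rmin d (Rmin 1 (eps / (2 * e)))). split.
    { repeat apply Rmin_glb_lt; try lra. apply Rdiv_lt_0_compat; lra. }
    intros w Hw.
    assert (Hw1 := Rlt_le_trans _ _ _ Hw (Rmin_l _ _)).
    assert (Hw' := Rlt_le_trans _ _ _ Hw (Rmin_r _ _)).
    assert (Hw2 := Rlt_le_trans _ _ _ Hw' (Rmin_l _ _)).
    assert (Hw3 := Rlt_le_trans _ _ _ Hw' (Rmin_r _ _)).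
    specialize (H w Hw1). rewrite !EPhi, Cmod_sub_self in H.
    apply Rlt_div_r in Hw3; [|lra]. pose proof (Cmod_ge_0 (w - z)).
    apply Rabs_def2 in H.
    assert (e * (Cmod (w - z) * Cmod (w - z)) <= e * Cmod (w - z)) by (apply Rmult_le_compat_l; nra).
    assert (0 <= e * (Cmod (w - z) * Cmod (w - z))) by (apply Rmult_le_pos; nra).
    apply Rabs_def1; lra. }
  assert (Hub : u b <= u p) by auto.
  assert (Ub : Cmod (f b) * Cmod (f b) <= u b).
  { unfold u, c. rewrite fst_conj_mul. pose proof (Cmod_ge_0 (b - a)).
    assert (0 <= e * (Cmod (b - a) * Cmod (b - a))) by (apply Rmult_le_pos; nra). lra. }
  destruct Hp1 as [Hp1|Hp1].
  2:{ unfold u in Hub at 2. rewrite Hp1, Her in Hub.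
      pose proof (fst_bounds (c * f p)%C) as [_ F]. rewrite Cmod_mult in F.
      unfold c in F. rewrite Cmod_conj in F. fold c in F. specialize (HM p Hp1).
      pose proof (Cmod_ge_0 (f b)).
      assert (Cmod (f b) * Cmod (f p) <= Cmod (f b) * M) by (apply Rmult_le_compat_l; auto).
      unfold g in *. lra. }
  set (dl := (r - Cmod (p - a)) / 2). assert (Hdl : 0 < dl) by (unfold dl; lra).
  pose proof (mean_value_le (Phi p) p (2 * dl) dl (u p - e * (Cmod (p - a) * Cmod (p - a)) - e * (dl * dl))) as K.
  rewrite EPhi, Cmod_sub_self in K.
  assert (u p - e * (Cmod (p - a) * Cmod (p - a)) - e * (0 * 0) <=
          u p - e * (Cmod (p - a) * Cmod (p - a)) - e * (dl * dl)).
  { apply K; [lra | | |].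
    - intros z _. apply DPhi.
    - apply centire_cont, DPhi.
    - intros z Hz. rewrite EPhi, Hz.
      assert (u z <= u p); [|lra]. apply Hp2.
      pose proof (Cmod_sub_triangle z p a). unfold dl in *. lra. }
  assert (0 < e * (dl * dl)) by (apply Rmult_lt_0_compat; nra). lra.
Qed.

Lemma small_on_circles_zero (q : C -> C) : centire q ->
  (forall eps X, 0 < eps -> exists r, X < r /\ forall z, Cmod z = r -> Cmod (q z) <= eps) ->
  forall z, q z = 0%C.
Proof.
  intros Hq H z. apply Cmod_eq_0. apply Rle_antisym; [|apply Cmod_ge_0].
  apply (le_eps_mul _ 1); [lra|]. intros eps He.
  destruct (H eps (Cmod z + 1) He) as [r [Hr H1]]. pose proof (Cmod_ge_0 z).
  rewrite Rmult_1_r. apply (max_principle q 0 r); auto; [lra | |].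
  - intros w Hw. apply H1. rewrite <- Hw. f_equal. ring.
  - replace (z - 0)%C with z by ring. lra.
Qed.

(** Passing to [(f z - f 0) / z] lowers the exponent by one; at exponent 0 this quotient is small on
    large circles, hence zero. The bound is asked only on arbitrarily large circles, since the
    lifting argument controls no others. *)
Lemma polynomial_growth (m : nat) : forall (f : C -> C) (K : R), centire f ->
  (forall X, exists r, X < r /\ forall z, Cmod z = r -> Cmod (f z) <= K * r ^ m) ->
  is_polynomial f.
Proof.
  assert (Q : forall (f df : C -> C) (r B : R), 0 < r -> (forall z, cdiff f z (df z)) ->
     (forall z, Cmod z = r -> Cmod (f z) <= B) ->
     forall z, Cmod z = r -> Cmod (dquot f 0 (df 0) z) <= (B + Cmod (f 0)) / r).
  { intros f df r B Hr Hf HB z Hz.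
    assert (z0 : z <> 0%C) by (apply Cmod_gt_0; lra).
    rewrite dquot_neq by auto. replace (z - 0)%C with z by ring.
    rewrite Cmod_div, Hz by auto. apply Rmult_le_compat_r; [left; apply Rinv_0_lt_compat; auto|].
    eapply Rle_trans; [apply Cmod_sub_le|]. specialize (HB z Hz). lra. }
  induction m as [|m IH]; intros f K Hf H; destruct (centire_deriv f Hf) as [df Hdf].
  - assert (Z : forall z, dquot f 0 (df 0) z = 0%C).
    { apply small_on_circles_zero; [apply dquot_entire; auto|]. intros eps X He.
      set (B := K + Cmod (f 0)).
      destruct (H (Rmax X (Rmax 1 (B / eps)))) as [r [Hr H1]].
      pose proof (Rmax_l X (Rmax 1 (B / eps))). pose proof (Rmax_r X (Rmax 1 (B / eps))).
      pose proof (Rmax_l 1 (B / eps)). pose proof (Rmax_r 1 (B / eps)).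
      exists r. split; [lra|]. intros z Hz.
      assert (K1 : Cmod (dquot f 0 (df 0) z) <= (K * r ^ 0 + Cmod (f 0)) / r) by (apply Q; auto; lra).
      simpl in K1. rewrite Rmult_1_r in K1. fold B in K1.
      eapply Rle_trans; [apply K1|]. apply Rle_div_l; [lra|].
      assert (B / eps < r) by lra. apply Rlt_div_l in H5; lra. }
    exists (f 0%C :: nil). intro z. rewrite (dquot_spec f 0 (df 0%C) z), Z. 
    change (f 0%C + (z - 0) * 0 = f 0%C + z * 0)%C. ring.
  - destruct (IH (dquot f 0 (df 0%C)) (Rmax 0 K + Cmod (f 0%C))) as [cs Hcs].
    + apply dquot_entire; auto.
    + intro X. destruct (H (Rmax X 1)) as [r [Hr H1]].
      pose proof (Rmax_l X 1). pose proof (Rmax_r X 1).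
      exists r. split; [lra|]. intros z Hz.
      eapply Rle_trans; [apply (Q f df r (K * r ^ S m)); auto; lra|].
      apply Rle_div_l; [lra|].
      assert (1 <= r ^ m) by (apply pow_R1_Rle; lra). simpl.
      pose proof (Cmod_ge_0 (f 0%C)). pose proof (Rmax_r 0 K).
      assert (0 <= r * r ^ m) by nra.
      assert (K * (r * r ^ m) <= Rmax 0 K * (r * r ^ m)) by (apply Rmult_le_compat_r; auto).
      assert (Cmod (f 0%C) * 1 <= Cmod (f 0%C) * (r * r ^ m)) by (apply Rmult_le_compat_l; nra).
      lra.
    + exists (f 0%C :: cs). intro z. simpl. rewrite <- Hcs.
      rewrite (dquot_spec f 0 (df 0%C) z) at 1.
      change (f 0%C + (z - 0) * dquot f 0 (df 0%C) z = f 0%C + z * dquot f 0 (df 0%C) z)%C. ring.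
Qed.

(** * Isolated values, open mapping and local inverses *)

Definition nonconst (f : C -> C) : Prop := exists a b, f a <> f b.

(** Otherwise, by compactness, every circle of radius below [d0] carries a point with value [E p].
    Then [E - E p] is divisible by every power of [z - p], and the maximum principle for the
    cofactor gives [Cmod (E z - E p) <= (s / r)^k * M] for all [k], so [E] is constant. *)
Lemma isolated_values (E : C -> C) (p : C) (d0 : R) : centire E -> nonconst E -> 0 < d0 ->
  exists d m, 0 < d < d0 /\ 0 < m /\ forall z, Cmod (z - p) = d -> m <= Cmod (E z - E p).
Proof.
  intros HE HN Hd0. apply NNPP. intro Hno.
  assert (DE : centire (fun z => E z - E p)%C).
  { intro z. destruct (HE z) as [l Hl]. exists l. apply cdiff_sub_c; auto. }
  assert (Zr : forall d, 0 < d < d0 -> exists z, Cmod (z - p) = d /\ E z = E p).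
  { intros d Hd.
    destruct (circle_max (fun z => - Cmod (E z - E p)) p d) as [q [Hq1 Hq2]]; [lra | |].
    { intros z _. apply rcont_opp. apply (rcont_Cmod (fun z => E z - E p)%C). apply centire_cont; auto. }
    exists q. split; auto. apply Cmod_sub_eq0. apply NNPP. intro Hnz. apply Hno.
    exists d, (Cmod (E q - E p)). pose proof (Cmod_ge_0 (E q - E p)). repeat split; try lra.
    intros z Hz. specialize (Hq2 z Hz). lra. }
  assert (Fac : forall k : nat, exists q, centire q /\ forall z, (E z - E p = (z - p) ^ k * q z)%C).
  { induction k as [|k [q [Hq Eq]]].
    - exists (fun z => E z - E p)%C. split; auto. intro z. simpl. ring.
    - assert (q0 : q p = 0%C).
      { apply Cmod_eq_0. apply Rle_antisym; [|apply Cmod_ge_0].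
        apply (le_eps_mul _ 1); [lra|]. intros eps He. rewrite Rmult_1_r.
        destruct (centire_cont q p Hq eps He) as [d [Hd H]].
        assert (M3 : 0 < Rmin d d0) by (apply Rmin_glb_lt; auto).
        assert (M1 := Rmin_l d d0). assert (M2 := Rmin_r d d0).
        destruct (Zr (Rmin d d0 / 2)) as [z [Hz1 Hz2]]; [lra|].
        specialize (H z ltac:(lra)). specialize (Eq z). rewrite Hz2 in Eq.
        assert (qz : q z = 0%C).
        { apply NNPP. intro nq. assert (zp : (z - p <> 0)%C) by (apply Cmod_gt_0; lra).
          apply (Cmult_neq_0 ((z - p) ^ k)%C (q z)); auto.
          - apply Cmod_gt_0. rewrite Cmod_pow. apply pow_lt. lra.
          - rewrite <- Eq. ring. }
        rewrite qz in H. replace (0 - q p)%C with (- q p)%C in H by ring. rewrite Cmod_opp in H. lra. }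
      destruct (centire_deriv q Hq) as [dq Hdq].
      exists (dquot q p (dq p)). split; [apply dquot_entire; auto|].
      intro z. rewrite Eq. rewrite (dquot_spec q p (dq p) z) at 1. rewrite q0. simpl. ring. }
  assert (Const : forall z, E z = E p).
  { intro z. apply Cmod_sub_eq0. apply Rle_antisym; [|apply Cmod_ge_0].
    set (s := Cmod (z - p)). assert (Hs : 0 <= s) by apply Cmod_ge_0. set (r := s + 1).
    destruct (circle_max (fun z => Cmod (E z - E p)) p r) as [w [Hw1 Hw2]]; [unfold r; lra | |].
    { intros x _. apply (rcont_Cmod (fun z => E z - E p)%C). apply centire_cont; auto. }
    set (M := Cmod (E w - E p)) in *.
    apply (le_eps_mul _ (M + 1)); [unfold M; pose proof (Cmod_ge_0 (E w - E p)); lra|].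
    intros eps He.
    destruct (pow_lt_1_zero (s / r)) with (y := eps) as [k Hk]; auto.
    { rewrite Rabs_pos_eq; [apply Rlt_div_l; unfold r; lra | apply Rdiv_le_0_compat; unfold r; lra]. }
    specialize (Hk k ltac:(lia)).
    destruct (Fac k) as [q [Hq Eq]].
    assert (Hrk : 0 < r ^ k) by (apply pow_lt; unfold r; lra).
    assert (Bq : Cmod (q z) <= M / r ^ k).
    { apply (max_principle q p r); auto; [unfold r; lra | | fold s; unfold r; lra].
      intros x Hx. apply Rle_div_r; auto. specialize (Hw2 x Hx). rewrite Eq, Cmod_mult, Cmod_pow, Hx in Hw2. lra. }
    rewrite Eq, Cmod_mult, Cmod_pow. fold s.
    assert (0 <= s / r) by (apply Rdiv_le_0_compat; unfold r; lra).
    rewrite Rabs_pos_eq in Hk by (apply pow_le; auto).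
    apply Rle_trans with (s ^ k * (M / r ^ k)).
    { apply Rmult_le_compat_l; auto. apply pow_le; auto. }
    replace (s ^ k * (M / r ^ k)) with ((s / r) ^ k * M).
    2:{ unfold Rdiv. rewrite Rpow_mult_distr, pow_inv. ring. }
    assert (0 <= M) by apply Cmod_ge_0. 
    assert (0 <= (s / r) ^ k) by (apply pow_le; auto). nra. }
  destruct HN as [a [b Hab]]. apply Hab. rewrite !Const. auto.
Qed.

Lemma open_mapping (E : C -> C) (p : C) (eps : R) : centire E -> nonconst E -> 0 < eps ->
  exists r, 0 < r /\ forall w, Cmod (w - E p) < r -> exists z, Cmod (z - p) < eps /\ E z = w.
Proof.
  intros HE HN He. destruct (isolated_values E p eps HE HN He) as [d [m [Hd [Hm H]]]].
  exists (m / 2). split; [lra|]. intros w Hw.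
  apply (disc_cover E p eps d m); auto.
Qed.

(** Near [p] the map differs from its linear part by a [k]-Lipschitz map with [k] half of
    [Cmod (dE p)], so distances shrink at most by the factor [k]. On a circle this lower bound is
    the hypothesis of [disc_cover]. *)
Lemma local_section (E dE : C -> C) (p : C) (d0 : R) : (forall z, cdiff E z (dE z)) ->
  dE p <> 0%C -> 0 < d0 ->
  exists d r k, 0 < d < d0 /\ 0 < r /\ 0 < k /\
    (forall z1 z2, Cmod (z1 - p) < d -> Cmod (z2 - p) < d -> k * Cmod (z1 - z2) <= Cmod (E z1 - E z2)) /\
    (forall w, Cmod (w - E p) < r -> exists z, Cmod (z - p) < d /\ E z = w).
Proof.
  intros HE Hp Hd0. apply Cmod_gt_0 in Hp. set (k := Cmod (dE p) / 2).
  destruct (deriv_cont E dE p 1 Rlt_0_1 ltac:(intros z _; auto) k ltac:(unfold k; lra)) as [d1 [Hd1 H1]].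
  assert (M1 := Rmin_l d0 d1). assert (M2 := Rmin_r d0 d1).
  assert (M3 : 0 < Rmin d0 d1) by (apply Rmin_glb_lt; auto).
  set (d := Rmin d0 d1 / 2).
  assert (L : forall z1 z2, Cmod (z1 - p) < d -> Cmod (z2 - p) < d -> k * Cmod (z1 - z2) <= Cmod (E z1 - E z2)).
  { intros z1 z2 Hz1 Hz2.
    assert (B : Cmod ((E z1 - dE p * z1) - (E z2 - dE p * z2)) <= k * Cmod (z1 - z2)).
    { apply (mean_value_disc (fun z => E z - dE p * z)%C (fun z => dE z - dE p * 1)%C p z2 z1 d k); auto.
      - intros z _. apply cdiff_minus; auto. apply cdiff_mult_c, cdiff_id.
      - intros z Hz. replace (dE z - dE p * 1)%C with (dE z - dE p)%C by ring. left. apply H1.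
        unfold d in Hz. lra. }
    pose proof (Cmod_sub_ge (dE p * (z1 - z2)) (E z1 - E z2))%C as T2. rewrite Cmod_mult in T2.
    rewrite (Cmod_sub_sym (dE p * (z1 - z2))%C) in T2.
    replace (E z1 - E z2 - dE p * (z1 - z2))%C with ((E z1 - dE p * z1) - (E z2 - dE p * z2))%C in T2 by ring.
    replace (Cmod (dE p)) with (2 * k) in T2 by (unfold k; field). lra. }
  exists d, (k * (d / 2) / 2), k.
  assert (0 < k) by (unfold k; lra). assert (0 < d) by (unfold d; lra).
  split; [unfold d in *; lra|]. split; [nra|]. split; auto. split; auto.
  intros w Hw. apply (disc_cover E p d (d / 2) (k * (d / 2))); auto; [lra | |].
  - intros z _. eexists; auto.
  - intros z Hz. rewrite <- Hz. apply L; [lra | rewrite Cmod_sub_self; auto].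
Qed.

(** * Lifting of paths and of maps on convex domains *)

Lemma Cnorm_Cmod (z : C) : Cnorm z = Cmod z.
Proof. unfold Cnorm, Cmod. f_equal. ring. Qed.

Lemma Cnorm_Csub (z w : C) : Cnorm (Csub z w) = Cmod (z - w).
Proof. apply Cnorm_Cmod. Qed.

(** Connectedness of [[0, T]] as an induction principle: if [P] can be carried across every [t], the
    supremum of the times where it holds cannot lie below [T]. *)
Lemma real_induction (P : R -> Prop) (T : R) : 0 <= T -> P 0 ->
  (forall t, 0 <= t <= T -> exists eta, 0 < eta /\ forall a b, 0 <= a -> b <= T ->
     t - eta < a <= t -> t <= b < t + eta -> P a -> P b) ->
  P T.
Proof.
  intros HT H0 H.
  destruct (completeness (fun t => 0 <= t <= T /\ P t)) as [S [HS1 HS2]].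
  { exists T. intros t Ht; lra. }
  { exists 0. split; auto; lra. }
  assert (S0 : 0 <= S) by (apply HS1; split; auto; lra).
  assert (ST : S <= T) by (apply HS2; intros t Ht; lra).
  destruct (H S ltac:(lra)) as [eta [He Hs]].
  assert (Ha : exists a, (0 <= a <= T /\ P a) /\ S - eta < a).
  { apply NNPP. intro Hn. assert (S <= S - eta); [|lra].
    apply HS2. intros t Ht. apply Rnot_lt_le. intro. apply Hn. eauto. }
  destruct Ha as [a [[Ha1 Ha2] Ha3]].
  assert (aS : a <= S) by (apply HS1; auto).
  set (b := Rmin T (S + eta / 2)).
  assert (b1 := Rmin_l T (S + eta / 2)). assert (b2 := Rmin_r T (S + eta / 2)).
  assert (b3 : S <= b) by (apply Rmin_glb; lra). fold b in b1, b2.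
  assert (Pb : P b) by (apply (Hs a b); auto; lra).
  assert (bS : b <= S) by (apply HS1; split; auto; lra).
  destruct (Rle_or_lt T (S + eta / 2)) as [h|h].
  - replace T with b; auto. apply Rmin_left; auto.
  - assert (b = S + eta / 2) by (apply Rmin_right; lra). lra.
Qed.

(** For properties inherited by smaller times, such as the existence of a lift, crossing [t] splits
    into a passage to the limit and a step beyond, which have different reasons. *)
Lemma real_induction_limit (P : R -> Prop) (T : R) : 0 <= T -> P 0 ->
  (forall s t, 0 <= s <= t -> P t -> P s) ->
  (forall t, 0 <= t < T -> P t -> exists t', t < t' <= T /\ P t') ->
  (forall t, 0 < t <= T -> (forall s, 0 <= s < t -> P s) -> P t) ->
  P T.
Proof.
  intros HT H0 Hdown Hstep Hlim.
  destruct (completeness (fun t => 0 <= t <= T /\ P t)) as [S [HS1 HS2]].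
  { exists T. intros t Ht; lra. }
  { exists 0. split; auto; lra. }
  assert (S0 : 0 <= S) by (apply HS1; split; auto; lra).
  assert (ST : S <= T) by (apply HS2; intros t Ht; lra).
  assert (PS : P S).
  { destruct S0 as [S0|<-]; auto. apply Hlim; [lra|]. intros s Hs. apply NNPP. intro Hn.
    assert (S <= s); [|lra]. apply HS2. intros t [Ht1 Ht2]. apply Rnot_lt_le. intro.
    apply Hn. apply (Hdown s t); auto; lra. }
  destruct ST as [ST| ->]; auto.
  destruct (Hstep S ltac:(lra) PS) as [t' [Ht1 Ht2]].
  assert (t' <= S) by (apply HS1; split; auto; lra). lra.
Qed.

Definition cont_on (g : R -> C) (T : R) : Prop :=
  forall t, 0 <= t <= T -> forall eps, 0 < eps -> exists d, 0 < d /\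
    forall s, 0 <= s <= T -> Rabs (s - t) < d -> Cmod (g s - g t) < eps.

Lemma stay_inside (g : R -> C) (p : C) (d T : R) : 0 <= T -> cont_on g T ->
  Cmod (g 0 - p) < d -> (forall t, 0 <= t <= T -> Cmod (g t - p) <> d) -> Cmod (g T - p) < d.
Proof.
  intros HT Hg H0 Hd. apply (real_induction (fun t => Cmod (g t - p) < d) T); auto.
  intros t Ht. specialize (Hd t Ht).
  destruct (Hg t Ht (Rabs (Cmod (g t - p) - d))) as [eta [He H]].
  { apply Rabs_pos_lt. lra. }
  exists eta. split; auto. intros a b Ha Hb Ha2 Hb2 Pa.
  pose proof (H a ltac:(lra) ltac:(apply Rabs_def1; lra)) as A.
  pose proof (H b ltac:(lra) ltac:(apply Rabs_def1; lra)) as B.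
  pose proof (Cmod_sub_triangle (g t) (g a) p) as T1. rewrite (Cmod_sub_sym (g t) (g a)) in T1.
  pose proof (Cmod_sub_triangle (g b) (g t) p) as T2.
  destruct (Rtotal_order (Cmod (g t - p)) d) as [h|[h|h]]; [|contradiction|].
  - rewrite Rabs_left in B by lra. lra.
  - rewrite Rabs_pos_eq in A by lra. lra.
Qed.

Definition contp (g : R -> C) : Prop :=
  forall t, 0 <= t -> forall eps, 0 < eps -> exists d, 0 < d /\
    forall s, 0 <= s -> Rabs (s - t) < d -> Cmod (g s - g t) < eps.

(** A path that does not tend to infinity has a cluster point [p], with [E p = a]. On some small
    circle about [p] the values of [E] keep away from [a], so the late part of the path cannot cross
    it and stays near [p]. *)
Lemma path_alternative (E : C -> C) (g : R -> C) (a : C) : centire E -> nonconst E -> contp g ->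
  (forall eps, 0 < eps -> exists U, forall u, U <= u -> Cmod (E (g u) - a) < eps) ->
  (forall M, exists U, forall u, U <= u -> M < Cmod (g u)) \/
  (exists p, E p = a /\ forall eps, 0 < eps -> exists U, forall u, U <= u -> Cmod (g u - p) < eps).
Proof.
  intros HE HN Hg Ha.
  destruct (classic (forall M, exists U, forall u, U <= u -> M < Cmod (g u))) as [h|h]; auto.
  right. apply not_all_ex_not in h. destruct h as [M h].
  destruct (choice (fun n u => INR n <= u /\ Cmod (g u) <= M)) as [u Hu].
  { intro n. apply NNPP. intro Hn. apply h. exists (INR n). intros u Hu.
    apply Rnot_le_lt. intro. apply Hn. eauto. }
  destruct (C_cluster (fun n => g (u n)) M) as [p Hp]; [intro n; apply Hu|].
  assert (Late : forall eps U, 0 < eps -> exists v, U <= v /\ Cmod (g v - p) < eps).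
  { intros eps U He. destruct (INR_unbounded U) as [N HN1]. destruct (Hp eps He N) as [n [Hn1 Hn2]].
    exists (u n). split; auto. apply le_INR in Hn1. destruct (Hu n). lra. }
  assert (Ep : E p = a).
  { apply Cmod_sub_eq0. apply Rle_antisym; [|apply Cmod_ge_0].
    apply (le_eps_mul _ 2); [lra|]. intros eps He.
    destruct (centire_cont E p HE eps He) as [d [Hd H]]. destruct (Ha eps He) as [U HU].
    destruct (Late d U Hd) as [v [Hv1 Hv2]]. specialize (H _ Hv2). specialize (HU _ Hv1).
    pose proof (Cmod_sub_triangle (E p) (E (g v)) a) as T. rewrite (Cmod_sub_sym (E p) (E (g v))) in T. lra. }
  exists p. split; auto. intros eps He.
  destruct (isolated_values E p eps HE HN He) as [d [m [Hd [Hm H]]]].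
  destruct (Ha m Hm) as [U HU]. destruct (Late d (Rmax 0 U) ltac:(lra)) as [v [Hv1 Hv2]].
  pose proof (Rmax_l 0 U). pose proof (Rmax_r 0 U).
  exists v. intros x Hx. apply Rlt_trans with d; [|lra].
  replace x with (v + (x - v)) by ring.
  apply (stay_inside (fun t => g (v + t)) p d (x - v)); [lra | | rewrite Rplus_0_r; auto |].
  - intros t Ht e He2. destruct (Hg (v + t) ltac:(lra) e He2) as [dl [Hdl K]].
    exists dl. split; auto. intros s Hs Hst. apply K; [lra|].
    replace (v + s - (v + t)) with (s - t) by ring. auto.
  - intros t Ht Hc. specialize (H _ Hc). rewrite Ep in H.
    specialize (HU (v + t) ltac:(lra)). lra.
Qed.

(** The last two clauses exclude the obstructions to lifting paths in [{|w| > R0}]: branching at a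
    critical point, and a lift that runs off to infinity in finite time. *)
Definition lifts_over (E dE : C -> C) (R0 : R) : Prop :=
  (forall z, cdiff E z (dE z)) /\ nonconst E /\
  (forall z, R0 < Cmod (E z) -> dE z <> 0%C) /\
  (forall a, asymptotic_value E a -> Cmod a <= R0).

Lemma lifts_over_centire (E dE : C -> C) (R0 : R) : lifts_over E dE R0 -> centire E.
Proof. intros [H _] z. eauto. Qed.

Lemma lift_unique (E dE : C -> C) (R0 T : R) (g1 g2 : R -> C) : lifts_over E dE R0 -> 0 <= T ->
  cont_on g1 T -> cont_on g2 T -> (forall t, 0 <= t <= T -> E (g1 t) = E (g2 t)) ->
  (forall t, 0 <= t <= T -> R0 < Cmod (E (g1 t))) -> g1 0 = g2 0 -> g1 T = g2 T.
Proof.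
  intros [HE [_ [Hcr _]]] HT H1 H2 Heq HR H0.
  apply (real_induction (fun t => g1 t = g2 t) T); auto.
  intros t Ht.
  destruct (local_section E dE (g1 t) 1 HE (Hcr _ (HR t Ht)) Rlt_0_1) as [d [r [k [Hd [_ [Hk [Hinj _]]]]]]].
  (* Thirds, because [g2 t] is within [2 d / 3] of [g1 t] through the common value at [a], and
     [g2 b] within another third. *)
  destruct (H1 t Ht (d / 3) ltac:(lra)) as [e1 [He1 C1]].
  destruct (H2 t Ht (d / 3) ltac:(lra)) as [e2 [He2 C2]].
  assert (m1 := Rmin_l e1 e2). assert (m2 := Rmin_r e1 e2).
  exists (Rmin e1 e2). split; [apply Rmin_glb_lt; auto|].
  intros a b Ha Hb Ha2 Hb2 Pa.
  assert (inj : forall x y, Cmod (x - g1 t) < d -> Cmod (y - g1 t) < d -> E x = E y -> x = y).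
  { intros x y Hx Hy Hxy. apply Cmod_sub_eq0. specialize (Hinj x y Hx Hy).
    rewrite Hxy, Cmod_sub_self in Hinj. pose proof (Cmod_ge_0 (x - y)). nra. }
  pose proof (C1 a ltac:(lra) ltac:(apply Rabs_def1; lra)) as A1.
  pose proof (C2 a ltac:(lra) ltac:(apply Rabs_def1; lra)) as A2.
  pose proof (C1 b ltac:(lra) ltac:(apply Rabs_def1; lra)) as B1.
  pose proof (C2 b ltac:(lra) ltac:(apply Rabs_def1; lra)) as B2.
  assert (P2 : Cmod (g2 t - g1 t) < d * (2 / 3)).
  { pose proof (Cmod_sub_triangle (g2 t) (g2 a) (g1 t)) as T1. rewrite (Cmod_sub_sym (g2 t) (g2 a)) in T1.
    rewrite <- Pa in T1 at 2. lra. }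
  apply inj; [lra | | apply Heq; lra].
  pose proof (Cmod_sub_triangle (g2 b) (g2 t) (g1 t)). lra.
Qed.

Lemma cont_on_restrict (g : R -> C) (s t : R) : s <= t -> cont_on g t -> cont_on g s.
Proof.
  intros Hst H x Hx eps He. destruct (H x ltac:(lra) eps He) as [d [Hd K]].
  exists d. split; auto. intros y Hy. apply K. lra.
Qed.

Definition lift_upto (E : C -> C) (w : R -> C) (z0 : C) (t : R) (g : R -> C) : Prop :=
  cont_on g t /\ g 0 = z0 /\ forall s, 0 <= s <= t -> E (g s) = w s.

Lemma lift_step (E dE : C -> C) (R0 T t : R) (w : R -> C) (z0 : C) : lifts_over E dE R0 ->
  cont_on w T -> (forall s, 0 <= s <= T -> R0 < Cmod (w s)) -> 0 <= t < T ->
  (exists g, lift_upto E w z0 t g) -> exists t', t < t' <= T /\ exists g, lift_upto E w z0 t' g.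
Proof.
  intros [HE [_ [Hcr _]]] Hw HR Ht [g [Hg [Hg0 Hgw]]].
  assert (Egt : E (g t) = w t) by (apply Hgw; lra).
  assert (nz : dE (g t) <> 0%C) by (apply Hcr; rewrite Egt; apply HR; lra).
  destruct (local_section E dE (g t) 1 HE nz Rlt_0_1) as [d [r [k [Hd [Hr [Hk [Hinj Hsec]]]]]]].
  destruct (Hw t ltac:(lra) r Hr) as [eta [He Hwt]].
  set (t' := Rmin T (t + eta / 2)).
  assert (m1 := Rmin_l T (t + eta / 2)). assert (m2 := Rmin_r T (t + eta / 2)). fold t' in m1, m2.
  assert (m3 : t < t') by (apply Rmin_glb_lt; lra).
  exists t'. split; [lra|].
  (* Preimages are picked independently for each [s]; their continuity is recovered from the lower
     bound [Hinj]. *)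
  destruct (choice (fun s z => t <= s <= t' -> Cmod (z - g t) < d /\ E z = w s)) as [sg Hsg].
  { intro s. destruct (classic (t <= s <= t')) as [h|h].
    - destruct (Hsec (w s)) as [z Hz].
      + rewrite Egt. apply Hwt; [lra|]. apply Rabs_def1; lra.
      + exists z. auto.
    - exists (RtoC 0). intro; contradiction. }
  set (G := fun s => if Rle_dec s t then g s else sg s).
  assert (G1 : forall s, s <= t -> G s = g s).
  { intros s Hs. unfold G. destruct (Rle_dec s t); [auto | contradiction]. }
  assert (G2 : forall s, t <= s <= t' -> Cmod (G s - g t) < d /\ E (G s) = w s).
  { intros s Hs. unfold G. destruct (Rle_dec s t) as [h|h]; [|apply Hsg; lra].
    replace s with t by lra. rewrite Cmod_sub_self. split; [lra | auto]. }
  exists G. split; [|split].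
  - intros s Hs eps Heps.
    assert (Right : t <= s -> exists d1, 0 < d1 /\ forall x, t <= x <= t' -> Rabs (x - s) < d1 -> Cmod (G x - G s) < eps).
    { intro Hts. destruct (Hw s ltac:(lra) (k * eps) ltac:(nra)) as [d1 [Hd1 K]].
      exists d1. split; auto. intros x Hx Hxs. specialize (K x ltac:(lra) Hxs).
      destruct (G2 x Hx) as [X1 X2]. destruct (G2 s ltac:(lra)) as [S1 S2].
      specialize (Hinj _ _ X1 S1). rewrite X2, S2 in Hinj.
      apply Rmult_lt_reg_l with k; lra. }
    assert (Left : s <= t -> exists d1, 0 < d1 /\ forall x, 0 <= x <= t -> Rabs (x - s) < d1 -> Cmod (G x - G s) < eps).
    { intro Hts. destruct (Hg s ltac:(lra) eps Heps) as [d1 [Hd1 K]].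
      exists d1. split; auto. intros x Hx Hxs. rewrite !G1 by lra. apply K; lra. }
    destruct (Rtotal_order s t) as [h|[h|h]].
    + destruct (Left ltac:(lra)) as [d1 [Hd1 K]]. exists (Rmin d1 (t - s)).
      split; [apply Rmin_glb_lt; lra|]. intros x Hx Hxs.
      assert (X1 := Rlt_le_trans _ _ _ Hxs (Rmin_l _ _)).
      assert (X2 := Rlt_le_trans _ _ _ Hxs (Rmin_r _ _)).
      apply Rabs_def2 in X2. apply K; lra.
    + destruct (Left ltac:(lra)) as [d1 [Hd1 K1]]. destruct (Right ltac:(lra)) as [d2 [Hd2 K2]].
      exists (Rmin d1 d2). split; [apply Rmin_glb_lt; lra|]. intros x Hx Hxs.
      assert (X1 := Rlt_le_trans _ _ _ Hxs (Rmin_l _ _)).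
      assert (X2 := Rlt_le_trans _ _ _ Hxs (Rmin_r _ _)).
      destruct (Rle_or_lt x t); [apply K1 | apply K2]; lra.
    + destruct (Right ltac:(lra)) as [d1 [Hd1 K]]. exists (Rmin d1 (s - t)).
      split; [apply Rmin_glb_lt; lra|]. intros x Hx Hxs.
      assert (X1 := Rlt_le_trans _ _ _ Hxs (Rmin_l _ _)).
      assert (X2 := Rlt_le_trans _ _ _ Hxs (Rmin_r _ _)).
      apply Rabs_def2 in X2. apply K; lra.
  - rewrite G1; auto. lra.
  - intros s Hs. destruct (Rle_or_lt s t).
    + rewrite G1 by auto. apply Hgw. lra.
    + apply G2. lra.
Qed.

(** Uniqueness glues the shorter lifts to a lift [g] on [[0, t)]. It converges at [t] or tends to
    infinity; the latter would make [w t] an asymptotic value of modulus above [R0]. *)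
Lemma lift_limit (E dE : C -> C) (R0 T t : R) (w : R -> C) (z0 : C) : lifts_over E dE R0 ->
  cont_on w T -> (forall s, 0 <= s <= T -> R0 < Cmod (w s)) -> 0 < t <= T ->
  (forall s, 0 <= s < t -> exists g, lift_upto E w z0 s g) -> exists g, lift_upto E w z0 t g.
Proof.
  intros HL Hw HR Ht H.
  destruct (choice (fun s g => 0 <= s < t -> lift_upto E w z0 s g)) as [G HG].
  { intro s. destruct (classic (0 <= s < t)) as [h|h].
    - destruct (H s h) as [g Hg]. exists g; auto.
    - exists (fun _ => RtoC 0). intro; contradiction. }
  assert (Agree : forall s s' x, 0 <= s < t -> 0 <= s' < t -> 0 <= x <= s -> x <= s' -> G s x = G s' x).
  { intros s s' x Hs Hs' Hx Hx'. destruct (HG s Hs) as [A1 [A2 A3]]. destruct (HG s' Hs') as [B1 [B2 B3]].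
    apply (lift_unique E dE R0 x); auto; try lra.
    - apply (cont_on_restrict _ x s); auto; lra.
    - apply (cont_on_restrict _ x s'); auto; lra.
    - intros y Hy. rewrite A3, B3 by lra. auto.
    - intros y Hy. rewrite A3 by lra. apply HR. lra.
    - rewrite A2, B2. auto. }
  (* Every lift defined up to [s] or beyond has the same value at [s]; the midpoint picks one. *)
  set (g := fun s => G ((s + t) / 2) s).
  assert (gG : forall s x, 0 <= x <= s -> s < t -> g x = G s x).
  { intros s x Hx Hs. unfold g. apply Agree; lra. }
  assert (gw : forall s, 0 <= s < t -> E (g s) = w s).
  { intros s Hs. rewrite (gG s s) by lra. apply (HG s Hs). lra. }
  assert (gcont : forall s, 0 <= s < t -> forall eps, 0 < eps -> exists d, 0 < d /\
    forall x, 0 <= x < t -> Rabs (x - s) < d -> Cmod (g x - g s) < eps).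
  { intros s Hs eps He. set (s' := (s + t) / 2).
    destruct (HG s' ltac:(unfold s'; lra)) as [A1 _].
    destruct (A1 s ltac:(unfold s'; lra) eps He) as [d [Hd K]].
    exists (Rmin d (s' - s)). split; [apply Rmin_glb_lt; unfold s'; lra|]. intros x Hx Hxs.
    assert (X1 := Rlt_le_trans _ _ _ Hxs (Rmin_l _ _)).
    assert (X2 := Rlt_le_trans _ _ _ Hxs (Rmin_r _ _)). apply Rabs_def2 in X2.
    rewrite (gG s' x), (gG s' s) by (unfold s' in *; lra). apply K; auto. lra. }
  (* Reparametrise [0, t) by [0, oo). *)
  set (th := fun u => t * (u / (1 + u))).
  assert (th_le : forall u, 0 <= u -> 0 <= th u < t).
  { intros u Hu. unfold th. assert (0 <= u / (1 + u)) by (apply Rdiv_le_0_compat; lra).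
    assert (u / (1 + u) < 1) by (apply Rlt_div_l; lra). nra. }
  assert (th_diff : forall u v, 0 <= u -> 0 <= v -> Rabs (th u - th v) <= t * Rabs (u - v)).
  { intros u v Hu Hv. unfold th.
    replace (t * (u / (1 + u)) - t * (v / (1 + v))) with (t * ((u - v) * / ((1 + u) * (1 + v)))) by (field; lra).
    rewrite !Rabs_mult, (Rabs_pos_eq t) by lra. apply Rmult_le_compat_l; [lra|].
    assert (1 <= (1 + u) * (1 + v)) by nra.
    assert (0 < / ((1 + u) * (1 + v)) <= 1).
    { split; [apply Rinv_0_lt_compat; lra|]. rewrite <- Rinv_1. apply Rinv_le_contravar; lra. }
    rewrite (Rabs_pos_eq (/ _)) by lra. pose proof (Rabs_pos (u - v)). nra. }
  (* [s / (t - s)] is the parameter that [th] sends to [s]. *)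
  assert (th_late : forall s u, 0 <= s < t -> s / (t - s) <= u -> s <= th u).
  { intros s u Hs Hu. unfold th.
    assert (0 <= s / (t - s)) by (apply Rdiv_le_0_compat; lra).
    assert (0 <= u) by lra. apply Rle_div_l in Hu; [|lra].
    replace (t * (u / (1 + u))) with (t * u / (1 + u)) by (field; lra).
    apply Rle_div_r; lra. }
  pose proof HL as [HE [HN [Hcr Has]]].
  destruct (path_alternative E (fun u => g (th u)) (w t)) as [Hinf|[p [Ep Hp]]].
  - apply (lifts_over_centire E dE R0); auto.
  - auto.
  - intros u Hu eps He. destruct (gcont (th u) (th_le u Hu) eps He) as [d [Hd K]].
    exists (d / t). split; [apply Rdiv_lt_0_compat; lra|]. intros v Hv Hvu. apply K; auto.
    eapply Rle_lt_trans; [apply th_diff; auto|]. apply Rlt_div_r in Hvu; lra.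
  - intros eps He. destruct (Hw t ltac:(lra) eps He) as [d [Hd K]].
    set (s := Rmax 0 (t - d / 2)).
    assert (m1 := Rmax_l 0 (t - d / 2)). assert (m2 := Rmax_r 0 (t - d / 2)). fold s in m1, m2.
    assert (m3 : s < t) by (apply Rmax_lub_lt; lra).
    exists (s / (t - s)). intros u Hu.
    assert (0 <= s / (t - s)) by (apply Rdiv_le_0_compat; lra).
    pose proof (th_le u ltac:(lra)). pose proof (th_late s u ltac:(lra) Hu).
    rewrite gw by lra. apply K; [lra|]. apply Rabs_def1; lra.
  - exfalso. assert (A : Cmod (w t) <= R0).
    { apply Has. exists (fun u => g (th u)). split; [|split].
      - intros u Hu eps He. destruct (gcont (th u) (th_le u Hu) eps He) as [d [Hd K]].
        exists (d / t). split; [apply Rdiv_lt_0_compat; lra|]. intros v Hv Hvu.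
        rewrite Cnorm_Csub. apply K; auto.
        eapply Rle_lt_trans; [apply th_diff; auto|]. apply Rlt_div_r in Hvu; lra.
      - intro M. destruct (Hinf M) as [U HU]. exists U. intros u Hu. rewrite Cnorm_Cmod. auto.
      - intros eps He. destruct (Hw t ltac:(lra) eps He) as [d [Hd K]].
        set (s := Rmax 0 (t - d / 2)).
        assert (m1 := Rmax_l 0 (t - d / 2)). assert (m2 := Rmax_r 0 (t - d / 2)). fold s in m1, m2.
        assert (m3 : s < t) by (apply Rmax_lub_lt; lra).
        exists (s / (t - s)). intros u Hu.
        assert (0 <= s / (t - s)) by (apply Rdiv_le_0_compat; lra).
        pose proof (th_le u ltac:(lra)). pose proof (th_late s u ltac:(lra) Hu).
        rewrite Cnorm_Csub. rewrite gw by lra. apply K; [lra|]. apply Rabs_def1; lra. }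
    specialize (HR t ltac:(lra)). lra.
  - set (g' := fun s => if Rlt_dec s t then g s else p).
    assert (g1 : forall s, s < t -> g' s = g s).
    { intros s Hs. unfold g'. destruct (Rlt_dec s t); [auto | contradiction]. }
    assert (g2 : g' t = p).
    { unfold g'. destruct (Rlt_dec t t); [lra | auto]. }
    exists g'. split; [|split].
    + intros s Hs eps He. destruct (Rlt_dec s t) as [h|h].
      * destruct (gcont s ltac:(lra) eps He) as [d [Hd K]].
        exists (Rmin d (t - s)). split; [apply Rmin_glb_lt; lra|]. intros x Hx Hxs.
        assert (X1 := Rlt_le_trans _ _ _ Hxs (Rmin_l _ _)).
        assert (X2 := Rlt_le_trans _ _ _ Hxs (Rmin_r _ _)). apply Rabs_def2 in X2.
        rewrite !g1 by lra. apply K; auto. lra.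
      * assert (s = t) by lra. subst s. rewrite g2.
        destruct (Hp eps He) as [U HU].
        set (U' := Rmax 0 U). assert (n1 := Rmax_l 0 U). assert (n2 := Rmax_r 0 U). fold U' in n1, n2.
        pose proof (th_le U' n1) as Q.
        exists (t - th U'). split; [lra|]. intros x Hx Hxt.
        destruct (Rlt_dec x t) as [h2|h2].
        -- rewrite g1 by auto. apply Rabs_def2 in Hxt.
           assert (Ex : th (x / (t - x)) = x) by (unfold th; field; lra).
           rewrite <- Ex. apply HU. apply Rle_trans with U'; auto.
           apply Rle_div_r; [lra|].
           assert (T1 : th U' * (1 + U') = t * U') by (unfold th; field; lra). nra.
        -- replace x with t by lra. rewrite g2, Cmod_sub_self. auto.
    + rewrite g1 by lra. rewrite (gG 0 0) by lra. apply (HG 0 ltac:(lra)).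
    + intros s Hs. destruct (Rlt_dec s t) as [h|h].
      * rewrite g1 by auto. apply gw. lra.
      * replace s with t by lra. rewrite g2. auto.
Qed.

Lemma path_lifting (E dE : C -> C) (R0 T : R) (w : R -> C) (z0 : C) : lifts_over E dE R0 -> 0 <= T ->
  cont_on w T -> (forall s, 0 <= s <= T -> R0 < Cmod (w s)) -> E z0 = w 0 ->
  exists g, lift_upto E w z0 T g.
Proof.
  intros HL HT Hw HR H0.
  apply (real_induction_limit (fun t => exists g, lift_upto E w z0 t g) T); auto.
  - exists (fun _ => z0). split; [|split]; auto.
    + intros t _ eps He. exists 1. split; [lra|]. intros. rewrite Cmod_sub_self. auto.
    + intros s Hs. replace s with 0 by lra. auto.
  - intros s t Hst [g [A1 [A2 A3]]]. exists g. split; [|split]; auto.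
    + apply (cont_on_restrict g s t); auto; lra.
    + intros x Hx. apply A3. lra.
  - intros t Ht. apply (lift_step E dE R0 T); auto.
  - intros t Ht. apply (lift_limit E dE R0 T); auto.
Qed.

Definition convex (Om : C -> Prop) : Prop :=
  forall a b t, Om a -> Om b -> 0 <= t <= 1 -> Om (seg a b t).

Definition cont_in (f : C -> C) (Om : C -> Prop) : Prop :=
  forall z, Om z -> forall eps, 0 < eps -> exists d, 0 < d /\
    forall w, Om w -> Cmod (w - z) < d -> Cmod (f w - f z) < eps.

Lemma cont_in_ccont (f : C -> C) (Om : C -> Prop) : (forall z, Om z -> ccont f z) -> cont_in f Om.
Proof. intros H z Hz eps He. destruct (H z Hz eps He) as [d [Hd K]]. exists d; auto. Qed.

Lemma cont_on_seg (f : C -> C) (Om : C -> Prop) (a b : C) : convex Om -> cont_in f Om ->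
  Om a -> Om b -> cont_on (fun t => f (seg a b t)) 1.
Proof.
  intros Hc Hf Ha Hb t Ht eps He.
  destruct (Hf (seg a b t) ltac:(apply Hc; auto) eps He) as [d [Hd K]].
  pose proof (Cmod_ge_0 (b - a)).
  exists (d / (Cmod (b - a) + 1)). split; [apply Rdiv_lt_0_compat; lra|].
  intros s Hs Hst. apply K; [apply Hc; auto|]. rewrite seg_sub.
  apply Rlt_div_r in Hst; [|lra]. pose proof (Rabs_pos (s - t)). nra.
Qed.

Lemma lift_unique_convex (E dE : C -> C) (R0 : R) (Om : C -> Prop) (f1 f2 : C -> C) (a b : C) :
  lifts_over E dE R0 -> convex Om -> cont_in f1 Om -> cont_in f2 Om ->
  (forall z, Om z -> E (f1 z) = E (f2 z)) -> (forall z, Om z -> R0 < Cmod (E (f1 z))) ->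
  Om a -> Om b -> f1 a = f2 a -> f1 b = f2 b.
Proof.
  intros HL Hc H1 H2 Heq HR Ha Hb H0.
  pose proof (lift_unique E dE R0 1 (fun t => f1 (seg a b t)) (fun t => f2 (seg a b t)) HL Rle_0_1) as U.
  cbv beta in U. rewrite !seg_0, !seg_1 in U. apply U; auto.
  - apply cont_on_seg with Om; auto.
  - apply cont_on_seg with Om; auto.
Qed.

(** [psi b] is the endpoint of the lift over the image of the segment from [a] to [b]. Convexity
    supplies a canonical path to each point and so replaces the homotopies of a monodromy
    argument. *)
Lemma lift_convex (E dE : C -> C) (R0 : R) (Om : C -> Prop) (e : C -> C) (a z0 : C) :
  lifts_over E dE R0 -> convex Om -> cont_in e Om -> (forall z, Om z -> R0 < Cmod (e z)) ->
  Om a -> E z0 = e a ->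
  exists psi, cont_in psi Om /\ psi a = z0 /\ forall z, Om z -> E (psi z) = e z.
Proof.
  intros HL Hc He HR Ha H0.
  destruct (choice (fun b g => Om b -> lift_upto E (fun t => e (seg a b t)) z0 1 g)) as [G HG].
  { intro b. destruct (classic (Om b)) as [h|h].
    - destruct (path_lifting E dE R0 1 (fun t => e (seg a b t)) z0) as [g Hg]; auto; try lra.
      + apply cont_on_seg with Om; auto.
      + rewrite seg_0. auto.
      + exists g; auto.
    - exists (fun _ => RtoC 0). intro; contradiction. }
  exists (fun b => G b 1). split; [|split].
  - intros b Hb.
    (* Continuity at [b] of the position at time [t] is carried along the segment by real induction;
       time 1 is the claim. *)
    cut ((fun t => forall eps, 0 < eps -> exists d, 0 < d /\
      forall w, Om w -> Cmod (w - b) < d -> Cmod (G w t - G b t) < eps) 1); auto.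
    apply real_induction; [lra | |].
    { intros eps Heps. exists 1. split; [lra|]. intros w Hw _.
      destruct (HG w Hw) as [_ [-> _]]. destruct (HG b Hb) as [_ [-> _]]. rewrite Cmod_sub_self; auto. }
    intros t Ht. destruct (HG b Hb) as [B1 [B2 B3]].
    pose proof HL as [HE [HN [Hcr Has]]].
    set (p := G b t).
    assert (Ep : E p = e (seg a b t)) by (apply B3; lra).
    assert (nz : dE p <> 0%C) by (apply Hcr; rewrite Ep; auto).
    destruct (local_section E dE p 1 HE nz Rlt_0_1) as [d [r [k [Hd [Hr [Hk [Hinj _]]]]]]].
    destruct (B1 t Ht (d / 4) ltac:(lra)) as [eta1 [Heta1 C1]].
    destruct (He (seg a b t) ltac:(auto) (k * (d / 2)) ltac:(nra)) as [rho [Hrho C2]].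
    pose proof (Cmod_ge_0 (b - a)) as Hba.
    set (eta2 := rho / 2 / (Cmod (b - a) + 1)).
    assert (Heta2 : 0 < eta2) by (apply Rdiv_lt_0_compat; lra).
    assert (seg_near : forall w s, Om w -> 0 <= s <= 1 -> Cmod (w - b) < rho / 2 -> Rabs (s - t) < eta2 ->
       Cmod (e (seg a w s) - E p) < k * (d / 2)).
    { intros w s Hw Hs Hwb Hst. rewrite Ep. apply C2; auto.
      pose proof (Cmod_sub_triangle (seg a w s) (seg a b s) (seg a b t)) as T. rewrite seg_sub in T.
      assert (A : Cmod (seg a w s - seg a b s) <= Cmod (w - b)).
      { unfold seg. replace (a + s * (w - a) - (a + s * (b - a)))%C with (RtoC s * (w - b))%C by ring.
        rewrite Cmod_mult, Cmod_R, Rabs_pos_eq by lra. pose proof (Cmod_ge_0 (w - b)). nra. }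
      unfold eta2 in Hst. apply Rlt_div_r in Hst; [|lra]. pose proof (Rabs_pos (s - t)). nra. }
    assert (m1 := Rmin_l eta1 eta2). assert (m2 := Rmin_r eta1 eta2).
    exists (Rmin eta1 eta2). split; [apply Rmin_glb_lt; auto|].
    intros x y Hx0 Hy1 Hx Hy Px eps Heps.
    destruct (Px (d / 4) ltac:(lra)) as [d1 [Hd1 K1]].
    destruct (He (seg a b y) ltac:(apply Hc; auto; lra) (k * eps) ltac:(nra)) as [d2 [Hd2 K2]].
    exists (Rmin d1 (Rmin d2 (rho / 2))). split; [repeat apply Rmin_glb_lt; lra|].
    intros w Hw Hwb.
    assert (W1 := Rlt_le_trans _ _ _ Hwb (Rmin_l _ _)).
    assert (W' := Rlt_le_trans _ _ _ Hwb (Rmin_r _ _)).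
    assert (W2 := Rlt_le_trans _ _ _ W' (Rmin_l _ _)).
    assert (W3 := Rlt_le_trans _ _ _ W' (Rmin_r _ _)).
    destruct (HG w Hw) as [A1 [A2 A3]].
    specialize (K1 w Hw W1).
    assert (Bx : Cmod (G b x - p) < d / 4) by (apply C1; [lra | apply Rabs_def1; lra]).
    assert (By : Cmod (G b y - p) < d / 4) by (apply C1; [lra | apply Rabs_def1; lra]).
    assert (Wx : Cmod (G w x - p) < d / 2).
    { pose proof (Cmod_sub_triangle (G w x) (G b x) p). lra. }
    (* The lift over a nearby segment cannot meet the circle of radius [d / 2] about [p]: there [E]
       differs from [E p] by at least [k * (d / 2)], contrary to [seg_near]. *)
    assert (Wy : Cmod (G w y - p) < d / 2).
    { replace y with (x + (y - x)) by ring.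
      apply (stay_inside (fun s => G w (x + s)) p (d / 2) (y - x)); [lra | | rewrite Rplus_0_r; auto |].
      - intros s Hs ep Hep. destruct (A1 (x + s) ltac:(lra) ep Hep) as [dl [Hdl K]].
        exists dl. split; auto. intros s' Hs' Hss. apply K; [lra|].
        replace (x + s' - (x + s)) with (s' - s) by ring. auto.
      - intros s Hs Hcon.
        assert (Q := Hinj (G w (x + s)) p ltac:(lra) ltac:(rewrite Cmod_sub_self; lra)).
        rewrite Hcon, A3 in Q by lra.
        assert (Q2 := seg_near w (x + s) Hw ltac:(lra) W3 ltac:(apply Rabs_def1; lra)). lra. }
    assert (Q := Hinj (G w y) (G b y) ltac:(lra) ltac:(lra)). rewrite A3, B3 in Q by lra.
    assert (Q2 : Cmod (e (seg a w y) - e (seg a b y)) < k * eps).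
    { apply K2; [apply Hc; auto; lra|].
      eapply Rle_lt_trans; [|apply W2].
      unfold seg. replace (a + y * (w - a) - (a + y * (b - a)))%C with (RtoC y * (w - b))%C by ring.
      rewrite Cmod_mult, Cmod_R, Rabs_pos_eq by lra. pose proof (Cmod_ge_0 (w - b)). nra. }
    apply Rmult_lt_reg_l with k; lra.
  - destruct (HG a Ha) as [A1 [A2 A3]].
    apply (lift_unique E dE R0 1 (G a) (fun _ => z0)); auto; try lra.
    + intros t _ eps Heps. exists 1. split; [lra|]. intros. rewrite Cmod_sub_self. auto.
    + intros t Ht. rewrite A3 by auto. unfold seg. rewrite H0. f_equal. ring.
    + intros t Ht. rewrite A3 by auto. apply HR. apply Hc; auto.
  - intros z Hz. destruct (HG z Hz) as [A1 [A2 A3]]. rewrite A3 by lra. rewrite seg_1. auto.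
Qed.

Lemma lift_diff (E e psi : C -> C) (z l m : C) (d0 : R) : 0 < d0 -> ccont psi z ->
  (forall w, Cmod (w - z) < d0 -> E (psi w) = e w) -> cdiff e z l -> cdiff E (psi z) m -> m <> 0%C ->
  cdiff psi z (l / m).
Proof.
  intros Hd0 Hpsi Heq He HE Hm eps Heps. pose proof Hm as Hm0. apply Cmod_gt_0 in Hm0.
  set (p := psi z) in *. set (A := Cmod m) in *. set (B := Cmod l + 1).
  assert (HB : 0 < B) by (unfold B; pose proof (Cmod_ge_0 l); lra).
  (* The first bound makes the increment of [psi] at most [B * 2 / A] times that of the variable;
     the second then turns the error of [E] into [eps / 2] after division by [m]. *)
  set (e1 := Rmin (A / 2) (eps * A / (2 * (B * 2 / A)))).
  assert (He1 : 0 < e1).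
  { apply Rmin_glb_lt; [lra|]. apply Rdiv_lt_0_compat; [nra|].
    assert (0 < B * 2 / A) by (apply Rdiv_lt_0_compat; lra). lra. }
  assert (e1A : e1 <= A / 2) by apply Rmin_l.
  assert (e1B : e1 * (B * 2 / A) <= eps * A / 2).
  { assert (Hq : e1 <= eps * A / (2 * (B * 2 / A))) by apply Rmin_r.
    assert (P : 0 < B * 2 / A) by (apply Rdiv_lt_0_compat; lra).
    apply Rle_div_r in Hq; lra. }
  destruct (HE e1 He1) as [d1 [Hd1 H1]]. destruct (Hpsi d1 Hd1) as [d2 [Hd2 H2]].
  destruct (He (eps * A / 2) ltac:(nra)) as [d3 [Hd3 H3]].
  destruct (cdiff_bound e z l He) as [d4 [Hd4 H4]]. fold B in H4.
  exists (Rmin d0 (Rmin d2 (Rmin d3 d4))). split; [repeat apply Rmin_glb_lt; auto|].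
  intros w Hw.
  assert (W0 := Rlt_le_trans _ _ _ Hw (Rmin_l _ _)).
  assert (Wa := Rlt_le_trans _ _ _ Hw (Rmin_r _ _)).
  assert (W2 := Rlt_le_trans _ _ _ Wa (Rmin_l _ _)).
  assert (Wb := Rlt_le_trans _ _ _ Wa (Rmin_r _ _)).
  assert (W3 := Rlt_le_trans _ _ _ Wb (Rmin_l _ _)).
  assert (W4 := Rlt_le_trans _ _ _ Wb (Rmin_r _ _)).
  specialize (H1 (psi w) (H2 w W2)). specialize (H3 w W3). specialize (H4 w W4).
  assert (Ez : E p = e z) by (apply Heq; rewrite Cmod_sub_self; auto).
  rewrite (Heq w W0), Ez in H1.
  set (n := Cmod (w - z)) in *. set (q := Cmod (psi w - p)) in *.
  assert (Hq0 : 0 <= q) by apply Cmod_ge_0. assert (Hn0 : 0 <= n) by apply Cmod_ge_0.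
  assert (Hq : A * q <= e1 * q + B * n).
  { replace (A * q) with (Cmod (m * (psi w - p))) by apply Cmod_mult.
    replace (m * (psi w - p))%C with ((e w - e z) - (e w - e z - m * (psi w - p)))%C by ring.
    eapply Rle_trans; [apply Cmod_sub_le|]. lra. }
  assert (Hq2 : q <= B * 2 / A * n).
  { replace (B * 2 / A * n) with (B * n * 2 / A) by (field; lra). apply Rle_div_r; [lra|]. nra. }
  replace (psi w - p - l / m * (w - z))%C
    with ((e w - e z - l * (w - z) - (e w - e z - m * (psi w - p))) / m)%C by (field; auto).
  rewrite Cmod_div by auto. fold A. apply Rle_div_l; [lra|].
  eapply Rle_trans; [apply Cmod_sub_le|].
  assert (e1 * q <= e1 * (B * 2 / A * n)) by (apply Rmult_le_compat_l; lra).
  assert (e1 * (B * 2 / A) * n <= eps * A / 2 * n) by (apply Rmult_le_compat_r; auto).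
  lra.
Qed.

(** * Logarithmic coordinates *)

(** If the limit were [a = cexp s0], then [cexp (g u - s0)] would eventually stay within 1/2 of 1.
    This bounds the real part of [g u - s0] and keeps the cosine of its imaginary part positive, so
    the imaginary part varies by less than [PI] and the path is bounded. *)
Lemma asymptotic_cexp (a : C) : asymptotic_value cexp a -> a = 0%C.
Proof.
  intros [g [Hc [Hinf Hlim]]]. apply NNPP. intro Ha.
  destruct (cexp_surj a Ha) as [s0 [Hs0 _]].
  assert (Pa : 0 < Cmod a) by (apply Cmod_gt_0; auto).
  destruct (Hlim (Cmod a / 2) ltac:(lra)) as [T0 HT0].
  set (U := Rmax 0 T0). assert (U1 := Rmax_l 0 T0). assert (U2 := Rmax_r 0 T0). fold U in U1, U2.
  set (y := fun u => snd (g u - s0)%C).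
  assert (near : forall u, U <= u -> Cmod (cexp (g u - s0) - 1) < 1 / 2).
  { intros u Hu. specialize (HT0 u ltac:(lra)). rewrite Cnorm_Csub in HT0.
    replace (cexp (g u)) with (cexp (g u - s0) * a)%C in HT0.
    2:{ rewrite <- Hs0, <- cexp_plus. f_equal. ring. }
    replace (cexp (g u - s0) * a - a)%C with ((cexp (g u - s0) - 1) * a)%C in HT0 by ring.
    rewrite Cmod_mult in HT0. apply Rmult_lt_reg_r with (Cmod a); lra. }
  assert (cpos : forall u, U <= u -> 0 < cos (y u)).
  { intros u Hu. pose proof (near u Hu) as N. pose proof (fst_bounds (cexp (g u - s0) - 1)%C) as F.
    change (fst (cexp (g u - s0) - 1)%C) with (exp (fst (g u - s0)%C) * cos (y u) + - 1) in F.
    pose proof (exp_pos (fst (g u - s0)%C)). nra. }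
  assert (ybd : forall u, U <= u -> Rabs (y u - y U) < PI).
  { intros u Hu.
    pose proof (stay_inside (fun t => RtoC (y (U + t))) (RtoC (y U)) PI (u - U)) as K.
    cbv beta in K. replace (U + (u - U)) with u in K by ring. rewrite Rplus_0_r in K.
    rewrite <- Cmod_R, RtoC_minus. apply K; [lra | | |].
    - intros t Ht eps He. destruct (Hc (U + t) ltac:(lra) eps He) as [d [Hd H]].
      exists d. split; auto. intros s Hs Hst. specialize (H (U + s) ltac:(lra)).
      rewrite Cnorm_Csub in H. specialize (H ltac:(replace (U + s - (U + t)) with (s - t) by ring; auto)).
      rewrite <- RtoC_minus, Cmod_R. eapply Rle_lt_trans; [|apply H].
      pose proof (snd_le_Cmod (g (U + s)%R - g (U + t)%R)%C) as F. simpl in F. unfold y. simpl.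
      replace (snd (g (U + s)) + - snd s0 - (snd (g (U + t)) + - snd s0))
        with (snd (g (U + s)) + - snd (g (U + t))) by ring. auto.
    - rewrite Cmod_sub_self. apply PI_RGT_0.
    - intros t Ht Hpi. rewrite <- RtoC_minus, Cmod_R in Hpi.
      pose proof (cpos (U + t) ltac:(lra)) as C1. pose proof (cpos U ltac:(lra)) as C2.
      unfold Rabs in Hpi. destruct (Rcase_abs (y (U + t) - y U)) as [h|h].
      + replace (y U) with (y (U + t) + PI) in C2 by lra. rewrite neg_cos in C2. lra.
      + replace (y (U + t)) with (y U + PI) in C1 by lra. rewrite neg_cos in C1. lra. }
  set (M := Cmod s0 + (1 + Rabs (y U) + PI)).
  destruct (Hinf M) as [T1 HT1].
  set (u := Rmax U T1). assert (u1 := Rmax_l U T1). assert (u2 := Rmax_r U T1). fold u in u1, u2.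
  specialize (HT1 u u2). rewrite Cnorm_Cmod in HT1.
  pose proof (Cmod_sub_ge (g u) s0) as T. pose proof (Cmod_le_abs (g u - s0)%C) as T2.
  fold (y u) in T2. specialize (ybd u u1). specialize (near u u1).
  assert (Rabs (y u) <= Rabs (y U) + PI).
  { replace (y u) with (y U + (y u - y U)) by ring. eapply Rle_trans; [apply Rabs_triang|]. lra. }
  assert (Rabs (fst (g u - s0)%C) <= 1).
  { set (x := fst (g u - s0)%C) in *.
    pose proof (Cmod_sub_ge (cexp (g u - s0)) 1) as N1. pose proof (Cmod_sub_ge 1 (cexp (g u - s0))) as N2.
    rewrite Cmod_1, Cmod_cexp in N1, N2. rewrite (Cmod_sub_sym 1) in N2. fold x in N1, N2.
    apply Rabs_le. split.
    - apply Rnot_lt_le. intro Hx. apply exp_increasing in Hx.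
      assert (exp (Ropp 1) <= 1 / 2).
      { rewrite exp_Ropp. replace (1 / 2) with (/ 2) by field. apply Rinv_le_contravar; [lra|].
        pose proof (exp_ineq1_le 1). lra. }
      lra.
    - apply Rnot_lt_le. intro Hx. apply exp_increasing in Hx. pose proof (exp_ineq1_le 1). lra. }
  unfold M in HT1. lra.
Qed.

Lemma lifts_over_cexp (R0 : R) : 0 <= R0 -> lifts_over cexp cexp R0.
Proof.
  intro H. split; [|split; [|split]].
  - apply cdiff_cexp.
  - exists 0%C, (1, 0)%C. intro E. assert (E2 : Cmod (cexp 0) = Cmod (cexp (1, 0))) by (rewrite E; auto).
    rewrite !Cmod_cexp in E2. simpl in E2. apply exp_inv in E2. lra.
  - intros z _. apply cexp_neq0.
  - intros a Ha. apply asymptotic_cexp in Ha. subst. rewrite Cmod_0. auto.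
Qed.

(** Along an asymptotic path of the composite, [cexp (g u)] either tends to infinity, giving an
    asymptotic value of [f], or converges to an asymptotic value of [cexp]. The latter is 0, and the
    bound on [f 0] takes care of it. *)
Lemma lifts_over_comp_cexp (f df : C -> C) (R0 : R) : lifts_over f df R0 -> Cmod (f 0) <= R0 ->
  lifts_over (fun s => f (cexp s)) (fun s => df (cexp s) * cexp s)%C R0.
Proof.
  intros [Hf [HN [Hcr Has]]] H0. split; [|split; [|split]].
  - intro z. apply (cdiff_comp cexp f); [apply cdiff_cexp | auto].
  - apply NNPP. intro Hn.
    assert (K : forall z : C, z <> 0%C -> f z = f (cexp 0)).
    { intros z Hz. apply NNPP. intro Hne. apply Hn. destruct (cexp_surj z Hz) as [s [Es _]].
      exists s, 0%C. rewrite Es. auto. }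
    assert (K0 : f 0%C = f (cexp 0)).
    { apply Cmod_sub_eq0. apply Rle_antisym; [|apply Cmod_ge_0].
      apply (le_eps_mul _ 1); [lra|]. intros eps He. rewrite Rmult_1_r.
      destruct (cdiff_cont _ _ _ (Hf 0%C) eps He) as [d [Hd H]].
      assert (Hd2 : Cmod (RtoC (d / 2)) = d / 2) by (rewrite Cmod_R; apply Rabs_pos_eq; lra).
      rewrite <- (K (RtoC (d / 2))).
      - rewrite Cmod_sub_sym. left. apply H. replace (RtoC (d / 2) - 0)%C with (RtoC (d / 2)) by ring. lra.
      - apply Cmod_gt_0. lra. }
    destruct HN as [a [b Hab]]. apply Hab.
    destruct (Ceq_dec a 0) as [->|na], (Ceq_dec b 0) as [->|nb]; auto.
    + rewrite K0, (K b); auto.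
    + rewrite K0, (K a); auto.
    + rewrite (K a), (K b); auto.
  - intros z Hz. apply Cmult_neq_0; [apply Hcr; auto | apply cexp_neq0].
  - intros a [g [Hc [Hinf Hlim]]].
    assert (Gc : contp (fun u => cexp (g u))).
    { intros t Ht eps He. destruct (cdiff_cont _ _ _ (cdiff_cexp (g t)) eps He) as [d [Hd H]].
      destruct (Hc t Ht d Hd) as [d1 [Hd1 H1]]. exists d1. split; auto. intros s Hs Hst.
      apply H. rewrite <- Cnorm_Csub. auto. }
    destruct (path_alternative f (fun u => cexp (g u)) a) as [h|[p [Ep Hp]]]; auto.
    + intro z. eauto.
    + intros eps He. destruct (Hlim eps He) as [T HT]. exists T. intros u Hu.
      rewrite <- Cnorm_Csub. auto.
    + apply Has. exists (fun u => cexp (g u)). split; [|split].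
      * intros t Ht eps He. destruct (Gc t Ht eps He) as [d [Hd H]]. exists d. split; auto.
        intros s Hs Hst. rewrite Cnorm_Csub. auto.
      * intro M. destruct (h M) as [T HT]. exists T. intros u Hu. rewrite Cnorm_Cmod. auto.
      * auto.
    + assert (Hp0 : p = 0%C).
      { apply asymptotic_cexp. exists g. split; [|split]; auto.
        intros eps He. destruct (Hp eps He) as [T HT]. exists T. intros u Hu. rewrite Cnorm_Csub. auto. }
      subst. auto.
Qed.

(** * From bounded type to inverse branches in logarithmic coordinates *)

Lemma has_cderiv_iff (f : C -> C) (z l : C) : has_cderiv f z l <-> cdiff f z l.
Proof.
  assert (E : forall h : C, h <> 0%C ->
    Cnorm (Csub (Defs.Cdiv (Csub (f (Cadd z h)) (f z)) h) l) = Cmod ((f (z + h) - f z - l * h) / h)%C).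
  { intros h Hh. rewrite Cnorm_Csub. f_equal. unfold Defs.Cdiv.
    replace (Defs.Cinv h) with (/ h)%C.
    - change ((f (z + h) - f z) * / h - l = (f (z + h) - f z - l * h) / h)%C. field. auto.
    - unfold Cinv, Defs.Cinv. f_equal; f_equal; ring. }
  split; intros H eps He.
  - destruct (H eps He) as [d [Hd K]]. exists d; split; auto.
    intros w Hw. destruct (Ceq_dec w z) as [->|n].
    { replace (f z - f z - l * (z - z))%C with (RtoC 0) by ring. rewrite Cmod_0, Cmod_sub_self. lra. }
    assert (n' : (w - z)%C <> 0%C) by (apply Cminus_eq_contra; auto).
    specialize (K (w - z)%C n'). rewrite Cnorm_Cmod in K. specialize (K Hw). rewrite E in K by auto.
    replace (z + (w - z))%C with w in K by ring. rewrite Cmod_div in K by auto.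
    apply Cmod_gt_0 in n'. apply Rlt_div_l in K; lra.
  - destruct (H (eps / 2) ltac:(lra)) as [d' [Hd' K']].
    exists d'. split; auto. intros h Hh Hhd. change C in h. rewrite Cnorm_Cmod in Hhd.
    assert (Hh' : h <> RtoC 0) by exact Hh. rewrite E by auto.
    specialize (K' (z + h)%C). replace (z + h - z)%C with h in K' by ring. specialize (K' Hhd).
    rewrite Cmod_div by auto. apply Cmod_gt_0 in Hh'. apply Rlt_div_l; [auto|]. nra.
Qed.

Lemma bounded_type_centire (f : C -> C) : bounded_type f -> centire f.
Proof.
  intros [[He _] _] z. destruct (He z) as [l Hl]. exists l. apply has_cderiv_iff; auto.
Qed.

Lemma bounded_type_nonconst (f : C -> C) : bounded_type f -> nonconst f.
Proof.
  intros [[_ Hp] _]. apply NNPP. intro Hn. apply Hp. exists (f 0%C :: nil). intro z.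
  apply NNPP. intro Hz. apply Hn. exists z, 0%C. intro E. apply Hz. rewrite E.
  change (f 0%C = f 0%C + z * 0)%C. ring.
Qed.

Lemma bounded_type_lifts (f : C -> C) : bounded_type f -> exists df R0, 1 <= R0 /\
  lifts_over f df R0 /\ forall z, Cmod z <= 1 -> Cmod (f z) <= R0.
Proof.
  intros Hb. pose proof (bounded_type_centire f Hb) as Hf.
  pose proof (bounded_type_nonconst f Hb) as HN.
  destruct Hb as [_ [M HM]].
  destruct (centire_deriv f Hf) as [df Hdf].
  destruct (disc_max (fun z => Cmod (f z)) 0 1) as [p [_ Hp]]; [lra | |].
  { intros z _. apply rcont_Cmod, centire_cont; auto. }
  set (R0 := Rmax 1 (Rmax M (Cmod (f p)))).
  assert (R1 : 1 <= R0) by apply Rmax_l.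
  assert (R2 : M <= R0) by (eapply Rle_trans; [apply Rmax_l | apply Rmax_r]).
  assert (R3 : Cmod (f p) <= R0) by (eapply Rle_trans; [apply Rmax_r | apply Rmax_r]).
  exists df, R0. split; auto. split; [split; [|split; [|split]]|]; auto.
  - intros z Hz Hd. assert (Cmod (f z) <= M); [|lra]. rewrite <- Cnorm_Cmod. apply HM.
    left. left. exists z. split; auto. apply has_cderiv_iff.
    replace C0 with (df z); auto.
  - intros a Ha. assert (Cmod a <= M); [|lra]. rewrite <- Cnorm_Cmod. apply HM. left. right. auto.
  - intros z Hz. apply Rle_trans with (Cmod (f p)); auto. apply Hp.
    replace (z - 0)%C with z by ring. auto.
Qed.

Definition halfplane (L : R) (z : C) : Prop := L < fst z.

Lemma convex_halfplane (L : R) : convex (halfplane L).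
Proof.
  intros a b t Ha Hb Ht. unfold halfplane, seg in *. simpl.
  replace (fst a + (t * (fst b + - fst a) - 0 * (snd b + - snd a)))
    with ((1 - t) * fst a + t * fst b) by ring.
  destruct (Req_dec t 1) as [->|]; [lra|]. nra.
Qed.

Lemma halfplane_disc (L : R) (z w : C) : Cmod (w - z) < fst z - L -> halfplane L w.
Proof.
  intro H. pose proof (fst_bounds (w - z)%C) as F. simpl in F. unfold halfplane. lra.
Qed.

(** The last clause puts the image in the right half-plane: Cayley's map needs this target, and it
    forces a large disc inside the image to lie far to the right. *)
Definition log_inverse (f : C -> C) (L : R) (psi dpsi : C -> C) : Prop :=
  (forall z, halfplane L z -> cdiff psi z (dpsi z)) /\
  (forall z, halfplane L z -> f (cexp (psi z)) = cexp z) /\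
  (forall z, halfplane L z -> 0 < fst (psi z)).

Lemma halfplane_cexp (L : R) (z : C) : halfplane L z <-> exp L < Cmod (cexp z).
Proof.
  rewrite Cmod_cexp. split; [apply exp_increasing | apply exp_lt_inv].
Qed.

Lemma log_inverse_exists (f df : C -> C) (L : R) (s0 z0 : C) : lifts_over f df (exp L) ->
  (forall z, Cmod z <= 1 -> Cmod (f z) <= exp L) -> f (cexp s0) = cexp z0 -> halfplane L z0 ->
  exists psi dpsi, log_inverse f L psi dpsi /\ psi z0 = s0.
Proof.
  intros HL H1 Hs Hz.
  assert (HF := lifts_over_comp_cexp f df (exp L) HL (H1 0%C ltac:(rewrite Cmod_0; lra))).
  destruct (lift_convex _ _ (exp L) (halfplane L) cexp z0 s0 HF) as [psi [P1 [P2 P3]]]; auto.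
  - apply convex_halfplane.
  - apply cont_in_ccont. intros z _. apply (cdiff_cont _ _ _ (cdiff_cexp z)).
  - intros z. apply halfplane_cexp.
  - exists psi, (fun z => cexp z / (df (cexp (psi z)) * cexp (psi z)))%C. split; [|auto].
    assert (Pc : forall z, halfplane L z -> ccont psi z).
    { intros z Hz' eps He. destruct (P1 z Hz' eps He) as [d [Hd K]].
      exists (Rmin d (fst z - L)). split; [apply Rmin_glb_lt; auto; unfold halfplane in Hz'; lra|].
      intros w Hw. apply K; [|eapply Rlt_le_trans; [apply Hw | apply Rmin_l]].
      apply (halfplane_disc L z). eapply Rlt_le_trans; [apply Hw | apply Rmin_r]. }
    destruct HF as [F1 [F2 [F3 F4]]].
    split; [|split]; auto.
    + intros z Hz'. apply (lift_diff (fun s => f (cexp s)) cexp psi z _ _ (fst z - L)); auto.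
      * unfold halfplane in Hz'; lra.
      * intros w Hw. apply P3. apply (halfplane_disc L z); auto.
      * apply cdiff_cexp.
      * apply F3. rewrite P3 by auto. apply halfplane_cexp; auto.
    + intros z Hz'. apply Rnot_le_lt. intro Hn.
      assert (C1 : Cmod (cexp (psi z)) <= 1).
      { rewrite Cmod_cexp, <- exp_0. destruct Hn as [Hn| ->]; [left; apply exp_increasing; auto | lra]. }
      specialize (H1 _ C1). rewrite P3 in H1 by auto. apply halfplane_cexp in Hz'. lra.
Qed.

(** A weak Schwarz lemma: Cauchy's estimate on discs of radius [rho / 2] bounds the derivative by
    [2 / (rho / 2)]. The constant only affects the degree of the growth bound obtained from it. *)
Lemma schwarz_half (h dh : C -> C) (a b : C) (rho : R) : 0 < rho -> holo h dh a rho ->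
  (forall z, Cmod (z - a) < rho -> Cmod (h z) <= 1) -> Cmod (b - a) < rho / 2 ->
  Cmod (h b - h a) <= 4 / rho * Cmod (b - a).
Proof.
  intros Hr Hh H1 Hb.
  apply (mean_value_disc h dh a a b (rho / 2)); auto.
  - intros z Hz. apply Hh. lra.
  - intros z Hz. replace (4 / rho) with (2 / (rho / 2)) by (field; lra).
    assert (Hin : forall w, Cmod (w - z) < rho / 2 -> Cmod (w - a) < rho).
    { intros w Hw. pose proof (Cmod_sub_triangle w z a). lra. }
    apply (cauchy_estimate h z); [lra | | apply Hh; lra |].
    + intros w Hw. eexists. apply Hh; auto.
    + intros w Hw. eapply Rle_trans; [apply Cmod_sub_le|].
      pose proof (H1 w (Hin w Hw)). pose proof (H1 z ltac:(lra)). lra.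
  - rewrite Cmod_sub_self. lra.
Qed.

(** Cayley's map of the right half-plane onto the unit disc, sending [v] to 0. *)
Lemma cayley_bound (u v : C) : 0 < fst u -> 0 < fst v ->
  (u + Cconj v)%C <> 0%C /\ Cmod ((u - v) / (u + Cconj v))%C <= 1.
Proof.
  intros Hu Hv. assert (N : (u + Cconj v)%C <> 0%C).
  { intro E. assert (fst (u + Cconj v)%C = 0) by (rewrite E; auto). simpl in *. lra. }
  split; auto. rewrite Cmod_div by auto. apply Cmod_gt_0 in N. apply Rle_div_l; auto.
  rewrite Rmult_1_l. apply Rsqr_incr_0; try apply Cmod_ge_0. unfold Rsqr. rewrite !Cmod_sq. simpl. nra.
Qed.

(* A lift [psi] which commutes with the deck transformations grows at least linearly,
   which means that [f] grows at most polynomially on the image of [psi]. *)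
Lemma equivariant_growth (psi dpsi : C -> C) (L : R) (m : Z) (z : C) :
  (forall w, halfplane L w -> cdiff psi w (dpsi w)) ->
  (forall w, halfplane L w -> 0 < fst (psi w)) ->
  (forall w, halfplane L w -> psi (w + (0, (2 * PI * IZR m)%R))%C = (psi w + (0, (2 * PI)%R))%C) ->
  halfplane L z -> fst z - L <= 8 * Rabs (IZR m) * (fst (psi z) + PI).
Proof.
  intros Hd Hp He Hz. pose proof PI_RGT_0 as HPI. unfold halfplane in Hz.
  set (rho := fst z - L). assert (Hrho : 0 < rho) by (unfold rho; lra).
  assert (Hin : forall w, Cmod (w - z) < rho -> halfplane L w) by (intros w; apply halfplane_disc).
  set (p := psi z). assert (Hpp : 0 < fst p) by (apply Hp; auto).
  set (h := fun w => ((psi w - p) * / (psi w + Cconj p))%C).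
  assert (Hh : forall w, Cmod (w - z) < rho -> exists l, cdiff h w l).
  { intros w Hw. eexists. apply cdiff_mult; [apply cdiff_sub_c, Hd; auto|].
    apply cdiff_inv; [apply cayley_bound; auto|]. apply cdiff_plus; [apply Hd; auto | apply cdiff_const]. }
  destruct (choice (fun w l => Cmod (w - z) < rho -> cdiff h w l)) as [dh Hdh].
  { intro w. destruct (classic (Cmod (w - z) < rho)) as [h1|h1].
    - destruct (Hh w h1) as [l Hl]. eauto.
    - exists 0%C. intro; contradiction. }
  set (b := (z + (0, (2 * PI * IZR m)%R))%C).
  assert (Eb : Cmod (b - z) = 2 * PI * Rabs (IZR m)).
  { unfold b. replace (z + (0, (2 * PI * IZR m)%R) - z)%C with ((0, (2 * PI * IZR m)%R) - (0, 0))%C.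
    - rewrite Cmod_vertical, Rminus_0_r, !Rabs_mult, (Rabs_pos_eq 2), (Rabs_pos_eq PI); lra.
    - unfold Cminus, Cplus, Copp. simpl. f_equal; ring. }
  pose proof (Rabs_pos (IZR m)) as Hm.
  (* The Schwarz estimate needs [b] within [rho / 2] of [z]; otherwise [rho] is at most [4 PI |m|],
     already inside the claimed bound. *)
  destruct (Rlt_or_le (2 * PI * Rabs (IZR m)) (rho / 2)) as [hs|hs].
  2:{ nra. }
  assert (K : Cmod (h b - h z) <= 4 / rho * Cmod (b - z)).
  { apply (schwarz_half h dh); auto; [|lra]. intros w Hw. apply cayley_bound; auto. }
  assert (hz : h z = 0%C) by (unfold h; fold p; ring).
  rewrite hz in K. replace (h b - 0)%C with (h b) in K by ring.
  (* Equivariance determines [h b], a quotient with numerator [2 PI i] and denominator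
     [2 Re p + 2 PI i], so the Schwarz bound becomes a lower bound for [Re p]. *)
  assert (Hb : h b = ((0, (2 * PI)%R) / (p + (0, (2 * PI)%R) + Cconj p))%C).
  { unfold h, b. rewrite He by auto. fold p. unfold Cdiv. f_equal. ring. }
  assert (Ed : (p + (0, (2 * PI)%R) + Cconj p)%C = (2 * fst p, 2 * PI)%R).
  { unfold Cplus, Cconj. simpl. f_equal; ring. }
  rewrite Ed in Hb.
  assert (nz : (2 * fst p, 2 * PI)%R <> RtoC 0) by (intro E; injection E; lra).
  rewrite Hb, Cmod_div, Eb in K by auto.
  assert (N1 : Cmod (0, (2 * PI)%R) = 2 * PI).
  { replace (0, (2 * PI)%R) with ((0, (2 * PI)%R) - (0, 0))%C.
    - rewrite Cmod_vertical, Rminus_0_r. apply Rabs_pos_eq. lra.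
    - unfold Cminus, Cplus, Copp. simpl. f_equal; ring. }
  assert (N2 : Cmod (2 * fst p, 2 * PI) <= 2 * fst p + 2 * PI).
  { eapply Rle_trans; [apply Cmod_le_abs|]. simpl. rewrite !Rabs_pos_eq by lra. lra. }
  apply Cmod_gt_0 in nz.
  rewrite N1 in K. apply (proj1 (Rle_div_l _ _ _ nz)) in K.
  assert (K2 : 2 * PI <= 4 / rho * (2 * PI * Rabs (IZR m)) * (2 * fst p + 2 * PI)).
  { eapply Rle_trans; [apply K|]. apply Rmult_le_compat_l; auto.
    apply Rmult_le_pos; [|nra]. apply Rdiv_le_0_compat; lra. }
  replace (4 / rho * (2 * PI * Rabs (IZR m)) * (2 * fst p + 2 * PI))
    with (8 * Rabs (IZR m) * (fst p + PI) * (2 * PI) / rho) in K2 by (field; lra).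
  apply (proj2 (Rle_div_r _ _ _ Hrho)) in K2. fold rho.
  apply Rmult_le_reg_r with (2 * PI); lra.
Qed.

(** [lam] is built as a continuous logarithm of [f] along the vertical line, and uniqueness of lifts
    shows that [psi] inverts it. So a line over [{|w| > exp L}] that meets the image of [psi] lies
    in it. *)
Lemma vertical_line_lift (f df : C -> C) (L x y1 : R) (psi dpsi : C -> C) (z1 : C) :
  lifts_over f df (exp L) -> Cmod (f 0) <= exp L -> log_inverse f L psi dpsi ->
  halfplane L z1 -> psi z1 = (x, y1) -> (forall y, exp L < Cmod (f (cexp (x, y)))) ->
  exists lam : R -> C, lam 0 = z1 /\
    forall t, halfplane L (lam t) /\ psi (lam t) = (x, y1 + t) /\ cexp (lam t) = f (cexp (x, y1 + t)).
Proof.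
  intros HL H0 [D1 [D2 D3]] Hz1 Hpsi Hline.
  pose proof (lifts_over_comp_cexp f df (exp L) HL H0) as HF.
  (* The line is parametrised by the real part of a complex variable, so that lifting over a convex
     set, here all of [C], applies; the real axis gives [lam]. *)
  set (e := fun z : C => f (cexp (x, y1 + fst z))).
  assert (c2 : forall z, ccont (fun z : C => (x, y1 + fst z)) z).
  { intros z eps He. exists eps. split; auto. intros w Hw. rewrite Cmod_vertical.
    pose proof (fst_le_Cmod (w - z)%C) as F. simpl in F.
    replace (y1 + fst w - (y1 + fst z)) with (fst w + - fst z) by ring. lra. }
  assert (conT : convex (fun _ => True)) by (intros a b t _ _ _; auto).
  destruct (lift_convex cexp cexp (exp L) (fun _ => True) e 0 z1) as [Lam [L1 [L2 L3]]]; auto.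
  - apply lifts_over_cexp. left. apply exp_pos.
  - apply cont_in_ccont. intros z _.
    apply (ccont_comp (fun z : C => (x, y1 + fst z)) (fun s => f (cexp s))); auto.
    apply centire_cont. apply (lifts_over_centire _ _ _ HF).
  - intros z _. apply Hline.
  - unfold e. simpl. rewrite Rplus_0_r, <- Hpsi. symmetry. auto.
  - assert (HH : forall z, halfplane L (Lam z)).
    { intro z. apply halfplane_cexp. rewrite L3 by auto. apply Hline. }
    assert (cL : forall z, ccont Lam z).
    { intros z eps He. destruct (L1 z I eps He) as [d [Hd K]]. exists d. split; auto. }
    exists (fun t => Lam (RtoC t)). split; auto. intro t.
    assert (Q : psi (Lam (RtoC t)) = (x, y1 + t)).
    { apply (lift_unique_convex _ _ (exp L) (fun _ => True) (fun z => psi (Lam z))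
        (fun z : C => (x, y1 + fst z)) 0 (RtoC t) HF); auto.
      - apply cont_in_ccont. intros z _. apply ccont_comp; auto.
        apply (cdiff_cont _ _ _ (D1 _ (HH z))).
      - apply cont_in_ccont. auto.
      - intros z _. rewrite D2 by auto. rewrite L3 by auto. auto.
      - intros z _. rewrite D2 by auto. apply halfplane_cexp; auto.
      - rewrite L2, Hpsi. simpl. rewrite Rplus_0_r. auto. }
    split; [auto | split; [auto | apply L3; auto]].
Qed.

Lemma exp_INR_mult (k : nat) (x : R) : exp (INR k * x) = exp x ^ k.
Proof.
  induction k as [|k IH]; [simpl; rewrite Rmult_0_l; apply exp_0|].
  rewrite S_INR. simpl. rewrite <- IH, <- exp_plus. f_equal. ring.
Qed.

(* If whole circles of arbitrarily large radius lay over [{|w| > exp L}], the lift through one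
   of them would be equivariant and [f] would grow polynomially along all of them. *)
Lemma bounded_point_on_circle (f df : C -> C) (L : R) : lifts_over f df (exp L) ->
  (forall z, Cmod z <= 1 -> Cmod (f z) <= exp L) -> ~ is_polynomial f ->
  exists X, 0 <= X /\ forall x, X < x -> exists y, Cmod (f (cexp (x, y))) <= exp L.
Proof.
  intros HL H1 Hpoly. apply NNPP. intro Hn. pose proof PI_RGT_0 as HPI.
  assert (H0 : Cmod (f 0) <= exp L) by (apply H1; rewrite Cmod_0; lra).
  assert (Lines : forall X, exists x, X < x /\ forall y, exp L < Cmod (f (cexp (x, y)))).
  { intro X. apply NNPP. intro Hc. apply Hn. exists (Rmax 0 X). split; [apply Rmax_l|].
    intros x Hx. apply NNPP. intro Hc2. apply Hc. exists x. split.
    - eapply Rle_lt_trans; [apply Rmax_r | apply Hx].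
    - intro y. apply Rnot_le_lt. intro. apply Hc2. eauto. }
  destruct (Lines 0) as [x1 [Hx1 Hl1]].
  destruct (cexp_surj (f (cexp (x1, 0)))) as [z0 [Ez0 _]].
  { apply Cmod_gt_0. eapply Rlt_trans; [apply exp_pos | apply Hl1]. }
  assert (Hz0 : halfplane L z0) by (apply halfplane_cexp; rewrite Ez0; auto).
  destruct (log_inverse_exists f df L (x1, 0) z0) as [psi [dpsi [HI Hpsi]]]; auto.
  destruct (vertical_line_lift f df L x1 0 psi dpsi z0) as [lam [lam0 Hlam]]; auto.
  pose proof HI as [D1 [D2 D3]].
  destruct (Hlam (2 * PI)) as [A1 [A2 A3]]. rewrite Rplus_0_l in A2, A3.
  (* The case [m = 0] needs no separate treatment: the growth bound would then read [fst z <= L] on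
     the half-plane, which is absurd. *)
  destruct (cexp_eq z0 (lam (2 * PI))) as [m Hm].
  { rewrite A3, Ez0. f_equal. pose proof (cexp_period (x1, 0) 1) as P.
    rewrite Rmult_1_r in P. rewrite <- P. f_equal. unfold Cplus. simpl. f_equal; ring. }
  rewrite Hm in A2.
  assert (HF := lifts_over_comp_cexp f df (exp L) HL H0).
  assert (shift : forall w, halfplane L w -> halfplane L (w + (0, (2 * PI * IZR m)%R))%C).
  { intros w Hw. unfold halfplane in *. simpl. lra. }
  assert (Eq : forall w, halfplane L w -> psi (w + (0, (2 * PI * IZR m)%R))%C = (psi w + (0, (2 * PI)%R))%C).
  { intros w Hw.
    apply (lift_unique_convex _ _ (exp L) (halfplane L) (fun w => psi (w + (0, (2 * PI * IZR m)%R))%C)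
      (fun w => psi w + (0, (2 * PI)%R))%C z0 w HF); auto.
    - apply convex_halfplane.
    - apply cont_in_ccont. intros z Hz. apply (cdiff_cont _ _ (dpsi (z + (0, (2 * PI * IZR m)%R))%C)).
      apply (cdiff_shift psi). auto.
    - apply cont_in_ccont. intros z Hz. eapply cdiff_cont. apply cdiff_plus; [apply D1; auto | apply cdiff_const].
    - intros z Hz. rewrite D2 by auto. pose proof (cexp_period (psi z) 1) as P. rewrite Rmult_1_r in P.
      rewrite P, D2 by auto. apply cexp_period.
    - intros z Hz. rewrite D2 by auto. apply halfplane_cexp; auto.
    - cbv beta. rewrite A2, Hpsi. unfold Cplus. simpl. f_equal; ring. }
  assert (Gr : forall z, halfplane L z -> fst z - L <= 8 * Rabs (IZR m) * (fst (psi z) + PI)).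
  { intros z. apply (equivariant_growth psi dpsi); auto. }
  set (k := (8 * Z.abs_nat m)%nat).
  assert (Hk : INR k = 8 * Rabs (IZR m)).
  { unfold k. rewrite mult_INR, (INR_IZR_INZ (Z.abs_nat m)), Zabs2Nat.id_abs, abs_IZR. simpl. ring. }
  rewrite <- Hk in Gr. pose proof (pos_INR k) as Kp.
  apply Hpoly. apply (polynomial_growth k f (exp (L + INR k * PI))).
  { destruct HL as [HL _]. intro z. eauto. }
  intro X. destruct (Lines (Rmax X x1)) as [x [Hx Hl]].
  pose proof (Rmax_l X x1). pose proof (Rmax_r X x1).
  exists (exp x). split.
  { pose proof (exp_ineq1_le x). lra. }
  assert (Hit : exists z, halfplane L z /\ fst (psi z) = x).
  { apply NNPP. intro Hno.
    (* If the real part of [psi] never took the value [x] on the horizontal ray from [z0], it would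
       stay below [x]; but at time [T] the left side of [Gr] exceeds [INR k * (x + PI)]. *)
    set (T := INR k * (x + PI) + 1).
    assert (HT : 0 <= T) by (unfold T; nra).
    assert (HH : forall t, 0 <= t -> halfplane L (z0 + RtoC t)%C).
    { intros t Ht. unfold halfplane in *. simpl. lra. }
    assert (S : Cmod (RtoC (fst (psi (z0 + RtoC T)%C)) - 0) < x).
    { apply (stay_inside (fun t => RtoC (fst (psi (z0 + RtoC t)%C))) 0 x T); auto.
      - intros t Ht eps He.
        destruct (rcont_fst psi _ (cdiff_cont _ _ _ (D1 _ (HH t ltac:(lra)))) eps He) as [d [Hd K]].
        exists d. split; auto. intros s Hs Hst. rewrite <- RtoC_minus, Cmod_R. apply K.
        replace (z0 + RtoC s - (z0 + RtoC t))%C with (RtoC (s - t)) by (rewrite RtoC_minus; ring).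
        rewrite Cmod_R. auto.
      - replace (RtoC (fst (psi (z0 + RtoC 0)%C)) - 0)%C with (RtoC x1).
        + rewrite Cmod_R, Rabs_pos_eq by lra. lra.
        + replace (z0 + RtoC 0)%C with z0 by ring. rewrite Hpsi. simpl. ring.
      - intros t Ht E. replace (RtoC (fst (psi (z0 + RtoC t)%C)) - 0)%C
          with (RtoC (fst (psi (z0 + RtoC t)%C))) in E by ring.
        rewrite Cmod_R, Rabs_pos_eq in E by (left; apply D3, HH; lra).
        apply Hno. exists (z0 + RtoC t)%C. split; auto. apply HH; lra. }
    replace (RtoC (fst (psi (z0 + RtoC T)%C)) - 0)%C with (RtoC (fst (psi (z0 + RtoC T)%C))) in S by ring.
    rewrite Cmod_R, Rabs_pos_eq in S by (left; apply D3, HH; lra).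
    specialize (Gr _ (HH T HT)). simpl in Gr. unfold halfplane in Hz0.
    assert (INR k * (fst (psi (z0 + RtoC T)%C) + PI) <= INR k * (x + PI)) by (apply Rmult_le_compat_l; lra).
    unfold T in *. lra. }
  destruct Hit as [z1 [Hz1 Ex]].
  destruct (vertical_line_lift f df L x (snd (psi z1)) psi dpsi z1) as [mu [_ Hmu]]; auto.
  { rewrite <- Ex. apply surjective_pairing. }
  (* Every point of the circle is [cexp] of a point of the line, where [f] has the logarithm [mu t];
     [Gr] bounds its real part linearly in [x]. *)
  intros w Hw. destruct (cexp_surj_near w (x, snd (psi z1))) as [t [_ Et]]; auto.
  destruct (Hmu t) as [B1 [B2 B3]].
  replace ((x, snd (psi z1)) + (0, t))%C with (x, snd (psi z1) + t) in Et
    by (unfold Cplus; simpl; f_equal; ring).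
  rewrite Et in B3. rewrite <- B3, Cmod_cexp. specialize (Gr _ B1). rewrite B2 in Gr. simpl in Gr.
  rewrite <- exp_INR_mult, <- exp_plus.
  assert (Q : fst (mu t) <= L + INR k * PI + INR k * x) by lra.
  destruct Q as [Q| ->]; [left; apply exp_increasing; auto | lra].
Qed.

(** * Bloch's theorem and the expansion estimate *)

Lemma rcont_mult (u v : C -> R) (z : C) : rcont u z -> rcont v z -> rcont (fun w => u w * v w) z.
Proof.
  intros Hu Hv eps He. set (A := Rabs (u z) + 1). set (B := Rabs (v z) + 1).
  assert (HA : 0 < A) by (unfold A; pose proof (Rabs_pos (u z)); lra).
  assert (HB : 0 < B) by (unfold B; pose proof (Rabs_pos (v z)); lra).
  destruct (Hu (Rmin 1 (eps / (2 * B)))) as [d1 [Hd1 K1]].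
  { apply Rmin_glb_lt; [lra | apply Rdiv_lt_0_compat; lra]. }
  destruct (Hv (eps / (2 * A))) as [d2 [Hd2 K2]]; [apply Rdiv_lt_0_compat; lra|].
  exists (Rmin d1 d2). split; [apply Rmin_glb_lt; auto|]. intros w Hw.
  specialize (K1 w (Rlt_le_trans _ _ _ Hw (Rmin_l _ _))).
  specialize (K2 w (Rlt_le_trans _ _ _ Hw (Rmin_r _ _))).
  assert (K3 := Rlt_le_trans _ _ _ K1 (Rmin_l _ _)).
  assert (K4 := Rlt_le_trans _ _ _ K1 (Rmin_r _ _)).
  replace (u w * v w - u z * v z) with (u w * (v w - v z) + (u w - u z) * v z) by ring.
  eapply Rle_lt_trans; [apply Rabs_triang|]. rewrite !Rabs_mult.
  assert (U : Rabs (u w) < A).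
  { replace (u w) with ((u w - u z) + u z) by ring.
    eapply Rle_lt_trans; [apply Rabs_triang|]. unfold A. lra. }
  apply Rlt_div_r in K2; [|lra]. apply Rlt_div_r in K4; [|lra].
  pose proof (Rabs_pos (v w - v z)). pose proof (Rabs_pos (u w - u z)).
  pose proof (Rabs_pos (u w)). pose proof (Rabs_pos (v z)).
  assert (Rabs (u w) * Rabs (v w - v z) <= A * Rabs (v w - v z)) by (apply Rmult_le_compat_r; lra).
  assert (Rabs (u w - u z) * Rabs (v z) <= Rabs (u w - u z) * B)
    by (apply Rmult_le_compat_l; [auto | unfold B; lra]).
  lra.
Qed.

(* Bloch's theorem: maximise [|h'(z)| (rho/2 - |z - a|)] and apply the quantitative
   open mapping theorem at the maximum. *)
Lemma bloch (h dh : C -> C) (a : C) (rho : R) : 0 < rho -> holo h dh a rho ->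
  exists p, Cmod (p - a) < rho /\ forall w, Cmod (w - h p) < Cmod (dh a) * rho / 512 ->
    exists z, Cmod (z - a) < rho /\ h z = w.
Proof.
  intros Hr Hh. set (r := rho / 2).
  set (v := fun z => Cmod (dh z) * (r - Cmod (z - a))).
  destruct (disc_max v a r) as [p [Hp1 Hp2]]; [unfold r; lra | |].
  { intros z Hz. apply rcont_mult.
    - apply rcont_Cmod. apply (deriv_cont h dh z (rho - Cmod (z - a))); [unfold r in Hz; lra|].
      apply (holo_sub h dh a z rho); auto. lra.
    - intros eps He. exists eps. split; auto. intros w Hw.
      pose proof (Cmod_sub_triangle w z a). pose proof (Cmod_sub_triangle z w a) as T.
      rewrite (Cmod_sub_sym z w) in T. apply Rabs_def1; lra. }
  exists p. split; [unfold r in *; lra|]. intros w Hw.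
  assert (Va : Cmod (dh a) * r <= v p).
  { specialize (Hp2 a). unfold v in Hp2 at 1. rewrite Cmod_sub_self, Rminus_0_r in Hp2.
    apply Hp2. unfold r; lra. }
  set (A := Cmod (dh p)) in *. set (d := r - Cmod (p - a)).
  assert (EV : v p = A * d) by reflexivity.
  assert (Pos : 0 < Cmod (dh a)).
  { pose proof (Cmod_ge_0 (w - h p)). destruct (Cmod_ge_0 (dh a)) as [|E]; auto. rewrite <- E in Hw. lra. }
  assert (Hd0 : 0 <= d) by (unfold d; lra).
  assert (HA0 : 0 <= A) by apply Cmod_ge_0.
  assert (Hr0 : 0 < r) by (unfold r; lra).
  assert (HAd : 0 < A * d) by nra.
  assert (Hd : 0 < d) by (destruct Hd0 as [|<-]; [auto | lra]).
  assert (HA : 0 < A) by (destruct HA0 as [|E]; [auto | rewrite <- E in HAd; lra]).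
  assert (Hin : forall z, Cmod (z - p) < d -> Cmod (z - a) < r).
  { intros z Hz. pose proof (Cmod_sub_triangle z p a). unfold d in Hz. lra. }
  (* By maximality at [p]: the factor [r - Cmod (z - a)] is still at least [d / 2], so the
     derivative at most doubles. *)
  assert (B2 : forall z, Cmod (z - p) < d / 2 -> Cmod (dh z) <= 2 * A).
  { intros z Hz. pose proof (Hin z ltac:(lra)) as Hza. specialize (Hp2 z ltac:(lra)).
    rewrite EV in Hp2. unfold v in Hp2.
    pose proof (Cmod_sub_triangle z p a) as T.
    assert (Hq : d / 2 <= r - Cmod (z - a)) by (unfold d in *; lra).
    pose proof (Cmod_ge_0 (dh z)).
    assert (Cmod (dh z) * (d / 2) <= A * d) by nra.
    apply Rmult_le_reg_r with (d / 2); lra. }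
  assert (Hhp : holo h dh p (d / 2)).
  { intros z Hz. apply Hh. specialize (Hin z ltac:(lra)). unfold r in *; lra. }
  (* Radius [d / 2] and bound [2 A] give the Lipschitz constant [16 A / d], whence [d / 32]. *)
  assert (Lip : forall z, Cmod (z - p) < d / 32 -> Cmod (dh z - dh p) <= A / 2).
  { intros z Hz. replace (dh z) with (dh (p + (z - p))%C) by (f_equal; ring).
    eapply Rle_trans; [apply (deriv_lipschitz h dh p (z - p)%C (d / 2) (2 * A)); auto; lra|].
    replace (4 * (2 * A) / (d / 2) * Cmod (z - p)) with (16 * A * Cmod (z - p) / d) by (field; lra).
    apply Rle_div_l; [auto|]. nra. }
  assert (Low : forall z, Cmod (z - p) < d / 32 -> A / 2 * Cmod (z - p) <= Cmod (h z - h p)).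
  { intros z Hz.
    assert (K : Cmod ((h z - dh p * z) - (h p - dh p * p)) <= A / 2 * Cmod (z - p)).
    { apply (mean_value_disc (fun z => h z - dh p * z)%C (fun z => dh z - dh p * 1)%C p p z (d / 32)); auto.
      - intros x Hx. apply cdiff_minus; [apply Hhp; lra | apply cdiff_mult_c, cdiff_id].
      - intros x Hx. replace (dh x - dh p * 1)%C with (dh x - dh p)%C by ring. auto.
      - rewrite Cmod_sub_self. lra. }
    pose proof (Cmod_sub_ge (dh p * (z - p)) (h z - h p))%C as T.
    rewrite Cmod_mult in T. fold A in T.
    rewrite (Cmod_sub_sym (dh p * (z - p))%C) in T.
    replace (h z - h p - dh p * (z - p))%C with ((h z - dh p * z) - (h p - dh p * p))%C in T by ring.
    lra. }
  (* At distance [d / 64] the increment is at least [A d / 128], and a disc of half that radius is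
     covered; since [A d] is at least [Cmod (dh a) * rho / 2], the constant is 512. *)
  destruct (disc_cover h p (d / 32) (d / 64) (A * d / 128) w) as [z [Hz1 Hz2]].
  - lra.
  - intros z Hz. eexists. apply Hhp. lra.
  - intros z Hz. specialize (Low z ltac:(lra)). rewrite Hz in Low. lra.
  - rewrite EV in Va. unfold r in Va. lra.
  - exists z. split; auto. specialize (Hin z ltac:(lra)). unfold r in *; lra.
Qed.

(** A larger derivative would put a disc of radius [X + 5] into the image of [psi]. Moving left by
    [X + 1] stays in the image, so the centre lies right of [X]; and since [PI < 5] the disc
    contains a whole vertical period, where some point has [Cmod (f (cexp _)) <= exp L]. *)
Lemma log_inverse_deriv (f : C -> C) (L X : R) (psi dpsi : C -> C) (z : C) :
  log_inverse f L psi dpsi -> 0 <= X ->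
  (forall x, X < x -> exists y, Cmod (f (cexp (x, y))) <= exp L) ->
  halfplane L z -> Cmod (dpsi z) <= 512 * (X + 5) / (fst z - L).
Proof.
  intros [D1 [D2 D3]] HX HB Hz. unfold halfplane in Hz.
  assert (Hin : forall w, Cmod (w - z) < fst z - L -> halfplane L w) by (intros w; apply halfplane_disc).
  apply Rle_div_r; [lra|]. apply Rnot_lt_le. intro Hlt.
  destruct (bloch psi dpsi z (fst z - L)) as [p [Hp1 Hp2]]; [lra | intros w Hw; apply D1; auto |].
  assert (Cov : forall w, Cmod (w - psi p) < X + 5 -> exists z', halfplane L z' /\ psi z' = w).
  { intros w Hw. destruct (Hp2 w) as [z' [Hz1 Hz2]]; [lra|]. exists z'. split; auto. }
  assert (Pos : X < fst (psi p)).
  { destruct (Cov (psi p - RtoC (X + 1))%C) as [z' [Hz1 Hz2]].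
    - replace (psi p - RtoC (X + 1) - psi p)%C with (- RtoC (X + 1))%C by ring.
      rewrite Cmod_opp, Cmod_R, Rabs_pos_eq by lra. lra.
    - specialize (D3 z' Hz1). rewrite Hz2 in D3. simpl in D3. lra. }
  destruct (HB _ Pos) as [y Hy].
  destruct (cexp_surj_near (cexp (fst (psi p), y)) (psi p)) as [t [Ht Et]].
  { rewrite Cmod_cexp. auto. }
  destruct (Cov (psi p + (0, t))%C) as [z' [Hz1 Hz2]].
  - replace (psi p + (0, t) - psi p)%C with ((0, t) - (0, 0))%C.
    + rewrite Cmod_vertical, Rminus_0_r. pose proof PI_4.
      apply Rle_lt_trans with PI; [apply Rabs_le; lra | lra].
    + unfold Cminus, Cplus, Copp. simpl. f_equal; ring.
  - pose proof (D2 z' Hz1) as E. rewrite Hz2, Et in E. rewrite E in Hy.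
    apply halfplane_cexp in Hz1. lra.
Qed.

(* The only consequence of bounded type needed for the dynamics: in logarithmic
   coordinates [f] is uniformly expanding and covers discs of a fixed size. *)
Theorem log_expansion (f : C -> C) : bounded_type f ->
  exists X, forall s0 z0, f (cexp s0) = cexp z0 -> X <= fst z0 ->
    forall z, Cmod (z - z0) <= 10 -> exists s, Cmod (s - s0) <= Cmod (z - z0) / 2 /\ f (cexp s) = cexp z.
Proof.
  intro Hb. destruct (bounded_type_lifts f Hb) as [df [R0 [HR0 [HL H1]]]].
  set (L := ln R0). assert (EL : R0 = exp L) by (unfold L; rewrite exp_ln; lra).
  rewrite EL in HL, H1.
  destruct (bounded_point_on_circle f df L HL H1) as [X [HX HB]].
  { apply Hb. }
  (* The open disc of radius 11 contains the closed one of radius 10, and on it [1024 = 2 * 512]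
     makes the derivative at most 1/2. *)
  exists (L + 11 + 1024 * (X + 5)). intros s0 z0 Hs Hz z Hzz.
  assert (Hz0 : halfplane L z0) by (unfold halfplane; lra).
  destruct (log_inverse_exists f df L s0 z0) as [psi [dpsi [HI Hpsi]]]; auto.
  pose proof HI as [D1 [D2 D3]].
  assert (Hin : forall w, Cmod (w - z0) < 11 -> halfplane L w /\ 1024 * (X + 5) <= fst w - L).
  { intros w Hw. pose proof (fst_bounds (w - z0)%C) as F. simpl in F. unfold halfplane. lra. }
  exists (psi z). split; [|apply D2, Hin; lra].
  rewrite <- Hpsi. replace (Cmod (z - z0) / 2) with (1 / 2 * Cmod (z - z0)) by field.
  apply (mean_value_disc psi dpsi z0 z0 z 11); [| | rewrite Cmod_sub_self; lra | lra].
  - intros w Hw. apply D1, Hin; auto.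
  - intros w Hw. destruct (Hin w Hw) as [I1 I2].
    eapply Rle_trans; [apply (log_inverse_deriv f L X psi dpsi w); auto|].
    apply Rle_div_l; lra.
Qed.

(** * Escaping points *)

Lemma iterate_S (f : C -> C) (n : nat) (z : C) : iterate f (S n) z = f (iterate f n z).
Proof. reflexivity. Qed.

Lemma iterate_add (f : C -> C) (n m : nat) (z : C) : iterate f (n + m) z = iterate f n (iterate f m z).
Proof. unfold iterate. rewrite Nat.iter_add. auto. Qed.

Lemma iterate_comm (f g : C -> C) (n : nat) (z : C) : (forall z, f (g z) = g (f z)) ->
  iterate f n (g z) = g (iterate f n z).
Proof.
  intro H. induction n as [|n IH]; auto. rewrite !iterate_S, IH. auto.
Qed.

Lemma escaping_Cmod (f : C -> C) (z : C) : escaping_set f z <->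
  forall M, exists N, forall n, (N <= n)%nat -> M < Cmod (iterate f n z).
Proof.
  split; intros H M; destruct (H M) as [N HN]; exists N; intros n Hn; specialize (HN n Hn);
    rewrite Cnorm_Cmod in *; auto.
Qed.

Lemma escaping_iterate (f : C -> C) (n : nat) (z : C) :
  escaping_set f (iterate f n z) <-> escaping_set f z.
Proof.
  split; intros H M; destruct (H M) as [N HN].
  - exists (N + n)%nat. intros k Hk. replace k with ((k - n) + n)%nat by lia.
    rewrite iterate_add. apply HN. lia.
  - exists N. intros k Hk. rewrite <- iterate_add. apply HN. lia.
Qed.

(** The contrapositive of [polynomial_growth]. Exponent 2 is enough: in logarithmic coordinates it
    doubles the real part. *)
Lemma transcendental_growth (g : C -> C) : bounded_type g ->
  exists X, forall r, X < r -> exists z, Cmod z = r /\ r ^ 2 < Cmod (g z).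
Proof.
  intro Hg. apply NNPP. intro Hn. pose proof Hg as [[_ Hp] _]. apply Hp.
  apply (polynomial_growth 2 g 1); [apply bounded_type_centire; auto|].
  intro X. apply NNPP. intro Hc. apply Hn. exists X. intros r Hr. apply NNPP. intro Hd.
  apply Hc. exists r. split; auto. intros z Hz. apply Rnot_lt_le. intro. apply Hd.
  exists z. split; auto. lra.
Qed.

(** Some point of the circle through [cexp z] is sent beyond the squared radius. Its logarithm is
    within [PI <= 4] of [z], and pulling back a disc of radius 10 adds at most 5; so the preimages
    stay within 10 and the step can be iterated. *)
Lemma log_disc_cover (g : C -> C) : bounded_type g -> exists X, 1 <= X /\ forall z, X <= fst z ->
  exists z', 2 * fst z <= fst z' /\
    forall w, Cmod (w - z') <= 10 -> exists s, Cmod (s - z) <= 10 /\ g (cexp s) = cexp w.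
Proof.
  intro Hg. destruct (log_expansion g Hg) as [X1 H1]. destruct (transcendental_growth g Hg) as [X2 H2].
  set (X := Rmax 1 (Rmax X1 X2)). assert (M0 : 1 <= X) by apply Rmax_l.
  assert (M1 : X1 <= X) by (eapply Rle_trans; [apply Rmax_l | apply Rmax_r]).
  assert (M2 : X2 <= X) by (eapply Rle_trans; [apply Rmax_r | apply Rmax_r]).
  exists X. split; auto. intros z Hz.
  destruct (H2 (exp (fst z))) as [v [Hv Hgv]]; [pose proof (exp_ineq1_le (fst z)); lra|].
  destruct (cexp_surj_near v z Hv) as [t [Ht Et]].
  assert (Pv : 0 < exp (fst z) ^ 2) by (apply pow_lt, exp_pos).
  destruct (cexp_surj (g v)) as [z' [Ez' Fz']]; [apply Cmod_gt_0; lra|].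
  assert (F : 2 * fst z <= fst z').
  { rewrite Fz'. rewrite <- (ln_exp (2 * fst z)). left. apply ln_increasing; [apply exp_pos|].
    eapply Rle_lt_trans; [|apply Hgv]. right.
    replace (2 * fst z) with (INR 2 * fst z) by (simpl; ring). apply exp_INR_mult. }
  exists z'. split; auto. intros w Hw.
  destruct (H1 (z + (0, t))%C z') with (z := w) as [s [Hs1 Hs2]]; auto.
  { rewrite Et. auto. }
  { lra. }
  exists s. split; auto.
  pose proof (Cmod_sub_triangle s (z + (0, t))%C z) as T.
  replace (z + (0, t) - z)%C with ((0, t) - (0, 0))%C in T
    by (unfold Cminus, Cplus, Copp; simpl; f_equal; ring).
  rewrite Cmod_vertical, Rminus_0_r in T. pose proof PI_4.
  assert (Rabs t <= PI) by (apply Rabs_le; lra). lra.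
Qed.

Lemma ccont_iterate (f : C -> C) (n : nat) (z : C) : centire f -> ccont (iterate f n) z.
Proof.
  intro Hf. induction n as [|n IH].
  - intros eps He. exists eps. split; auto.
  - apply (ccont_comp (iterate f n) f); auto. apply centire_cont; auto.
Qed.

(** Pulling back the centre of the [n]-th disc gives a starting point whose first [n] iterates are
    large; a cluster point of these escapes, because the lower bounds on the moduli are closed
    conditions. *)
Lemma log_disc_meets_escaping (f : C -> C) : bounded_type f ->
  exists X, forall z, X <= fst z -> exists w, Cmod (w - z) <= 10 /\ escaping_set f (cexp w).
Proof.
  intro Hf. destruct (log_disc_cover f Hf) as [X [HX H]]. exists X. intros z0 Hz0.
  destruct (choice (fun z z' => X <= fst z -> 2 * fst z <= fst z' /\
    forall w, Cmod (w - z') <= 10 -> exists s, Cmod (s - z) <= 10 /\ f (cexp s) = cexp w)) as [nx Hnx].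
  { intro z. destruct (classic (X <= fst z)) as [h|h].
    - destruct (H z h) as [z' Hz']. exists z'; auto.
    - exists z. intro; contradiction. }
  set (Z := fun n => Nat.iter n nx z0).
  (* Doubling a real part that is at least 1 gains at least 1 per step. *)
  assert (HZ : forall n, X <= fst (Z n) /\ INR n <= fst (Z n)).
  { induction n as [|n [IH1 IH2]].
    - simpl. split; lra.
    - destruct (Hnx (Z n) IH1) as [K _]. change (Z (S n)) with (nx (Z n)). rewrite S_INR. lra. }
  assert (Cov : forall n w, Cmod (w - Z n) <= 10 -> exists s, Cmod (s - z0) <= 10 /\
    iterate f n (cexp s) = cexp w /\
    forall k, (k <= n)%nat -> exp (fst (Z k) - 10) <= Cmod (iterate f k (cexp s))).
  { induction n as [|n IH]; intros w Hw.
    - exists w. repeat split; auto. intros k Hk. replace k with O by lia. simpl.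
      change (Nat.iter 0 nx z0) with z0 in *. rewrite Cmod_cexp.
      pose proof (fst_bounds (w - z0)%C) as F. simpl in F. change (Z O) with z0 in *.
      destruct (Rle_lt_or_eq_dec (fst z0 - 10) (fst w)) as [h|h]; [lra | left; apply exp_increasing; auto | rewrite h; lra].
    - destruct (HZ n) as [IH1 _]. destruct (Hnx (Z n) IH1) as [_ K].
      change (Z (S n)) with (nx (Z n)) in Hw. destruct (K w Hw) as [s1 [S1 S2]].
      destruct (IH s1 S1) as [s [A1 [A2 A3]]]. exists s.
      assert (E : iterate f (S n) (cexp s) = cexp w) by (rewrite iterate_S, A2; auto).
      repeat split; auto. intros k Hk. destruct (Nat.eq_dec k (S n)) as [->|]; [|apply A3; lia].
      rewrite E, Cmod_cexp. change (Z (S n)) with (nx (Z n)).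
      pose proof (fst_bounds (w - nx (Z n))%C) as F. simpl in F.
      destruct (Rle_lt_or_eq_dec (fst (nx (Z n)) - 10) (fst w)) as [h|h]; [lra | left; apply exp_increasing; auto | rewrite h; lra]. }
  destruct (choice (fun n s => Cmod (s - z0) <= 10 /\
    forall k, (k <= n)%nat -> exp (fst (Z k) - 10) <= Cmod (iterate f k (cexp s)))) as [x Hx].
  { intro n. destruct (Cov n (Z n)) as [s [A1 [_ A3]]]; [rewrite Cmod_sub_self; lra|]. exists s; auto. }
  destruct (C_cluster x (Cmod z0 + 10)) as [l Hl].
  { intro n. destruct (Hx n) as [A _]. pose proof (Cmod_sub_ge (x n) z0). lra. }
  exists l. split.
  - apply disc_closed. intros eps He. destruct (Hl eps He O) as [n [_ Hn]]. exists (x n). split; auto. apply Hx.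
  - apply escaping_Cmod. intro M. destruct (INR_unbounded (M + 10)) as [N HN].
    exists N. intros n Hn. apply le_INR in Hn. destruct (HZ n) as [_ HZn].
    apply Rlt_le_trans with (exp (fst (Z n) - 10)).
    { pose proof (exp_ineq1_le (fst (Z n) - 10)). lra. }
    apply Rnot_lt_le. intro Hlt.
    assert (Hc : ccont (fun s => iterate f n (cexp s)) l).
    { apply (ccont_comp cexp (iterate f n)).
      - apply (cdiff_cont _ _ _ (cdiff_cexp l)).
      - apply ccont_iterate. apply bounded_type_centire; auto. }
    destruct (rcont_Cmod _ _ Hc (exp (fst (Z n) - 10) - Cmod (iterate f n (cexp l)))) as [d [Hd K]]; [lra|].
    destruct (Hl d Hd n) as [m [Hm1 Hm2]]. specialize (K _ Hm2). destruct (Hx m) as [_ A].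
    specialize (A n Hm1). apply Rabs_def2 in K. lra.
Qed.

Lemma iterate_open (f : C -> C) (n : nat) (z : C) (eps : R) : centire f -> nonconst f -> 0 < eps ->
  exists r, 0 < r /\ forall w, Cmod (w - iterate f n z) < r ->
    exists u, Cmod (u - z) < eps /\ iterate f n u = w.
Proof.
  intros Hf HN He. induction n as [|n [r [Hr IH]]].
  - exists eps. split; auto. intros w Hw. exists w. auto.
  - destruct (open_mapping f (iterate f n z) r Hf HN Hr) as [r' [Hr' K]].
    exists r'. split; auto. intros w Hw. destruct (K w Hw) as [v [Hv1 Hv2]].
    destruct (IH v Hv1) as [u [Hu1 Hu2]]. exists u. split; auto. rewrite iterate_S, Hu2. auto.
Qed.

(** From time [N] on, [log_expansion] applies to any choice of logarithms [s n] of the orbit.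
    Pulling back halves distances, so the radius covered doubles at each step until it reaches
    10. *)
Lemma escaping_blow_up (f : C -> C) (z : C) (eps Y : R) : bounded_type f -> escaping_set f z -> 0 < eps ->
  exists n s, Y <= fst s /\ forall w, Cmod (w - s) <= 10 -> exists u, Cmod (u - z) < eps /\ iterate f n u = cexp w.
Proof.
  intros Hf Hz He. destruct (log_expansion f Hf) as [X HX].
  destruct (proj1 (escaping_Cmod f z) Hz (exp (Rmax X Y))) as [N HN].
  destruct (choice (fun n s => (N <= n)%nat -> cexp s = iterate f n z /\ X <= fst s /\ Y <= fst s)) as [s Hs].
  { intro n. destruct (classic (N <= n)%nat) as [h|h].
    - specialize (HN n h). pose proof (exp_pos (Rmax X Y)).
      destruct (cexp_surj (iterate f n z)) as [s [E F]]; [apply Cmod_gt_0; lra|].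
      exists s. intros _. split; auto. rewrite F.
      apply ln_increasing in HN; [|auto]. rewrite ln_exp in HN.
      pose proof (Rmax_l X Y). pose proof (Rmax_r X Y). lra.
    - exists 0%C. intro; contradiction. }
  destruct (iterate_open f N z eps (bounded_type_centire f Hf) (bounded_type_nonconst f Hf) He) as [r [Hr Hop]].
  destruct (Hs N (le_n N)) as [EsN _].
  destruct (cdiff_cont _ _ _ (cdiff_cexp (s N)) r Hr) as [d [Hd Hc]].
  (* The two bounds describe a disc of radius [min (10, 2^k d / 2)]; the cap 10 is the range of
     [log_expansion]. *)
  assert (P : forall (k : nat) (w : C), Cmod (w - s (N + k)%nat) <= 10 -> Cmod (w - s (N + k)%nat) <= 2 ^ k * (d / 2) ->
    exists u, Cmod (u - z) < eps /\ iterate f (N + k) u = cexp w).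
  { induction k as [|k IH]; intros w Hw1 Hw2.
    - rewrite Nat.add_0_r in *. apply Hop. rewrite <- EsN. apply Hc. simpl in Hw2. lra.
    - destruct (Hs (N + k)%nat ltac:(lia)) as [E1 _].
      destruct (Hs (N + S k)%nat ltac:(lia)) as [E2 [F2 _]].
      destruct (HX (s (N + k)%nat) (s (N + S k)%nat)) with (z := w) as [v [Hv1 Hv2]]; auto.
      { rewrite E1, E2. rewrite Nat.add_succ_r. reflexivity. }
      simpl in Hw2.
      destruct (IH v) as [u [Hu1 Hu2]]; [lra | lra |].
      exists u. split; auto. rewrite Nat.add_succ_r, iterate_S, Hu2. auto. }
  destruct (Pow_x_infinity 2) with (b := 20 / d) as [k Hk]; [rewrite Rabs_pos_eq; lra|].
  specialize (Hk k (le_n k)). rewrite Rabs_pos_eq in Hk by (apply pow_le; lra).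
  exists (N + k)%nat, (s (N + k)%nat). split; [apply Hs; lia|].
  intros w Hw. apply P; auto. apply Rge_le in Hk. apply (proj1 (Rle_div_l _ _ _ Hd)) in Hk. lra.
Qed.

(** Since [f^n (g z) = g (f^n z)] and [g] is bounded on every disc, large iterates of [g z] force
    large iterates of [z]. *)
Lemma escaping_of_image (f g : C -> C) (z : C) : centire g -> (forall z, f (g z) = g (f z)) ->
  escaping_set f (g z) -> escaping_set f z.
Proof.
  intros Hg Hc H. apply escaping_Cmod. intro M.
  destruct (disc_max (fun w => Cmod (g w)) 0 (Rmax 0 M)) as [p [_ Hp]]; [apply Rmax_l | |].
  { intros w _. apply rcont_Cmod, centire_cont; auto. }
  destruct (proj1 (escaping_Cmod f (g z)) H (Cmod (g p))) as [N HN].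
  exists N. intros n Hn. specialize (HN n Hn). rewrite iterate_comm in HN by auto.
  apply Rnot_le_lt. intro Hle.
  assert (Cmod (g (iterate f n z)) <= Cmod (g p)); [|lra].
  assert (E0 : forall x : C, (x - 0)%C = x) by (intro x; ring).
  apply Hp. rewrite E0.
  eapply Rle_trans; [apply Hle | apply Rmax_r].
Qed.

(* Small neighbourhoods of [z] are blown up by [f^n] to large logarithmic discs, whose images
   under [g] contain large logarithmic discs and hence escaping points of [f]. *)
Lemma escaping_image_closure (f g : C -> C) (z : C) (eps : R) : bounded_type f -> bounded_type g ->
  (forall z, f (g z) = g (f z)) -> escaping_set f z -> 0 < eps ->
  exists u, Cmod (u - z) < eps /\ escaping_set f (g u).
Proof.
  intros Hf Hg Hc Hz He.
  destruct (log_disc_cover g Hg) as [Xg [HXg Kg]]. destruct (log_disc_meets_escaping f Hf) as [Xf Kf].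
  destruct (escaping_blow_up f z eps (Rmax Xg Xf) Hf Hz He) as [n [s [Hs Kn]]].
  pose proof (Rmax_l Xg Xf). pose proof (Rmax_r Xg Xf).
  destruct (Kg s ltac:(lra)) as [z' [Fz' Kz']].
  destruct (Kf z' ltac:(lra)) as [w [Hw1 Hw2]].
  destruct (Kz' w Hw1) as [v [Hv1 Hv2]]. destruct (Kn v Hv1) as [u [Hu1 Hu2]].
  exists u. split; auto. apply (escaping_iterate f n). rewrite iterate_comm, Hu2, Hv2 by auto. auto.
Qed.

(** * Closures and complete invariance *)

Lemma closure_Cmod (E : C -> Prop) (z : C) : closure E z <->
  forall eps, 0 < eps -> exists w, E w /\ Cmod (w - z) < eps.
Proof.
  split; intros H eps He; destruct (H eps He) as [w [H1 H2]]; exists w; split; auto;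
    rewrite Cnorm_Csub in *; auto.
Qed.

(** Only points near [w], not [w] itself, are required to be sent into [E]; this is the form that
    [escaping_image_closure] delivers. *)
Lemma closure_image (E : C -> Prop) (g : C -> C) (z : C) : ccont g z ->
  (forall w eps, E w -> 0 < eps -> exists u, Cmod (u - w) < eps /\ E (g u)) ->
  closure E z -> closure E (g z).
Proof.
  intros Hg HE H. rewrite closure_Cmod in *. intros eps He.
  destruct (Hg eps He) as [d [Hd K]]. destruct (H (d / 2) ltac:(lra)) as [w [Hw1 Hw2]].
  destruct (HE w (d / 2) Hw1 ltac:(lra)) as [u [Hu1 Hu2]].
  exists (g u). split; auto. apply K. pose proof (Cmod_sub_triangle u w z). lra.
Qed.

Lemma closure_preimage (E : C -> Prop) (g : C -> C) (z : C) : centire g -> nonconst g ->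
  (forall w, E (g w) -> E w) -> closure E (g z) -> closure E z.
Proof.
  intros Hg HN HE H. rewrite closure_Cmod in *. intros eps He.
  destruct (open_mapping g z eps Hg HN He) as [r [Hr K]]. destruct (H r Hr) as [w [Hw1 Hw2]].
  destruct (K w Hw2) as [u [Hu1 Hu2]]. exists u. split; auto. apply HE. rewrite Hu2. auto.
Qed.

(** The composite is treated one factor at a time. Membership in the escaping set is preserved by
    [f] in both directions; for [g] the backward direction is pointwise, the forward one passes
    through nearby points. *)
Lemma closure_escaping_invariant (f g : C -> C) : bounded_type f -> bounded_type g ->
  (forall z, f (g z) = g (f z)) ->
  completely_invariant (closure (escaping_set f)) (fun z => f (g z)).
Proof.
  intros Hf Hg Hc z.
  pose proof (bounded_type_centire f Hf) as Ef. pose proof (bounded_type_centire g Hg) as Eg.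
  pose proof (bounded_type_nonconst f Hf) as Nf. pose proof (bounded_type_nonconst g Hg) as Ng.
  assert (Sf : forall w, escaping_set f (f w) <-> escaping_set f w) by (intro w; apply (escaping_iterate f 1)).
  split; intro H.
  - apply closure_image; [apply centire_cont; auto | |].
    + intros w eps Hw He. exists w. rewrite Cmod_sub_self. split; auto. apply Sf; auto.
    + apply closure_image; [apply centire_cont; auto | | auto].
      intros w eps Hw He. apply escaping_image_closure; auto.
  - apply (closure_preimage _ g z Eg Ng).
    + intros w. apply escaping_of_image; auto.
    + apply (closure_preimage _ f (g z) Ef Nf); auto. intros w. apply Sf.
Qed.

Theorem theorem4 (f g : Cpx -> Cpx) :
  bounded_type f -> bounded_type g ->
  (forall z, f (g z) = g (f z)) ->
  completely_invariant (closure (escaping_set f)) (fun z => f (g z)) /\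
  completely_invariant (closure (escaping_set g)) (fun z => f (g z)).
Proof.
  intros Hf Hg Hc. split.
  - apply closure_escaping_invariant; auto.
  - intro z. rewrite Hc. apply (closure_escaping_invariant g f Hg Hf (fun w => eq_sym (Hc w))).
Qed.
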